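(* Let $\alpha,\beta_w^+\in(0,1)$ be constants and let $n\to\infty$ with $m=\alpha n$ and $k=\beta_w^+ n$. Let $A$ be an $m\times n$ matrix with i.i.d. standard normal entries. Fix a set $S\subset\{1,\dots,n\}$ with $|S|=k$, and consider $k$-sparse vectors $\mathbf{x}\in\mathbb{R}^n$ with $\mathbf{x}_i=0$ for $i\notin S$ whose nonzero components are a priori known to be positive. For $\mathbf{y}=A\mathbf{x}$ consider $$\min_{\mathbf{u}}\ \|\mathbf{u}\|_1\quad\text{subject to}\quad A\mathbf{u}=\mathbf{y},\ \ \mathbf{u}_i\ge 0\ (1\le i\le n).\qquad(\ast\ast)$$ Let $\epsilon_1^{(c)},\epsilon_2^{(c)},\epsilon_1^{(m)},\epsilon_1^{(g)},\epsilon_3^{(g)}>0$ be arbitrarily small constants independent of $n$. (1) Let $\hat\theta_w^+\in[\beta_w^+,1]$ be the solution of $$(1-\epsilon_1^{(c)})(1-\beta_w^+)\frac{\sqrt{\frac{1}{2\pi}}\,e^{-(\operatorname{erfinv}(2\frac{1-\theta}{1-\beta_w^+}-1))^2}}{\theta}-\sqrt{2}\operatorname{erfinv}\Big(2\frac{(1+\epsilon_1^{(c)})(1-\theta)}{1-\beta_w^+}-1\Big)=0.$$ If $$\alpha>\frac{1-\beta_w^+}{\sqrt{2\pi}}\cdot\frac{\sqrt{2(\operatorname{erfinv}(2\frac{1-\hat\theta_w^+}{1-\beta_w^+}-1))^2}}{e^{(\operatorname{erfinv}(2\frac{1-\hat\theta_w^+}{1-\beta_w^+}-1))^2}}+\hat\theta_w^+-\frac{\left((1-\beta_w^+)\sqrt{\frac{1}{2\pi}}\,e^{-(\operatorname{erfinv}(2\frac{1-\hat\theta_w^+}{1-\beta_w^+}-1))^2}\right)^2}{\hat\theta_w^+},$$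 then with overwhelming probability the solution of $(\ast\ast)$ is the positive $k$-sparse $\mathbf{x}$. (2) Let $\hat\theta_w^+\in[\beta_w^+,1]$ be the solution of $$(1+\epsilon_2^{(c)})(1-\beta_w^+)\frac{\sqrt{\frac{1}{2\pi}}\,e^{-(\operatorname{erfinv}(2\frac{1-\theta}{1-\beta_w^+}-1))^2}}{\theta}-\sqrt{2}\operatorname{erfinv}\Big(2\frac{(1-\epsilon_2^{(c)})(1-\theta)}{1-\beta_w^+}-1\Big)=0.$$ If $$\alpha<\frac{1}{(1+\epsilon_1^{(m)})^2}\left((1-\epsilon_1^{(g)})\Big(\hat\theta_w^++\frac{1-\beta_w^+}{\sqrt{2\pi}}\frac{\sqrt{2(\operatorname{erfinv}(2\frac{1-\hat\theta_w^+}{1-\beta_w^+}-1))^2}}{e^{(\operatorname{erfinv}(2\frac{1-\hat\theta_w^+}{1-\beta_w^+}-1))^2}}\Big)-(1+\epsilon_3^{(g)})^{2}\frac{\left((1-\beta_w^+)\sqrt{\frac{1}{2\pi}}\,e^{-(\operatorname{erfinv}(2\frac{1-\hat\theta_w^+}{1-\beta_w^+}-1))^2}\right)^2}{\hat\theta_w^+}\right),$$ then with overwhelming probability there is a positive $k$-sparse $\mathbf{x}$ with nonzero components located in $S$ that satisfies $A\mathbf{x}=\mathbf{y}$ and is not the solution of $(\ast\ast)$.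
   Context: $\operatorname{erfinv}$ is the inverse of the standard error function $\operatorname{erf}(t)=\frac{2}{\sqrt{\pi}}\int_0^t e^{-s^2}\,ds$. ''With overwhelming probability'' means with probability at least $1-e^{-cn}$ for some constant $c>0$ independent of $n$ (for all large $n$). ''The solution of $(\ast\ast)$ is $\mathbf{x}$'' means $\mathbf{x}$ is the unique minimizer of $(\ast\ast)$. *)

(* Defs.v *)
From HB Require Import structures.
From mathcomp Require Import all_boot all_order all_algebra.
From mathcomp Require Import all_classical all_reals all_analysis.
Set Implicit Arguments. Unset Strict Implicit. Unset Printing Implicit Defensive.
Import Order.TTheory GRing.Theory Num.Theory.
Import numFieldNormedType.Exports.
Local Open Scope classical_set_scope.
Local Open Scope ring_scope.

Section Defs.
Context {R : realType}.

Definition erf (t : R) : R :=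
  (2 / Num.sqrt pi) *
  (if 0 <= t
   then Rintegral lebesgue_measure [set s : R | 0 <= s <= t] (fun s => expR (- s ^+ 2))
   else - Rintegral lebesgue_measure [set s : R | t <= s <= 0] (fun s => expR (- s ^+ 2))).

(* erfinv y = the t with erf t = y (unique for -1 < y < 1; arbitrary otherwise) *)
Definition erfinv (y : R) : R := xget 0 [set t : R | erf t = y].

(* m = alpha n and k = beta n, rounded down to integers *)
Definition nfloor (a : R) (n : nat) : nat := Num.truncn (a * n%:R).

(* Iterated integral against the standard Gaussian N(0,1) of the first N
   coordinates of a real sequence (the remaining coordinates are set to 0):
   giter N f = E[ f(g_0,...,g_{N-1},0,0,...) ] for g_i i.i.d. N(0,1). *)
Definition scons (t : R) (g : nat -> R) : nat -> R :=
  fun i => if i is i'.+1 then g i' else t.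

Fixpoint giter (N : nat) (f : (nat -> R) -> \bar R) : \bar R :=
  match N with
  | 0 => f (fun _ => 0)
  | N'.+1 => (\int[normal_prob 0 1]_t giter N' (fun g => f (scons t g)))%E
  end.

Definition mat_of (m n : nat) (v : nat -> R) : 'M[R]_(m, n) :=
  \matrix_(i < m, j < n) v (i * n + j)%N.

Definition gauss_prob (m n : nat) (E : set 'M[R]_(m, n)) : \bar R :=
  giter (m * n) (fun v => (\1_E (mat_of m n v))%:E).

Definition l1 (n : nat) (u : 'cV[R]_n) : R := \sum_(i < n) `| u i 0 |.

Definition feasible (m n : nat) (A : 'M[R]_(m, n)) (y : 'cV[R]_m) (u : 'cV[R]_n) :=
  A *m u = y /\ forall i, 0 <= u i 0.

Definition is_solution (m n : nat) (A : 'M[R]_(m, n)) (y : 'cV[R]_m) (x : 'cV[R]_n) :=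
  feasible A y x /\ forall u, feasible A y u -> u <> x -> l1 x < l1 u.

Definition pos_supported (n : nat) (S : {set 'I_n}) (x : 'cV[R]_n) :=
  forall i, (i \in S -> 0 < x i 0) /\ (i \notin S -> x i 0 = 0).

Definition earg (c beta theta : R) : R := 2 * ((c * (1 - theta)) / (1 - beta)) - 1.

Definition solves_eq (c1 c2 beta theta : R) : Prop :=
  [/\ beta <= theta <= 1,
      -1 < earg 1 beta theta < 1,
      -1 < earg c2 beta theta < 1 &
      c1 * (1 - beta) * (Num.sqrt (1 / (2 * pi)) * expR (- (erfinv (earg 1 beta theta)) ^+ 2))
        / theta
      - Num.sqrt 2 * erfinv (earg c2 beta theta) = 0].

Definition overwhelming (alpha beta : R)
    (P : forall (n : nat) (S : {set 'I_n}), set 'M[R]_(nfloor alpha n, n)) :=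
  exists c : R, 0 < c /\ exists N : nat, forall n : nat, (N <= n)%N ->
    forall S : {set 'I_n}, #|S| = nfloor beta n ->
      ((1 - expR (- (c * n%:R)))%:E <= gauss_prob (P n S))%E.

Definition recovery_event (m n : nat) (S : {set 'I_n}) : set 'M[R]_(m, n) :=
  [set A | forall x : 'cV[R]_n, pos_supported S x -> is_solution A (A *m x) x].

Definition failure_event (m n : nat) (S : {set 'I_n}) : set 'M[R]_(m, n) :=
  [set A | exists x : 'cV[R]_n, pos_supported S x /\ ~ is_solution A (A *m x) x].

End Defs.
Arguments overwhelming {R} alpha beta P.
Arguments recovery_event {R} m {n} S _.
Arguments failure_event {R} m {n} S _.

(* Main.v *)
(** Put [C = {w : w_i >= 0 off S, sum_i w_i <= 0}]. Every positive [x] supported on [S] is the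
    unique minimiser iff [ker A] meets [C] only at [0], and recovery fails for some [x] as soon
    as [A] maps [C] onto [R^m]. Gordon's comparison of [g0 + z A w] with [z g + w h], where the
    normal variable [g0] equalises the variances, reduces the min-max over unit vectors [z] and
    unit [w] in [C], in either order, to [|g|] against [sup {w h : w in C, |w| = 1}].

    With [t = sqrt 2 * erfinv (earg 1 beta theta)] one has
    [theta = beta + (1 - beta) * gauss_tail t], and [s = (1 - beta) * gauss_pdf t / theta] is a
    Lagrange multiplier of the constraint [sum_i w_i <= 0]. Up to the epsilons both thresholds
    are the mean per coordinate of [(h - s)^2] on [S] and of [(h - s)^2 1_{h > t}] off [S]. In
    part (1) the perturbed equation forces [t < s], so that the truncated [h - s] dominates
    [w h] on [C]; in part (2) it forces [s < t], so that the truncated [h - s'] with [s']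
    slightly above [s] lies in [C]. The sums of functions of [g] and [h] concentrate by
    Chernoff bounds.

    The comparison is proved by Lindeberg replacement for [prod_i (1 - prod_j f (x_ij))] with
    [f] a logistic function, a smooth surrogate of the event that each row [i] has some large
    [x_ij]. *)
Require Import Defs.
From HB Require Import structures.
From mathcomp Require Import all_boot all_order all_algebra.
From mathcomp Require Import all_classical all_reals all_analysis.
From mathcomp Require Import measurable_realfun ring lra.
Set Implicit Arguments. Unset Strict Implicit. Unset Printing Implicit Defensive.
Import Order.TTheory GRing.Theory Num.Theory.
Import numFieldNormedType.Exports.
Local Open Scope classical_set_scope.
Local Open Scope ring_scope.

Section normal_probability.
Context {R : realType}.
Implicit Types (m s : R).
Local Notation mu := (@lebesgue_measure R).

Lemma ge0_integral_normal_prob m s (f : measurableTypeR R -> \bar R) :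
  measurable_fun setT f -> (forall x, 0 <= f x)%E ->
  (\int[normal_prob m s]_x f x = \int[mu]_x (f x * (normal_pdf m s x)%:E))%E.
Proof.
move=> mf f0; have dom := normal_prob_dominates m s.
have mpdf : measurable_fun [set: measurableTypeR R] (fun x => (normal_pdf m s x)%:E).
  by apply/measurable_EFinP; exact: measurable_normal_pdf.
have mRN := Radon_Nikodym_SigmaFinite.f_integrable dom.
rewrite -(Radon_Nikodym_SigmaFinite.change_of_variables dom)//.
apply: ge0_ae_eq_integral => //.
- by apply: emeasurable_funM => //; exact: measurable_int mRN.
- exact: emeasurable_funM.
- by move=> x _; rewrite mule_ge0// Radon_Nikodym_SigmaFinite.f_ge0.
- by move=> x _; rewrite mule_ge0// lee_fin normal_pdf_ge0.
- apply: ae_eqe_mul2l; apply: integral_ae_eq => // E _ mE.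
  by rewrite -Radon_Nikodym_SigmaFinite.f_integral.
Qed.

Lemma ge0_integral_normal_prob_EFin m s (f : R -> R) :
  measurable_fun setT f -> (forall x, 0 <= f x) ->
  (\int[normal_prob m s]_x (f x)%:E = \int[mu]_x (f x * normal_pdf m s x)%:E)%E.
Proof.
by move=> mf f0; rewrite ge0_integral_normal_prob//; exact/measurable_EFinP.
Qed.

End normal_probability.

Section gaussian_mean.
Context {R : realType}.
Implicit Types (f g : R -> R) (x c : R).
Local Notation mu := (@lebesgue_measure R).
Local Notation gamma := (normal_prob (0 : R) 1).

Definition gauss_pdf x : R := normal_pdf 0 1 x.

Lemma gauss_pdf_ge0 x : 0 <= gauss_pdf x.
Proof. exact: normal_pdf_ge0. Qed.

Lemma gauss_pdfE x : gauss_pdf x = (Num.sqrt (2 * pi))^-1 * expR (- x ^+ 2 / 2).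
Proof.
rewrite /gauss_pdf normal_pdfE ?oner_neq0// /normal_peak /normal_fun.
by rewrite expr1n mul1r subr0 mulr_natl.
Qed.

Lemma gauss_pdf_gt0 x : 0 < gauss_pdf x.
Proof.
by rewrite gauss_pdfE mulr_gt0 ?expR_gt0// invr_gt0 sqrtr_gt0 mulr_gt0 ?pi_gt0.
Qed.

Lemma gauss_pdfN x : gauss_pdf (- x) = gauss_pdf x.
Proof. by rewrite !gauss_pdfE sqrrN. Qed.

Lemma measurable_gauss_pdf : measurable_fun setT gauss_pdf.
Proof. exact: measurable_normal_pdf. Qed.

Lemma continuous_gauss_pdf : continuous gauss_pdf.
Proof. by apply: continuous_normal_pdf; exact: oner_neq0. Qed.

Definition gauss_integrable f := gamma.-integrable setT (EFin \o f).
Definition gauss_mean f : R := \int[gamma]_x f x.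

Lemma gauss_integrable_measurable f : gauss_integrable f -> measurable_fun setT f.
Proof. by move=> /measurable_int fi; exact/measurable_EFinP. Qed.

Lemma le_gauss_integrable f g : measurable_fun setT f ->
  (forall x, `|f x| <= g x) -> gauss_integrable g -> gauss_integrable f.
Proof.
move=> mf fg; apply: le_integrable => //; first exact/measurable_EFinP.
by move=> x _; rewrite /= lee_fin (le_trans (fg x))// ler_norm.
Qed.

Lemma gauss_integrable_cst c : gauss_integrable (fun=> c).
Proof. exact: finite_measure_integrable_cst. Qed.

Lemma gauss_integrableD f g : gauss_integrable f -> gauss_integrable g ->
  gauss_integrable (fun x => f x + g x).
Proof. by move=> fi gi; exact: (integrableD measurableT fi gi). Qed.

Lemma gauss_integrableZ c f : gauss_integrable f -> gauss_integrable (fun x => c * f x).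
Proof. by move=> fi; exact: (integrableZl measurableT c fi). Qed.

Lemma gauss_integrable_norm f : gauss_integrable f -> gauss_integrable (fun x => `|f x|).
Proof. by move=> fi; exact: (integrable_norm fi). Qed.

Lemma gauss_integrable_bounded f c : measurable_fun setT f ->
  (forall x, `|f x| <= c) -> gauss_integrable f.
Proof. by move=> mf fc; exact: le_gauss_integrable (gauss_integrable_cst c). Qed.

Lemma integral_gauss_mean f : gauss_integrable f ->
  (\int[gamma]_x (f x)%:E = (gauss_mean f)%:E)%E.
Proof. by move=> fi; rewrite /gauss_mean /Rintegral fineK//; exact: integrable_fin_num. Qed.

Lemma gauss_mean_cst c : gauss_mean (fun=> c) = c.
Proof.
rewrite /gauss_mean Rintegral_cst//.
by rewrite [X in fine X](@probability_setT _ _ _ gamma) mulr1.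
Qed.

Lemma gauss_meanD f g : gauss_integrable f -> gauss_integrable g ->
  gauss_mean (fun x => f x + g x) = gauss_mean f + gauss_mean g.
Proof. by move=> fi gi; exact: (RintegralD measurableT fi gi). Qed.

Lemma gauss_meanZ c f : gauss_integrable f ->
  gauss_mean (fun x => c * f x) = c * gauss_mean f.
Proof. by move=> fi; exact: (RintegralZl c measurableT fi). Qed.

Lemma le_gauss_mean f g : gauss_integrable f -> gauss_integrable g ->
  (forall x, f x <= g x) -> gauss_mean f <= gauss_mean g.
Proof. by move=> fi gi fg; apply: (le_Rintegral measurableT fi gi) => x _; exact: fg. Qed.

Lemma gauss_mean_ge0 f : (forall x, 0 <= f x) -> 0 <= gauss_mean f.
Proof. by move=> f0; apply: Rintegral_ge0. Qed.

Lemma eq_gauss_mean f g : f =1 g -> gauss_mean f = gauss_mean g.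
Proof. by move=> /funext ->. Qed.

Lemma ge0_gauss_integrable f (l : R) : measurable_fun setT f -> (forall x, 0 <= f x) ->
  (\int[gamma]_x (f x)%:E = l%:E)%E -> gauss_integrable f.
Proof.
move=> mf f0 fl; apply/integrableP; split; first exact/measurable_EFinP.
by under eq_integral do rewrite /= ger0_norm//; rewrite fl ltry.
Qed.

Lemma ge0_gauss_mean f (l : R) : (\int[gamma]_x (f x)%:E = l%:E)%E -> gauss_mean f = l.
Proof. by move=> fl; rewrite /gauss_mean /Rintegral fl. Qed.

Lemma gauss_integrable_pdf f : gauss_integrable f ->
  mu.-integrable setT (fun x => (f x * gauss_pdf x)%:E).
Proof.
move=> fi; have mf := gauss_integrable_measurable fi; apply/integrableP; split.
  by apply/measurable_EFinP; apply: measurable_funM => //; exact: measurable_gauss_pdf.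
have /integrableP[_] := fi.
rewrite (ge0_integral_normal_prob_EFin _ _ (f := fun x => `|f x|))//; last first.
  exact: measurableT_comp.
by under [X in _ -> (X < _)%E]eq_integral do
  rewrite abse_EFin normrM (ger0_norm (gauss_pdf_ge0 _)).
Qed.

Lemma gauss_meanE f : gauss_integrable f -> gauss_mean f = \int[mu]_x (f x * gauss_pdf x).
Proof.
move=> fi; have mf := gauss_integrable_measurable fi.
rewrite /gauss_mean /Rintegral; congr fine; rewrite integralE [RHS]integralE.
have mfe : measurable_fun setT (fun x => (f x)%:E) by exact/measurable_EFinP.
congr (_ - _)%E; rewrite ge0_integral_normal_prob//.
- apply: eq_integral => x _ /=; rewrite !funeposE -!EFin_max -EFinM.
  by rewrite maxr_pMl ?gauss_pdf_ge0// mul0r.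
- exact: measurable_funepos.
- apply: eq_integral => x _ /=; rewrite !funenegE -!EFinN -!EFin_max -EFinM.
  by rewrite maxr_pMl ?gauss_pdf_ge0// mul0r mulNr.
- exact: measurable_funeneg.
Qed.

Lemma normal_prob_oppr (A : set (measurableTypeR R)) : measurable A ->
  gamma (-%R @^-1` A) = gamma A.
Proof.
move=> mA; rewrite /normal_prob [RHS](@eq_measure_integral _ _ _ _
    (pushforward mu (-%R : measurableTypeR R -> measurableTypeR R))); last first.
  by move=> B mB _; exact/esym/lebesgue_measureN.
rewrite ge0_integral_pushforward//.
- by apply: eq_integral => x _ /=; rewrite -[RHS]/((gauss_pdf (- x))%:E) gauss_pdfN.
- by apply/measurable_EFinP; apply: measurable_funTS; exact: measurable_gauss_pdf.
- by move=> x _; rewrite lee_fin normal_pdf_ge0.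
Qed.

Lemma gauss_integrableN f : gauss_integrable f -> gauss_integrable (fun x => f (- x)).
Proof.
move=> fi; have mf := gauss_integrable_measurable fi; apply/integrableP; split.
  by apply/measurable_EFinP; apply: measurableT_comp => //; exact: oppr_measurable.
have /integrableP[_] := fi; apply: le_lt_trans.
rewrite [leRHS](@eq_measure_integral _ _ _ _
    (pushforward gamma (-%R : measurableTypeR R -> measurableTypeR R))); last first.
  by move=> B mB _; rewrite -[LHS]normal_prob_oppr.
rewrite ge0_integral_pushforward//.
by apply: measurableT_comp => //; exact/measurable_EFinP.
Qed.

Lemma gauss_meanN f : gauss_integrable f -> gauss_mean (fun x => f (- x)) = gauss_mean f.
Proof.
move=> fi; have mf := gauss_integrable_measurable fi.
rewrite [RHS]/gauss_mean /Rintegral [in RHS](@eq_measure_integral _ _ _ _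
    (pushforward gamma (-%R : measurableTypeR R -> measurableTypeR R))); last first.
  by move=> B mB _; rewrite -[LHS]normal_prob_oppr.
rewrite integral_pushforward//; first exact/measurable_EFinP.
exact: gauss_integrableN.
Qed.

End gaussian_mean.

Section gaussian_exponential_moments.
Context {R : realType}.
Implicit Types (f : R -> R) (x a C D : R).
Local Notation mu := (@lebesgue_measure R).
Local Notation gamma := (normal_prob (0 : R) 1).

Lemma integral_expR_gauss a :
  (\int[gamma]_x (expR (a * x))%:E = (expR (a ^+ 2 / 2))%:E)%E.
Proof.
rewrite ge0_integral_normal_prob_EFin => [||x]; last exact: expR_ge0; last first.
  by apply: measurableT_comp => //; exact: measurable_funM.
transitivity (\int[mu]_x ((expR (a ^+ 2 / 2))%:E * (normal_pdf a 1 x)%:E))%E.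
  apply: eq_integral => x _; rewrite -EFinM -/(gauss_pdf x) gauss_pdfE; congr EFin.
  rewrite normal_pdfE ?oner_neq0// /normal_peak /normal_fun.
  rewrite expr1n mul1r -(mulr_natl pi) mulrCA [RHS]mulrCA; congr (_ * _).
  by rewrite -!expRD; congr expR; field.
rewrite ge0_integralZl//.
- by rewrite integral_normal_pdf mule1.
- by apply/measurable_EFinP; exact: measurable_normal_pdf.
- by move=> x _; rewrite lee_fin normal_pdf_ge0.
Qed.

Lemma gauss_integrable_expR a : gauss_integrable (fun x => expR (a * x)).
Proof.
apply: (ge0_gauss_integrable _ _ (integral_expR_gauss a)) => [|x]; last exact: expR_ge0.
by apply: measurableT_comp => //; exact: measurable_funM.
Qed.

Lemma gauss_mean_expR a : gauss_mean (fun x => expR (a * x)) = expR (a ^+ 2 / 2).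
Proof. exact/ge0_gauss_mean/integral_expR_gauss. Qed.

Lemma gauss_integrable_expR_norm a : gauss_integrable (fun x => expR (a * `|x|)).
Proof.
apply: (@le_gauss_integrable _ _ (fun x => expR (a * x) + expR ((- a) * x))).
- by apply: measurableT_comp => //; exact: measurable_funM.
- move=> x; rewrite ger0_norm ?expR_ge0//.
  have [x0|x0] := ger0P x; first by rewrite lerDl expR_ge0.
  by rewrite mulrN mulNr lerDr expR_ge0.
- by apply: gauss_integrableD; exact: gauss_integrable_expR.
Qed.

Lemma gauss_integrable_le_expR f C D : measurable_fun setT f ->
  (forall x, `|f x| <= C * expR (D * `|x|)) -> gauss_integrable f.
Proof.
move=> mf fC; apply: (le_gauss_integrable mf fC).
by apply: gauss_integrableZ; exact: gauss_integrable_expR_norm.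
Qed.

Lemma gauss_integrable_expn n : gauss_integrable (fun x => x ^+ n).
Proof.
apply: (@gauss_integrable_le_expR _ 1 n%:R) => [|x].
  exact: exprn_measurable.
rewrite mul1r normrX expRM_natl lerXn2r ?nnegrE ?expR_ge0//.
by apply: le_trans (expR_ge1Dx _); rewrite lerDr.
Qed.

Lemma gauss_integrable_id : gauss_integrable (fun x : R => x).
Proof. exact: (gauss_integrable_expn 1). Qed.

Lemma gauss_integrable_expR_sqr : gauss_integrable (fun x : R => expR (x ^+ 2 / 4)).
Proof.
have mE : measurable_fun setT (fun x : R => expR (x ^+ 2 / 4)).
  by apply: measurableT_comp => //; exact: measurable_funM.
apply: (@ge0_gauss_integrable _ _ (Num.sqrt 2) mE (fun x => expR_ge0 _)).
rewrite ge0_integral_normal_prob_EFin//.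
transitivity (\int[mu]_x ((Num.sqrt 2)%:E * (normal_pdf 0 (Num.sqrt 2) x)%:E))%E.
  apply: eq_integral => x _; rewrite -EFinM -/(gauss_pdf x) gauss_pdfE; congr EFin.
  rewrite normal_pdfE// /normal_peak /normal_fun sqr_sqrtr// mulrCA -expRD mulrA.
  rewrite -(mulr_natl (2 * pi) 2) [X in _ = _ / X * _]sqrtrM// invfM mulrA divff// mul1r.
  by congr (_ * expR _); rewrite subr0 mulr2n; field.
rewrite ge0_integralZl//.
- by rewrite integral_normal_pdf mule1.
- by apply/measurable_EFinP; exact: measurable_normal_pdf.
- by move=> x _; rewrite lee_fin normal_pdf_ge0.
Qed.

End gaussian_exponential_moments.

Section gaussian_tail.
Context {R : realType}.
Implicit Types (f F p : R -> R) (x t T : R).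
Local Notation mu := (@lebesgue_measure R).

Lemma Rintegral_continuous_FTC2y f F t T (l : R) :
  mu.-integrable `[t, +oo[ (EFin \o f) -> continuous f ->
  (forall x, is_derive x 1 F (f x)) -> F x @[x --> +oo] --> l -> t < T ->
  (forall x, T <= x -> 0 <= f x) -> \int[mu]_(x in `[t, +oo[) f x = l - F t.
Proof.
move=> fi cf dF Fl tT f0.
have cF : continuous F.
  by move=> x; apply: differentiable_continuous; apply/derivable1_diffP; case: (dF x).
have F'E x : derive1 F x = f x by rewrite derive1E derive_val.
have tTE : `[t, +oo[%classic = `[t, T] `|` `]T, +oo[ :> set (measurableTypeR R).
  by apply: itv_bndbnd_setU; rewrite bnd_simp// ltW.
have disj : [disjoint (`[t, T]%classic : set (measurableTypeR R)) & `]T, +oo[%classic].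
  rewrite disj_set2E; apply/eqP; rewrite -subset0 => x []/= /[!in_itv]/=.
  by move=> /andP[_ xT] /andP[]; rewrite ltNge xT.
rewrite tTE Rintegral_setU//; last by rewrite -tTE.
have -> : \int[mu]_(x in `[t, T]) f x = F T - F t.
  rewrite /Rintegral (@continuous_FTC2 _ f F)//; first exact: continuous_subspaceT.
  by split => //; [exact/cvg_at_right_filter/cF|exact/cvg_at_left_filter/cF].
rewrite Rintegral_itv_obnd_cbnd; last first.
  apply: integrableS fi => // x /=; rewrite !in_itv/= !andbT => /ltW.
  by apply: le_trans; exact: ltW.
rewrite (Rintegral_ge0_continuous_FTC2y (F := F) (l := l))//.
- by rewrite addrC addrA subrK.
- exact: continuous_subspaceT.
- exact/cvg_at_right_filter/cF.
Qed.

Lemma is_derive_gauss_pdf x : is_derive x 1 gauss_pdf (- x * gauss_pdf x).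
Proof.
rewrite (_ : gauss_pdf = fun y => (Num.sqrt (2 * pi))^-1 * expR (- y ^+ 2 / 2)); last first.
  by apply/funext => y; rewrite gauss_pdfE.
by apply: is_derive_eq; rewrite /GRing.scale/=; field; rewrite gt_eqF// sqrtr_gt0 mulr_gt0 ?pi_gt0.
Qed.

Lemma cvg_id_gauss_pdf : x * gauss_pdf x @[x --> +oo] --> (0 : R).
Proof.
apply: (@squeeze_cvgr _ _ _ _ (fun=> 0) (fun x => (Num.sqrt (2 * pi))^-1 * (2 * x^-1))).
- near=> x; have x0 : 0 < x by near: x; exact: nbhs_pinfty_gt.
  rewrite mulr_ge0 ?gauss_pdf_ge0 ?(ltW x0)//= gauss_pdfE mulrCA.
  rewrite ler_wpM2l ?invr_ge0 ?sqrtr_ge0// mulNr expRN ler_pdivrMr ?expR_gt0//.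
  have xE : x = 2 * x^-1 * (x ^+ 2 / 2) by field; rewrite gt_eqF.
  rewrite [leLHS]xE ler_wpM2l// ?mulr_ge0 ?invr_ge0 ?(ltW x0)//.
  by apply: le_trans (expR_ge1Dx _); rewrite lerDr.
- exact: cvg_cst.
- rewrite -[X in _ --> X](mulr0 (Num.sqrt (2 * pi))^-1).
  apply: cvgM; first exact: cvg_cst.
  rewrite -[X in _ --> X](mulr0 2).
  apply: cvgM; first exact: cvg_cst.
  by apply/gtr0_cvgV0; [exact: nbhs_pinfty_gt|exact: cvg_id].
Unshelve. all: by end_near. Qed.

Lemma cvg_gauss_pdf : gauss_pdf x @[x --> +oo] --> (0 : R).
Proof.
apply: (@squeeze_cvgr _ _ _ _ (fun=> 0) (fun x => x * gauss_pdf x)).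
- near=> x; have x1 : 1 <= x by near: x; exact: nbhs_pinfty_ge.
  by rewrite gauss_pdf_ge0/= ler_peMl// gauss_pdf_ge0.
- exact: cvg_cst.
- exact: cvg_id_gauss_pdf.
Unshelve. all: by end_near. Qed.

Definition heaviside t x : R := (t < x)%R%:R.

Lemma heaviside_ge0 t x : 0 <= heaviside t x.
Proof. exact: ler0n. Qed.

Lemma heaviside_le1 t x : heaviside t x <= 1.
Proof. by rewrite /heaviside; case: ltP. Qed.

Lemma heavisideE t : heaviside t = \1_(`]t, +oo[%classic).
Proof. by apply/funext => x; rewrite indicE mem_setE in_itv/= andbT. Qed.

Lemma measurable_heaviside t : measurable_fun setT (heaviside t).
Proof. by rewrite heavisideE; exact: measurable_indic. Qed.

Lemma gauss_integrable_heavisideM t f : gauss_integrable f ->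
  gauss_integrable (fun x => heaviside t x * f x).
Proof.
move=> fi; apply: le_gauss_integrable (gauss_integrable_norm fi).
  apply: measurable_funM; first exact: measurable_heaviside.
  exact: gauss_integrable_measurable.
move=> x; rewrite normrM ger0_norm ?heaviside_ge0//.
by rewrite ler_piMl// heaviside_le1.
Qed.

Lemma gauss_mean_heaviside p F t T (l : R) : continuous p -> gauss_integrable p ->
  (forall x, is_derive x 1 F (p x * gauss_pdf x)) -> F x @[x --> +oo] --> l ->
  (forall x, T <= x -> 0 <= p x) ->
  gauss_mean (fun x => heaviside t x * p x) = l - F t.
Proof.
move=> cp ip dF Fl p0.
have cpg : continuous (fun x => p x * gauss_pdf x).
  by move=> x; apply: cvgM; [exact: cp|exact: continuous_gauss_pdf].
rewrite gauss_meanE; last exact: gauss_integrable_heavisideM.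
transitivity (\int[mu]_(x in `]t, +oo[) (p x * gauss_pdf x)).
  rewrite [RHS]Rintegral_mkcond; apply: eq_Rintegral => x _.
  by rewrite patchE mem_setE in_itv/= andbT /heaviside; case: (t < x); rewrite ?mul1r ?mul0r.
rewrite Rintegral_itv_obnd_cbnd; last exact: integrableS (gauss_integrable_pdf ip).
apply: (@Rintegral_continuous_FTC2y _ F t (Num.max t T + 1)) => //.
- exact: integrableS (gauss_integrable_pdf ip).
- by rewrite ltr_pwDr// le_max lexx.
- move=> x Tx; rewrite mulr_ge0 ?gauss_pdf_ge0// p0//.
  by apply: le_trans Tx; rewrite -[leLHS]addr0 lerD// le_max lexx orbT.
Qed.

Lemma gauss_mean_heaviside_id t : gauss_mean (fun x => heaviside t x * x) = gauss_pdf t.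
Proof.
transitivity (0 - - gauss_pdf t); last by rewrite sub0r opprK.
apply: (@gauss_mean_heaviside id (fun y => - gauss_pdf y) t 0) => //.
- by move=> x; exact: cvg_id.
- exact: gauss_integrable_id.
- move=> x; have dpdf := is_derive_gauss_pdf x.
  by apply: is_derive_eq; rewrite mulNr opprK.
- by rewrite -oppr0; apply: cvgN; exact: cvg_gauss_pdf.
Qed.

Definition gauss_tail t : R := gauss_mean (heaviside t).

Lemma gauss_integrable_heaviside t : gauss_integrable (heaviside t).
Proof.
apply: (@gauss_integrable_bounded _ _ 1); first exact: measurable_heaviside.
by move=> x; rewrite ger0_norm ?heaviside_ge0 ?heaviside_le1.
Qed.

Lemma gauss_mean_heaviside_sqr t :
  gauss_mean (fun x => heaviside t x * x ^+ 2) = gauss_tail t + t * gauss_pdf t.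
Proof.
have isqr := @gauss_integrable_expn R 2.
have isqrB1 : gauss_integrable (fun x : R => x ^+ 2 + (-1)).
  by apply: gauss_integrableD => //; exact: gauss_integrable_cst.
transitivity (gauss_mean (fun x => heaviside t x * (x ^+ 2 + (-1)) + heaviside t x)).
  by apply: eq_gauss_mean => x; ring.
rewrite gauss_meanD; [|exact: gauss_integrable_heavisideM|exact: gauss_integrable_heaviside].
rewrite addrC; congr (_ + _).
transitivity (0 - - (t * gauss_pdf t)); last by rewrite sub0r opprK.
apply: (@gauss_mean_heaviside _ (fun y => - (y * gauss_pdf y)) t 1) => //.
- by move=> x; apply: cvgD; [exact: exprn_continuous|exact: cvg_cst].
- move=> x; have dpdf := is_derive_gauss_pdf x.
  by apply: is_derive_eq; rewrite /GRing.scale/=; ring.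
- by rewrite -oppr0; apply: cvgN; exact: cvg_id_gauss_pdf.
- by move=> x x1; rewrite subr_ge0 exprn_ege1.
Qed.

Lemma gauss_mean_set1 t : gauss_mean \1_[set t] = 0.
Proof.
by apply: ge0_gauss_mean; rewrite integral_indic//= setIT; exact: integral_set1.
Qed.

Lemma gauss_tailN t : gauss_tail (- t) = 1 - gauss_tail t.
Proof.
have i1 : gauss_integrable \1_[set t].
  by apply: (@gauss_integrable_bounded _ _ 1) => // x; rewrite ger0_norm.
have ih := gauss_integrable_heaviside t.
have iZ := gauss_integrableZ (-1) (gauss_integrableD ih i1).
transitivity (gauss_mean (fun x => 1 + (-1) * (heaviside t x + \1_[set t] x))).
  rewrite -[LHS]gauss_meanN; last exact: gauss_integrable_heaviside.
  apply: eq_gauss_mean => x; rewrite /heaviside ltrN2 indicE.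
  have -> : (x \in [set t]) = (x == t) by apply/idP/eqP; rewrite inE.
  by case: ltgtP => _; rewrite /=; ring.
rewrite gauss_meanD//; last exact: gauss_integrable_cst.
rewrite gauss_mean_cst gauss_meanZ; last exact: gauss_integrableD.
by rewrite gauss_meanD// gauss_mean_set1 addr0 mulN1r.
Qed.

Lemma gauss_tail0 : gauss_tail 0 = 2^-1.
Proof. by have := gauss_tailN 0; rewrite oppr0; lra. Qed.

Lemma gauss_mean_id : gauss_mean (fun x : R => x) = 0.
Proof.
have := gauss_meanN (@gauss_integrable_id R).
rewrite (eq_gauss_mean (g := fun x => (-1) * x)) ?gauss_meanZ; first by lra.
  exact: gauss_integrable_id.
by move=> x; rewrite mulN1r.
Qed.

Lemma gauss_mean_sqr : gauss_mean (fun x : R => x ^+ 2) = 1.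
Proof.
have ih := gauss_integrable_heavisideM 0 (@gauss_integrable_expn R 2).
transitivity (gauss_mean (fun x : R =>
    heaviside 0 x * x ^+ 2 + heaviside 0 (- x) * (- x) ^+ 2)).
  apply: eq_gauss_mean => x; rewrite /heaviside oppr_gt0 sqrrN.
  by case: ltgtP => [_|_|<-] /=; ring.
rewrite gauss_meanD//; last exact: gauss_integrableN ih.
rewrite (gauss_meanN ih) gauss_mean_heaviside_sqr mul0r addr0 gauss_tail0; lra.
Qed.

End gaussian_tail.

Section gaussian_fubini.
Context {R : realType}.
Implicit Types (f : R -> R) (x y s t u a b C : R).
Local Notation mu := (@lebesgue_measure R).
Local Notation gamma := (normal_prob (0 : R) 1).
Local Notation RM := (measurableTypeR R).

(* The continuous variable is rounded down to a multiple of [1 / n.+1]. *)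
Lemma measurable_fun_caratheodory (F : R -> R -> R) :
  (forall y, continuous (F ^~ y)) -> (forall x, measurable_fun setT (F x)) ->
  measurable_fun [set: RM * RM] (fun p => F p.1 p.2).
Proof.
move=> cF mF.
pose q (n : nat) x : R := (Num.floor (n.+1%:R * x))%:~R / n.+1%:R.
apply: (@measurable_fun_cvg _ _ _ _ (fun n p => F (q n p.1) p.2)).
- move=> n _ B mB; rewrite setTI.
  pose I (k : int) : set RM := `[k%:~R / n.+1%:R, (k + 1)%:~R / n.+1%:R[%classic.
  rewrite (_ : _ @^-1` B = \bigcup_(k : int) (I k `*` (F (k%:~R / n.+1%:R) @^-1` B))).
    apply: countable_bigcupT_measurable; first exact: countableP.
    move=> k; apply: measurableX; first exact: measurable_itv.
    by rewrite -[X in measurable X]setTI; exact: mF.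
  apply/seteqP; split => [[x y] /= Bxy|[x y] [k _ [/=]]].
    exists (Num.floor (n.+1%:R * x)) => //; split => //=.
    rewrite /I/= in_itv/= ler_pdivrMr// ltr_pdivlMr// mulrC ge_floor/=.
    exact: floorD1_gt.
  rewrite /I/= in_itv/= ler_pdivrMr// ltr_pdivlMr// => kx.
  by rewrite /q (_ : Num.floor _ = k)//; apply: floor_def; rewrite mulrC.
- move=> [x y] _ /=.
  apply: (cvg_comp (q ^~ x) (F ^~ y)); last exact: cF.
  apply: (@squeeze_cvgr _ _ _ _ (fun n => x - n.+1%:R^-1) (fun=> x)).
  + near=> n; rewrite /q ler_pdivlMr// mulrBl mulVf// lerBlDr ler_pdivrMr//.
    rewrite [x * _]mulrC ge_floor andbT.
    by have := floorD1_gt (n.+1%:R * x); rewrite intrD => /ltW.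
  + rewrite -[X in _ --> X]subr0; apply: cvgB; first exact: cvg_cst.
    exact: cvg_harmonic.
  + exact: cvg_cst.
Unshelve. all: by end_near. Qed.

Section bounded.
Variables (F : RM * RM -> R) (C : R).
Hypotheses (mF : measurable_fun setT F) (FC : forall p, `|F p| <= C).

Let integrable_section1 x : gauss_integrable (fun y => F (x, y)).
Proof.
apply: (gauss_integrable_bounded (c := C)) => //.
by apply: (measurableT_comp mF); exact: measurable_pair1.
Qed.

Let integrable_section2 y : gauss_integrable (fun x => F (x, y)).
Proof.
apply: (gauss_integrable_bounded (c := C)) => //.
by apply: (measurableT_comp mF); exact: measurable_pair2.
Qed.

Let integrable_prod : (gamma \x gamma)%E.-integrable setT (EFin \o F).
Proof.
apply: measurable_bounded_integrable => //.
  rewrite -setXTT /= [X in (X < _)%E](@product_measure1E _ _ RM RM R gamma gamma)//.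
  have gammaT := @probability_setT _ _ _ gamma.
  by rewrite [X in (X * _)%E]gammaT [X in (_ * X)%E]gammaT mule1 ltry.
exists C; split; first exact: num_real.
by move=> M /ltW CM p _; exact: le_trans CM.
Qed.

Lemma measurable_gauss_mean : measurable_fun setT (fun x => gauss_mean (fun y => F (x, y))).
Proof.
apply: (@measurableT_comp _ _ _ _ _ _ fine); first exact: fine_measurable.
exact: measurable_fubini_F integrable_prod.
Qed.

Lemma gauss_mean_swap : gauss_mean (fun x => gauss_mean (fun y => F (x, y))) =
  gauss_mean (fun y => gauss_mean (fun x => F (x, y))).
Proof.
have := Fubini integrable_prod; rewrite /fubini_F /fubini_G.
under eq_integral do rewrite /= (integral_gauss_mean (integrable_section1 _)).
under [X in _ = X -> _]eq_integral do
  rewrite /= (integral_gauss_mean (integrable_section2 _)).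
by rewrite /gauss_mean /Rintegral => ->.
Qed.

End bounded.

Lemma continuous_affine a b : continuous (fun x : R => a * x + b).
Proof. by move=> x; apply: cvgD; [exact: mulrl_continuous|exact: cvg_cst]. Qed.

Lemma is_derive_affine a b x : is_derive x 1 (fun x : R => a * x + b) a.
Proof. by apply: is_derive_eq; rewrite /GRing.scale/=; ring. Qed.

Lemma normal_pdf_affine a t s : 0 < a -> a * normal_pdf t a (a * s + t) = gauss_pdf s.
Proof.
move=> a0; rewrite gauss_pdfE normal_pdfE ?gt_eqF// /normal_peak /normal_fun.
rewrite -[_ *+ 2]mulr_natr -mulrA sqrtrM ?sqr_ge0// sqrtr_sqr (gtr0_norm a0).
rewrite invfM !mulrA divff ?gt_eqF// mul1r (mulrC pi); congr (_ * expR _).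
by rewrite addrK -mulr_natr; field; rewrite gt_eqF.
Qed.

Lemma ge0_integral_gauss_affine f a t : continuous f -> (forall x, 0 <= f x) -> 0 < a ->
  (\int[gamma]_s (f (a * s + t))%:E = \int[mu]_u (f u * normal_pdf t a u)%:E)%E.
Proof.
move=> cf f0 a0.
have aff' : derive1 (fun s => a * s + t) = cst a.
  by apply/funext => x; rewrite derive1E; have := is_derive_affine a t x => d; rewrite derive_val.
rewrite ge0_integral_normal_prob_EFin; last 2 first.
- apply: measurableT_comp; apply: continuous_measurable_fun; first exact: cf.
  exact: continuous_affine.
- by move=> s; exact: f0.
rewrite (@increasing_ge0_integration_by_substitutionT _ (fun s => a * s + t)
  (fun u => f u * normal_pdf t a u))//.
- apply: eq_integral => s _; congr EFin; rewrite aff'.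
  rewrite -[RHS]/(f (a * s + t) * normal_pdf t a (a * s + t) * a).
  by rewrite -mulrA [_ * a]mulrC normal_pdf_affine.
- by move=> x y xy; rewrite ltrD2r ltr_pM2l.
- by rewrite aff' => x; exact: cvg_cst.
- by rewrite aff'; exact: is_cvg_cst.
- by rewrite aff'; exact: is_cvg_cst.
- apply/cvgrNyPle => A; near=> x; rewrite -lerBrDr mulrC -ler_pdivlMr//.
- apply/cvgryPge => A; near=> x; rewrite -lerBlDr mulrC -ler_pdivrMr//.
- move=> x; apply: cvgM; first exact: cf.
  by apply: continuous_normal_pdf; rewrite gt_eqF.
- by move=> x; rewrite mulr_ge0// normal_pdf_ge0.
Unshelve. all: by end_near. Qed.

(* The joint density of [(t, a s + b t)] is symmetric, so that [a s + b t] is again a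
   standard normal variable. *)
Lemma normal_pdf_exchange a b u t : 0 < a -> a ^+ 2 + b ^+ 2 = 1 ->
  normal_pdf (b * t) a u * gauss_pdf t = gauss_pdf u * normal_pdf (b * u) a t.
Proof.
move=> a0 ab; rewrite !gauss_pdfE !normal_pdfE ?gt_eqF// /normal_peak /normal_fun.
rewrite [LHS]mulrACA [RHS]mulrACA -!expRD [X in X * _]mulrC; congr (_ * expR _).
have b2 : b ^+ 2 = 1 - a ^+ 2 by rewrite -ab; ring.
have sqrBM x y : (x - b * y) ^+ 2 = x ^+ 2 - 2 * b * x * y + (1 - a ^+ 2) * y ^+ 2.
  by rewrite -b2; ring.
by rewrite !sqrBM -mulr_natr; field; rewrite gt_eqF.
Qed.

Lemma measurable_normal_pdf_mean a b : a != 0 ->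
  measurable_fun [set: RM * RM] (fun p => normal_pdf (b * p.1) a p.2).
Proof.
move=> a0; rewrite (_ : (fun p => _) =
  (fun p => normal_peak a * expR (- (p.2 - b * p.1) ^+ 2 / (a ^+ 2 *+ 2)))); last first.
  by apply/funext => p; rewrite normal_pdfE.
apply: measurable_funM => //; apply: measurableT_comp => //.
apply: measurable_funM => //; apply: measurableT_comp => //.
apply: measurable_funX; apply: measurable_funB; first exact: measurable_snd.
by apply: measurable_funM => //; exact: measurable_fst.
Qed.

Lemma ge0_integral_gauss_stable f a b : continuous f -> (forall x, 0 <= f x) ->
  0 < a -> a ^+ 2 + b ^+ 2 = 1 ->
  (\int[gamma]_t \int[gamma]_s (f (a * s + b * t))%:E = \int[gamma]_u (f u)%:E)%E.
Proof.
move=> cf f0 a0 ab.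
have mf : measurable_fun [set: RM] f by exact: continuous_measurable_fun.
under eq_integral do rewrite ge0_integral_gauss_affine//.
pose h (p : RM * RM) := f p.2 * normal_pdf (b * p.1) a p.2.
have h0 p : 0 <= h p by rewrite mulr_ge0// normal_pdf_ge0.
have mh : measurable_fun [set: RM * RM] h.
  apply: measurable_funM; first by apply: (measurableT_comp mf); exact: measurable_snd.
  by apply: measurable_normal_pdf_mean; rewrite gt_eqF.
have mpdf1 : measurable_fun [set: RM * RM] (fun p : RM * RM => gauss_pdf p.1).
  by apply: (measurableT_comp measurable_gauss_pdf); exact: measurable_fst.
have mFub : measurable_fun [set: RM] (fun t => \int[mu]_u (h (t, u))%:E)%E.
  by apply: (measurable_fun_fubini_tonelli_F (EFin \o h)) => //; exact/measurable_EFinP.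
have Fub0 t : (0 <= \int[mu]_u (h (t, u))%:E)%E.
  by apply: integral_ge0 => u _; rewrite lee_fin.
transitivity (\int[mu]_t (\int[mu]_u (h (t, u))%:E * (gauss_pdf t)%:E))%E.
  exact: ge0_integral_normal_prob mFub Fub0.
transitivity (\int[mu]_t \int[mu]_u (h (t, u) * gauss_pdf t)%:E)%E.
  apply: eq_integral => t _; rewrite -ge0_integralZr//.
  - apply/measurable_EFinP; apply: (measurableT_comp mh).
    exact: measurable_pair1.
  - by move=> u _; rewrite lee_fin.
  - by rewrite lee_fin gauss_pdf_ge0.
rewrite (fubini_tonelli (fun p => (h p * gauss_pdf p.1)%:E))/=; last 2 first.
- by apply/measurable_EFinP; exact: measurable_funM.
- by move=> p; rewrite lee_fin mulr_ge0 ?gauss_pdf_ge0.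
rewrite ge0_integral_normal_prob_EFin//; apply: eq_integral => u _.
under eq_integral do rewrite /h/= -mulrA (normal_pdf_exchange _ _ a0 ab) mulrA EFinM.
rewrite ge0_integralZl//.
- by rewrite integral_normal_pdf mule1.
- by apply/measurable_EFinP; exact: measurable_normal_pdf.
- by move=> t _; rewrite lee_fin normal_pdf_ge0.
- by rewrite lee_fin mulr_ge0// gauss_pdf_ge0.
Qed.

Lemma gauss_mean_stable f a b C : continuous f -> (forall x, `|f x| <= C) ->
  0 <= a -> 0 <= b -> a ^+ 2 + b ^+ 2 = 1 ->
  gauss_mean (fun t => gauss_mean (fun s => f (a * s + b * t))) = gauss_mean f.
Proof.
move=> cf fC; rewrite le_eqVlt => /predU1P[<- b0|a0 _] ab.
  have -> : b = 1 by apply/eqP; rewrite -(@eqrXn2 _ 2)// expr1n -ab expr0n add0r.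
  apply: eq_gauss_mean => t; rewrite -[RHS]gauss_mean_cst.
  by apply: eq_gauss_mean => s; rewrite mul0r add0r mul1r.
have mf : measurable_fun setT f by exact: continuous_measurable_fun.
have i_f t : gauss_integrable (fun s => f (a * s + b * t)).
  apply: (gauss_integrable_bounded (c := C)) => //; apply: measurableT_comp => //.
  by apply: continuous_measurable_fun; exact: continuous_affine.
have i_C := gauss_integrable_cst C.
pose g x := f x + C.
have g0 x : 0 <= g x by rewrite -lerBlDr sub0r; have := fC x; rewrite ler_norml => /andP[].
have mE t : gauss_mean (fun s => g (a * s + b * t)) =
    gauss_mean (fun s => f (a * s + b * t)) + C.
  by rewrite gauss_meanD// gauss_mean_cst.
have cg : continuous g by move=> x; apply: cvgD; [exact: cf|exact: cvg_cst].
have := ge0_integral_gauss_stable cg g0 a0 ab.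
under eq_integral do rewrite (integral_gauss_mean (gauss_integrableD (i_f _) i_C)) mE.
have igf : gauss_integrable f by exact: gauss_integrable_bounded fC.
rewrite (integral_gauss_mean (gauss_integrableD igf i_C)) gauss_meanD// gauss_mean_cst.
move=> meanE; have := ge0_gauss_mean meanE.
rewrite gauss_meanD// ?gauss_mean_cst => [/addIr//|].
have mF : measurable_fun [set: RM * RM] (fun p => f (a * p.2 + b * p.1)).
  by apply: (measurableT_comp mf); apply: measurable_funD; apply: measurable_funM.
apply: (gauss_integrable_bounded (c := C)) => [|t].
  exact: (measurable_gauss_mean mF (fun=> fC _)).
rewrite ler_norml -{1}(gauss_mean_cst (- C)) -{2}(gauss_mean_cst C).
by apply/andP; split; apply: le_gauss_mean => //;
  [exact: gauss_integrable_cst| |]; move=> s; have := fC (a * s + b * t);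
  rewrite ler_norml => /andP[].
Qed.

End gaussian_fubini.

Section iterated_gaussian.
Context {R : realType}.
Implicit Types (f g h : (nat -> R) -> R) (N M : nat) (v x y : nat -> R) (c : R).
Local Notation gamma := (normal_prob (0 : R) 1).

Fixpoint iter_mean N f : R :=
  if N is N'.+1 then gauss_mean (fun t => iter_mean N' (fun v => f (scons t v)))
  else f (fun=> 0).

Fixpoint iter_integrable N f : Prop :=
  if N is N'.+1 then
    (forall t, iter_integrable N' (fun v => f (scons t v))) /\
    gauss_integrable (fun t => iter_mean N' (fun v => f (scons t v)))
  else True.

Lemma eq_iter_mean N f g : f =1 g -> iter_mean N f = iter_mean N g.
Proof. by move=> /funext ->. Qed.

Lemma eq_iter_integrable N f g : f =1 g -> iter_integrable N f -> iter_integrable N g.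
Proof. by move=> /funext ->. Qed.

Lemma iter_mean_cst N c : iter_mean N (fun=> c) = c.
Proof. by elim: N => //= N ->; rewrite gauss_mean_cst. Qed.

Lemma iter_integrable_cst N c : iter_integrable N (fun=> c).
Proof. by elim: N => //= N IH; rewrite iter_mean_cst; split=> //; exact: gauss_integrable_cst. Qed.

Lemma iter_meanD N f g : iter_integrable N f -> iter_integrable N g ->
  iter_mean N (fun v => f v + g v) = iter_mean N f + iter_mean N g.
Proof.
elim: N f g => [//|N IH] f g /= [fi mf] [gi mg].
by rewrite -gauss_meanD//; apply: eq_gauss_mean => t; exact: IH.
Qed.

Lemma iter_integrableD N f g : iter_integrable N f -> iter_integrable N g ->
  iter_integrable N (fun v => f v + g v).
Proof.
elim: N f g => [//|N IH] f g /= [fi mf] [gi mg]; split => [t|]; first exact: IH.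
under eq_fun do rewrite iter_meanD//.
exact: gauss_integrableD.
Qed.

Lemma iter_meanZ N c f : iter_integrable N f ->
  iter_mean N (fun v => c * f v) = c * iter_mean N f.
Proof.
elim: N f => [//|N IH] f /= [fi mf].
by rewrite -gauss_meanZ//; apply: eq_gauss_mean => t; exact: IH.
Qed.

Lemma iter_integrableZ N c f : iter_integrable N f -> iter_integrable N (fun v => c * f v).
Proof.
elim: N f => [//|N IH] f /= [fi mf]; split => [t|]; first exact: IH.
under eq_fun do rewrite iter_meanZ//.
exact: gauss_integrableZ.
Qed.

Lemma iter_integrableB N f g : iter_integrable N f -> iter_integrable N g ->
  iter_integrable N (fun v => f v - g v).
Proof.
move=> fi gi; apply: eq_iter_integrable (iter_integrableD fi (iter_integrableZ (-1) gi)).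
by move=> v; rewrite mulN1r.
Qed.

Lemma iter_meanB N f g : iter_integrable N f -> iter_integrable N g ->
  iter_mean N (fun v => f v - g v) = iter_mean N f - iter_mean N g.
Proof.
move=> fi gi; rewrite -[- iter_mean N g]mulN1r -iter_meanZ// -iter_meanD//.
  by apply: eq_iter_mean => v; rewrite mulN1r.
exact: iter_integrableZ.
Qed.

Lemma iter_integrable_sum N (I : Type) (r : seq I) (F : I -> (nat -> R) -> R) :
  (forall i, iter_integrable N (F i)) -> iter_integrable N (fun v => \sum_(i <- r) F i v).
Proof.
move=> Fi; elim: r => [|i r IH].
  by apply: eq_iter_integrable (iter_integrable_cst N 0) => v; rewrite big_nil.
by apply: eq_iter_integrable (iter_integrableD (Fi i) IH) => v; rewrite big_cons.
Qed.

Lemma iter_mean_sum N (I : Type) (r : seq I) (F : I -> (nat -> R) -> R) :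
  (forall i, iter_integrable N (F i)) ->
  iter_mean N (fun v => \sum_(i <- r) F i v) = \sum_(i <- r) iter_mean N (F i).
Proof.
move=> Fi; elim: r => [|i r IH].
  by rewrite big_nil -[RHS](iter_mean_cst N 0); apply: eq_iter_mean => v; rewrite big_nil.
rewrite big_cons -IH -iter_meanD//; last exact: iter_integrable_sum.
by apply: eq_iter_mean => v; rewrite big_cons.
Qed.

Lemma le_iter_mean N f g : iter_integrable N f -> iter_integrable N g ->
  (forall v, f v <= g v) -> iter_mean N f <= iter_mean N g.
Proof.
elim: N f g => [f g _ _|N IH f g /= [fi mf] [gi mg]] fg; first exact: fg.
by apply: le_gauss_mean => // t; exact: IH.
Qed.

Lemma iter_mean_ge0 N f : (forall v, 0 <= f v) -> 0 <= iter_mean N f.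
Proof.
elim: N f => [f f0|N IH f f0] /=; first exact: f0.
by apply: gauss_mean_ge0 => t; exact: IH.
Qed.

Lemma ler_dist_iter_mean N f g h : iter_integrable N f -> iter_integrable N g ->
  iter_integrable N h -> (forall v, `|f v - g v| <= h v) ->
  `|iter_mean N f - iter_mean N g| <= iter_mean N h.
Proof.
move=> fi gi hi fgh; have hNi := iter_integrableZ (-1) hi.
have fgi := iter_integrableB fi gi.
rewrite -iter_meanB// ler_norml -mulN1r -iter_meanZ//.
by apply/andP; split; apply: le_iter_mean => // v;
  have := fgh v; rewrite ?mulN1r ler_norml => /andP[].
Qed.

Lemma iter_mean_prod N (psi : nat -> R -> R) c :
  (forall i, (i < N)%N -> gauss_integrable (psi i)) ->
  iter_mean N (fun v => c * \prod_(i < N) psi i (v i)) =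
  c * \prod_(i < N) gauss_mean (psi i).
Proof.
elim: N psi c => [|N IH] psi c psi_int; first by rewrite /= !big_ord0.
rewrite /= [in RHS]big_ord_recl/= mulrA [RHS]mulrAC -gauss_meanZ; last exact: psi_int.
apply: eq_gauss_mean => t; rewrite mulrAC -(IH (fun i => psi i.+1)) => [|i iN]; last first.
  exact: psi_int.
by apply: eq_iter_mean => v; rewrite big_ord_recl/= mulrA.
Qed.

Lemma iter_integrable_prod N (psi : nat -> R -> R) c :
  (forall i, (i < N)%N -> gauss_integrable (psi i)) ->
  iter_integrable N (fun v => c * \prod_(i < N) psi i (v i)).
Proof.
elim: N psi c => [//|N IH] psi c psi_int.
have psiE t v : c * \prod_(i < N.+1) psi i (scons t v i) =
    c * psi 0%N t * \prod_(i < N) psi i.+1 (v i) by rewrite big_ord_recl/= mulrA.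
have psiS_int i : (i < N)%N -> gauss_integrable (psi i.+1) by move=> iN; exact: psi_int.
split => [t|]; first by apply: eq_iter_integrable (IH (psi \o succn) _ psiS_int) => v; rewrite psiE.
under eq_fun => t.
  under eq_iter_mean do rewrite psiE.
  rewrite (iter_mean_prod (psi := psi \o succn))// mulrAC.
  over.
by apply: gauss_integrableZ; exact: psi_int.
Qed.

(* The events of the theorem are not known to be measurable: only inner approximation by
   simple functions is available for [giter]. *)
Lemma ge0_le_integral_nonmeasurable (h k : R -> \bar R) :
  (forall t, 0 <= h t)%E -> (forall t, h t <= k t)%E ->
  (\int[gamma]_t h t <= \int[gamma]_t k t)%E.
Proof.
move=> h0 hk; have k0 t : (0 <= k t)%E by exact: le_trans (hk t).
rewrite !ge0_integralTE//; apply: le_ereal_sup => _ [u /= uh <-].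
by exists u => // t; exact: le_trans (hk t).
Qed.

Lemma giter_ge0 N (h : (nat -> R) -> \bar R) : (forall v, 0 <= h v)%E -> (0 <= giter N h)%E.
Proof.
elim: N h => [h h0|N IH h h0 /=]; first exact: h0.
by apply: integral_ge0 => t _; exact: IH.
Qed.

Lemma iter_mean_le_giter N f (h : (nat -> R) -> \bar R) : iter_integrable N f ->
  (forall v, 0 <= h v)%E -> (forall v, (f v)%:E <= h v)%E ->
  ((iter_mean N f)%:E <= giter N h)%E.
Proof.
elim: N f h => [f h _ _|N IH f h [fi mf] h0 fh] /=; first exact.
pose m t := iter_mean N (fun v => f (scons t v)).
have i_max : gauss_integrable (fun t => Num.max (m t) 0).
  apply: (le_gauss_integrable _ _ (gauss_integrable_norm mf)).
    by apply: measurable_maxr => //; exact: gauss_integrable_measurable mf.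
  by move=> t; rewrite ger0_norm ?le_max ?lexx ?orbT// ge_max ler_norm normr_ge0.
apply: (@le_trans _ _ (\int[gamma]_t (Num.max (m t) 0)%:E)%E).
  by rewrite integral_gauss_mean// lee_fin le_gauss_mean// => t; rewrite le_max lexx.
apply: ge0_le_integral_nonmeasurable => t; first by rewrite lee_fin le_max lexx orbT.
rewrite EFin_max ge_max IH//=; [exact: giter_ge0|exact: fi].
Qed.

Lemma iter_mean_addn N M f : iter_mean (N + M) f =
  iter_mean N (fun x => iter_mean M (fun y => f (fun i => if (i < N)%N then x i else y (i - N)%N))).
Proof.
elim: N f => [|N IH] f.
  by rewrite add0n; apply: eq_iter_mean => y; congr f; apply/funext => i; rewrite ltn0 subn0.
rewrite addSn /=; apply: eq_gauss_mean => t; rewrite IH.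
apply: eq_iter_mean => x; apply: eq_iter_mean => y; congr f.
by apply/funext => -[|i] //=; rewrite ltnS subSS; case: ltnP.
Qed.

End iterated_gaussian.

Section iterated_lipschitz.
Context {R : realType}.
Implicit Types (N : nat) (v x y : nat -> R) (s t u a b C : R).

Definition abs_sum N x : R := \sum_(i < N) `|x i|.

Lemma abs_sum_ge0 N x : 0 <= abs_sum N x.
Proof. exact: sumr_ge0. Qed.

Definition dist1 N x y : R := abs_sum N (fun i => x i - y i).

Lemma dist1_ge0 N x y : 0 <= dist1 N x y.
Proof. exact: abs_sum_ge0. Qed.

Lemma dist1xx N x : dist1 N x x = 0.
Proof. by rewrite /dist1 /abs_sum big1// => i _; rewrite subrr normr0. Qed.

Lemma dist1_scons N s t x y : dist1 N.+1 (scons s x) (scons t y) = `|s - t| + dist1 N x y.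
Proof. by rewrite /dist1 /abs_sum big_ord_recl. Qed.

Lemma ler_dist_lipschitz_continuous C (h : R -> R) :
  (forall s t, `|h s - h t| <= C * `|s - t|) -> continuous h.
Proof.
move=> hC x; apply/cvgrPdist_le => e e0.
have C0 : 0 <= C by have := hC 1 0; rewrite subr0 normr1 mulr1; exact: le_trans.
have C1 : 0 < C + 1 by rewrite ltr_wpDl.
near=> y; apply: (le_trans (hC _ _)).
apply: (@le_trans _ _ ((C + 1) * `|x - y|)); first by rewrite ler_wpM2r// lerDl.
rewrite -ler_pdivlMl//; near: y; apply: cvgr_dist_le; first exact: cvg_id.
by rewrite mulr_gt0// invr_gt0.
Unshelve. all: by end_near. Qed.

Lemma lipschitz_gauss_integrable C (h : R -> R) :
  (forall s t, `|h s - h t| <= C * `|s - t|) -> gauss_integrable h.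
Proof.
move=> hC; apply: (@le_gauss_integrable _ _ (fun t => `|h 0| + C * `|t|)).
- by apply: continuous_measurable_fun; exact: ler_dist_lipschitz_continuous hC.
- move=> t; rewrite -{1}(subrK (h 0) (h t)) addrC (le_trans (ler_normD _ _))// lerD2l.
  by rewrite (le_trans (hC _ _))// subr0.
- apply: gauss_integrableD; first exact: gauss_integrable_cst.
  by apply: gauss_integrableZ; apply: gauss_integrable_norm; exact: gauss_integrable_id.
Qed.

(* Integrating out Gaussian coordinates preserves Lipschitz dependence on the remaining
   parameter, which ranges over an arbitrary type. *)
Lemma lipschitz_iter_integrable_mean (T : Type) (d : T -> T -> R) C N (F : T -> (nat -> R) -> R) :
  (forall p, d p p = 0) ->
  (forall p q x y, `|F p x - F q y| <= C * (d p q + dist1 N x y)) ->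
  (forall p, iter_integrable N (F p)) /\
  (forall p q, `|iter_mean N (F p) - iter_mean N (F q)| <= C * d p q).
Proof.
elim: N T d F => [|N IH] T d F dpp FC.
  by split => // p q; have := FC p q (fun=> 0) (fun=> 0); rewrite dist1xx addr0.
have [||F_int m_lip] := IH (T * R)%type (fun p q => d p.1 q.1 + `|p.2 - q.2|)
    (fun p v => F p.1 (scons p.2 v)).
- by move=> [p t] /=; rewrite dpp subrr normr0 addr0.
- move=> [p s] [q t] x y; apply: (le_trans (FC _ _ _ _)).
  by rewrite dist1_scons addrA.
pose m p t := iter_mean N (fun v => F p (scons t v)).
have m_int p : gauss_integrable (m p).
  apply: (@lipschitz_gauss_integrable C) => s t.
  by have := m_lip (p, s) (p, t); rewrite /= dpp add0r.
split => [p|p q]; first by split => [t|]; [exact: F_int (p, t)|exact: m_int].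
rewrite -[leRHS]gauss_mean_cst.
apply: (@ler_dist_iter_mean _ 1 (fun v => m p (v 0%N)) (fun v => m q (v 0%N)) (fun=> _)).
- by split => //; exact: m_int.
- by split => //; exact: m_int.
- by split => //; exact: gauss_integrable_cst.
- by move=> v; have := m_lip (p, v 0%N) (q, v 0%N); rewrite /= subrr normr0 addr0.
Qed.

Lemma lipschitz_iter_integrable C N (f : (nat -> R) -> R) :
  (forall x y, `|f x - f y| <= C * dist1 N x y) -> iter_integrable N f.
Proof.
move=> fC; have [||f_int _] := @lipschitz_iter_integrable_mean unit (fun _ _ => 0) C N (fun=> f).
- by [].
- by move=> _ _ x y; rewrite add0r.
exact: f_int tt.
Qed.

Lemma lipschitz_iter_mean_scons C N (f : (nat -> R) -> R) :
  (forall x y, `|f x - f y| <= C * dist1 N.+1 x y) ->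
  (forall t, iter_integrable N (fun v => f (scons t v))) /\
  continuous (fun t => iter_mean N (fun v => f (scons t v))).
Proof.
move=> fC; have [||f_int f_lip] := @lipschitz_iter_integrable_mean R (fun s t => `|s - t|) C N
  (fun t v => f (scons t v)).
- by move=> t; rewrite subrr normr0.
- by move=> s t x y; apply: (le_trans (fC _ _)); rewrite dist1_scons.
by split => //; exact: ler_dist_lipschitz_continuous f_lip.
Qed.

Lemma ler_norm_iter_mean N (f : (nat -> R) -> R) C : iter_integrable N f ->
  (forall v, `|f v| <= C) -> `|iter_mean N f| <= C.
Proof.
move=> fi fC; have := @ler_dist_iter_mean R N f (fun=> 0) (fun=> C).
rewrite !iter_mean_cst subr0; apply => //; try exact: iter_integrable_cst.
by move=> v; rewrite subr0.
Qed.

Lemma iter_mean_gauss_mean_swap C B N (F : (nat -> R) -> R -> R) :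
  (forall x x' t t', `|F x t - F x' t'| <= C * (dist1 N x x' + `|t - t'|)) ->
  (forall x t, `|F x t| <= B) ->
  iter_mean N (fun x => gauss_mean (F x)) = gauss_mean (fun t => iter_mean N (F ^~ t)).
Proof.
elim: N F => [//|N IH] F FC FB /=.
have [||F_int m_lip] := @lipschitz_iter_integrable_mean (R * R)%type
    (fun p q => `|p.1 - q.1| + `|p.2 - q.2|) C N (fun p x => F (scons p.1 x) p.2).
- by move=> [s t] /=; rewrite !subrr normr0 addr0.
- move=> [s t] [s' t'] y y'; apply: (le_trans (FC _ _ _ _)).
  by rewrite dist1_scons addrAC.
pose m (s t : R) := iter_mean N (fun x => F (scons s x) t).
transitivity (gauss_mean (fun s => gauss_mean (m s))).
  apply: eq_gauss_mean => s; apply: IH => [x x' t t'|//].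
  by apply: (le_trans (FC _ _ _ _)); rewrite dist1_scons subrr normr0 add0r.
apply: (@gauss_mean_swap _ (fun p => m p.1 p.2) B) => [|p]; last first.
  exact: ler_norm_iter_mean (F_int p) _.
apply: measurable_fun_caratheodory => [t|s].
  apply: (@ler_dist_lipschitz_continuous C) => s s'.
  by have := m_lip (s, t) (s', t); rewrite /= subrr normr0 addr0.
apply: continuous_measurable_fun; apply: (@ler_dist_lipschitz_continuous C) => t t'.
by have := m_lip (s, t) (s, t'); rewrite /= subrr normr0 add0r.
Qed.

Lemma dist1_axby N (a b : nat -> R) x x' y y' :
  (forall i, 0 <= a i <= 1) -> (forall i, 0 <= b i <= 1) ->
  dist1 N (fun i => a i * x i + b i * y i) (fun i => a i * x' i + b i * y' i) <=
  dist1 N x x' + dist1 N y y'.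
Proof.
move=> a01 b01; rewrite /dist1 /abs_sum -big_split; apply: ler_sum => i _ /=.
have -> : a i * x i + b i * y i - (a i * x' i + b i * y' i) =
    a i * (x i - x' i) + b i * (y i - y' i) by ring.
have /andP[a0 a1] := a01 i; have /andP[b0 b1] := b01 i.
rewrite (le_trans (ler_normD _ _))// !normrM (ger0_norm a0) (ger0_norm b0).
by rewrite lerD// ler_piMl.
Qed.

(* If [a i ^+ 2 + b i ^+ 2 = 1] for all [i], then [a x + b y] is a standard normal vector. *)
Lemma iter_mean_stable C B N (f : (nat -> R) -> R) (a b : nat -> R) : 0 <= C ->
  (forall x y, `|f x - f y| <= C * dist1 N x y) -> (forall x, `|f x| <= B) ->
  (forall i, [/\ 0 <= a i, 0 <= b i & a i ^+ 2 + b i ^+ 2 = 1]) ->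
  iter_mean N (fun x => iter_mean N (fun y => f (fun i => a i * x i + b i * y i))) =
  iter_mean N f.
Proof.
move=> C0; elim: N f a b => [|N IH] f a b fC fB ab /=.
  by congr f; apply/funext => i; rewrite !mulr0 addr0.
pose axby x y i := a i.+1 * x i + b i.+1 * y i.
have a01 i : 0 <= a i <= 1 by have [a0 b0 abE] := ab i; apply/andP; split => //; nra.
have b01 i : 0 <= b i <= 1 by have [a0 b0 abE] := ab i; apply/andP; split => //; nra.
have [a0 b0 abE] := ab 0%N; have /andP[_ b1] := b01 0%N.
have axby_scons t x t' y : (fun i => a i * scons t x i + b i * scons t' y i) =
    scons (a 0%N * t + b 0%N * t') (axby x y) by apply/funext => -[].
pose h u := iter_mean N (fun v => f (scons u v)).
transitivity (gauss_mean (fun t => gauss_mean (fun t' => h (b 0%N * t' + a 0%N * t)))).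
  apply: eq_gauss_mean => t.
  pose G x t' := iter_mean N (fun y => f (scons (a 0%N * t + b 0%N * t') (axby x y))).
  have [||G_int G_lip] := @lipschitz_iter_integrable_mean ((nat -> R) * R)%type
    (fun p q => dist1 N p.1 q.1 + `|p.2 - q.2|) C N
    (fun p y => f (scons (a 0%N * t + b 0%N * p.2) (axby p.1 y))).
  - by move=> [x t'] /=; rewrite dist1xx subrr normr0 addr0.
  - move=> [x s] [x' s'] y y'; apply: (le_trans (fC _ _)).
    rewrite ler_wpM2l// dist1_scons [leRHS]addrAC [leRHS]addrC lerD ?dist1_axby//.
    by rewrite /= opprD addrACA subrr add0r -mulrBr normrM (ger0_norm b0) ler_piMl.
  transitivity (iter_mean N (fun x => gauss_mean (G x))).
    apply: eq_iter_mean => x; apply: eq_gauss_mean => t'; apply: eq_iter_mean => y.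
    by rewrite axby_scons.
  rewrite (@iter_mean_gauss_mean_swap C B)//; last 2 first.
  - by move=> x x' t' t''; exact: (G_lip (x, t') (x', t'')).
  - by move=> x t'; apply: ler_norm_iter_mean (G_int (x, t')) _.
  apply: eq_gauss_mean => t'; rewrite [b 0%N * _ + _]addrC.
  apply: (IH (fun v => f (scons (a 0%N * t + b 0%N * t') v)) (a \o succn) (b \o succn)) => //.
    by move=> x y; apply: (le_trans (fC _ _)); rewrite dist1_scons subrr normr0 add0r.
  by move=> i; exact: ab.
have [h_int h_cont] := lipschitz_iter_mean_scons fC.
apply: (gauss_mean_stable (C := B)) => //; last by rewrite addrC.
by move=> u; exact: ler_norm_iter_mean.
Qed.

End iterated_lipschitz.

Section taylor_expansion.
Context {R : realType}.
Implicit Types (F : R -> R) (u x h B M : R).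

Lemma mean_value_bound F F' u h B : (forall x, is_derive x 1 F (F' x)) ->
  (forall x, `|x - u| <= `|h| -> `|F' x| <= B) -> `|F (u + h) - F u| <= B * `|h|.
Proof.
move=> dF F'B.
have cF : continuous F.
  by move=> x; apply: differentiable_continuous; apply/derivable1_diffP; case: (dF x).
have [h0|h0] := leP 0 h.
- have uh : u <= u + h by rewrite lerDl.
  have [x xI ->] := MVT_segment uh (fun x _ => dF x) (continuous_subspaceT cF).
  move: xI; rewrite in_itv/= => /andP[ux xh]; rewrite normrM addrAC subrr add0r.
  by rewrite ler_wpM2r// F'B// !ger0_norm// ?subr_ge0// lerBlDl.
- have uh : u + h <= u by rewrite gerDl ltW.
  have [x xI FE] := MVT_segment uh (fun x _ => dF x) (continuous_subspaceT cF).
  move: xI; rewrite in_itv/= => /andP[ux xh].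
  rewrite distrC FE normrM opprD addrA subrr add0r normrN.
  by rewrite ler_wpM2r// F'B// !ler0_norm ?subr_le0// ?(ltW h0)//; lra.
Qed.

Lemma taylor2_bound (f f1 f2 f3 : R -> R) M u h :
  (forall x, is_derive x 1 f (f1 x)) -> (forall x, is_derive x 1 f1 (f2 x)) ->
  (forall x, is_derive x 1 f2 (f3 x)) -> (forall x, `|f3 x| <= M) ->
  `|f (u + h) - (f u + f1 u * h + f2 u / 2 * h ^+ 2)| <= M * `|h| ^+ 3.
Proof.
move=> d1 d2 d3 fM.
have M0 : 0 <= M by apply: le_trans (fM 0).
have f2_bound x : `|x - u| <= `|h| -> `|f2 x - f2 u| <= M * `|h|.
  move=> xh; have := @mean_value_bound f2 f3 u (x - u) M d3 (fun x _ => fM x).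
  by rewrite (addrC u) subrK => /le_trans; apply; rewrite ler_wpM2l.
have f1_bound x : `|x - u| <= `|h| -> `|f1 x - f1 u - f2 u * (x - u)| <= M * `|h| ^+ 2.
  move=> xh; pose g y := f1 y - f2 u * (y - u).
  have dg (y : R) : is_derive y 1 g (f2 y - f2 u).
    by apply: is_derive_eq; rewrite /GRing.scale/=; ring.
  have g_bound := @mean_value_bound g (fun y => f2 y - f2 u) u (x - u) (M * `|h|) dg.
  rewrite /g subrr mulr0 subr0 (addrC u) subrK addrAC in g_bound.
  apply: (le_trans (g_bound _)) => [y yx|]; first by apply: f2_bound; exact: le_trans xh.
  by rewrite expr2 mulrA ler_wpM2l// mulr_ge0.
pose k y := f y - f1 u * (y - u) - f2 u / 2 * (y - u) ^+ 2.
have dk (y : R) : is_derive y 1 k (f1 y - f1 u - f2 u * (y - u)).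
  by apply: is_derive_eq; rewrite /GRing.scale/=; field.
have := @mean_value_bound k _ u h (M * `|h| ^+ 2) dk f1_bound.
rewrite /k subrr mulr0 expr0n mulr0 !subr0 (addrC u) addrK -(mulrA M) -exprSr.
by congr (`|_| <= _); ring.
Qed.

End taylor_expansion.

Section logistic.
Context {R : realType}.
Implicit Types (x : R).
Variables l c : R.

Definition logistic x : R := (1 + expR (l * (x - c)))^-1.

Lemma logistic_bounds x : 0 < logistic x < 1.
Proof.
have e0 := expR_gt0 (l * (x - c)).
by rewrite invr_gt0 addr_gt0//= invf_lt1 ?ltrDl// addr_gt0.
Qed.

Lemma logistic_ge0 x : 0 <= logistic x.
Proof. by have /andP[/ltW] := logistic_bounds x. Qed.

Lemma logistic_le1 x : logistic x <= 1.
Proof. by have /andP[_ /ltW] := logistic_bounds x. Qed.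

Lemma logistic_le_expR d x : 0 <= l -> c + d <= x -> logistic x <= expR (- (l * d)).
Proof.
move=> l0 xd; rewrite expRN lef_pV2 ?posrE ?expR_gt0 ?addr_gt0 ?expR_gt0//.
apply: (@le_trans _ _ (expR (l * (x - c)))); last by rewrite lerDr.
by rewrite ler_expR ler_wpM2l//; lra.
Qed.

Lemma onem_logistic_le_expR d x : 0 <= l -> x <= c - d -> 1 - logistic x <= expR (- (l * d)).
Proof.
move=> l0 xd; have e0 := expR_gt0 (l * (x - c)).
have -> : 1 - logistic x = expR (l * (x - c)) / (1 + expR (l * (x - c))).
  by rewrite /logistic; field; rewrite gt_eqF.
rewrite ler_pdivrMr//; apply: (@le_trans _ _ (expR (- (l * d)))).
  by rewrite ler_expR -(mulrN l) ler_wpM2l//; lra.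
by rewrite ler_peMr ?expR_ge0// lerDl ltW.
Qed.

Definition logistic1 x : R := - l * (logistic x * (1 - logistic x)).
Definition logistic2 x : R := l ^+ 2 * (logistic x * (1 - logistic x) * (1 - 2 * logistic x)).
Definition logistic3 x : R :=
  - l ^+ 3 * (logistic x * (1 - logistic x) * (1 - 6 * (logistic x * (1 - logistic x)))).

Lemma is_derive_logistic x : is_derive x 1 logistic (logistic1 x).
Proof.
have n0 : 1 + expR (l * (x - c)) != 0 by rewrite gt_eqF// addr_gt0.
have dD : is_derive x 1 (fun x => 1 + expR (l * (x - c))) (l * expR (l * (x - c))).
  by apply: is_derive_eq; rewrite /GRing.scale/=; ring.
have dV := @is_deriveV _ (fun x => 1 + expR (l * (x - c))) x _ _ n0 dD.
by apply: (is_derive_eq dV); rewrite /logistic1 /logistic /GRing.scale/=; field.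
Qed.

Lemma is_derive_logistic1 x : is_derive x 1 logistic1 (logistic2 x).
Proof.
have d1 := is_derive_logistic x.
by apply: is_derive_eq; rewrite /logistic2 /logistic1 /GRing.scale/=; ring.
Qed.

Lemma is_derive_logistic2 x : is_derive x 1 logistic2 (logistic3 x).
Proof.
have d1 := is_derive_logistic x.
by apply: is_derive_eq; rewrite /logistic3 /logistic1 /GRing.scale/=; ring.
Qed.

Let logistic_var_bounds x : 0 <= logistic x * (1 - logistic x) <= 1 / 4.
Proof.
rewrite mulr_ge0 ?logistic_ge0 ?subr_ge0 ?logistic_le1//= -subr_ge0.
have -> : 1 / 4 - logistic x * (1 - logistic x) = (logistic x - 1 / 2) ^+ 2 by field.
exact: sqr_ge0.
Qed.

Lemma logistic1_le0 x : 0 <= l -> logistic1 x <= 0.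
Proof.
by move=> l0; have /andP[v0 _] := logistic_var_bounds x; rewrite /logistic1 mulNr oppr_le0 mulr_ge0.
Qed.

Lemma ler_norm_logistic1 x : `|logistic1 x| <= `|l|.
Proof.
have /andP[v0 v1] := logistic_var_bounds x.
by rewrite /logistic1 normrM normrN ler_piMr// ger0_norm//; lra.
Qed.

Lemma ler_norm_logistic2 x : `|logistic2 x| <= `|l| ^+ 2.
Proof.
have /andP[v0 v1] := logistic_var_bounds x.
rewrite /logistic2 normrM normrX ler_piMr ?exprn_ge0// normrM ger0_norm//.
rewrite mulr_ile1//; first by lra.
have := logistic_ge0 x; have := logistic_le1 x => t1 t0.
by rewrite ler_norml; apply/andP; split; lra.
Qed.

Lemma ler_norm_logistic3 x : `|logistic3 x| <= `|l| ^+ 3.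
Proof.
have /andP[v0 v1] := logistic_var_bounds x.
rewrite /logistic3 normrM normrN normrX ler_piMr ?exprn_ge0// normrM ger0_norm//.
rewrite mulr_ile1//; first by lra.
by rewrite ler_norml; apply/andP; split; lra.
Qed.

End logistic.

Section taylor_class.
Context {R : realType} {P : finType}.
Implicit Types (x h b : P -> R) (c : P -> P -> R) (f g : (P -> R) -> R).
Implicit Types (K : R -> (P -> R) -> (P -> P -> R) -> Prop) (M : R).

Definition norm1 h : R := \sum_p `|h p|.

Lemma norm1_ge0 h : 0 <= norm1 h.
Proof. exact: sumr_ge0. Qed.

Lemma ler_norm1 h p : `|h p| <= norm1 h.
Proof. by rewrite /norm1 (bigD1 p)//= lerDl sumr_ge0. Qed.

Definition linear_form b h : R := \sum_p b p * h p.
Definition quad_form c h : R := \sum_p \sum_q c p q * (h p * h q).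

Lemma ler_norm_linear_form b h M : (forall p, `|b p| <= M) -> `|linear_form b h| <= M * norm1 h.
Proof.
move=> bM; rewrite (le_trans (ler_norm_sum _ _ _))// mulr_sumr.
by apply: ler_sum => p _; rewrite normrM ler_wpM2r.
Qed.

Lemma ler_norm_quad_form c h M : (forall p q, `|c p q| <= M) ->
  `|quad_form c h| <= M * norm1 h ^+ 2.
Proof.
move=> cM; rewrite (le_trans (ler_norm_sum _ _ _))// expr2 [norm1 h in leRHS]/norm1.
rewrite mulr_suml mulr_sumr; apply: ler_sum => p _; rewrite (le_trans (ler_norm_sum _ _ _))//.
by rewrite /norm1 !mulr_sumr; apply: ler_sum => q _; rewrite !normrM ler_wpM2r// mulr_ge0.
Qed.

Definition taylor_poly (u : R) b c h : R := u + linear_form b h + quad_form c h.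

(* [b] and [c] play the role of the gradient and of half the Hessian of [f] at [x]; the
   predicate [K] records sign information on the value and on them. *)
Definition taylor_class K f := exists2 M : R, 0 <= M & forall x, exists b c,
  [/\ `|f x| <= M, forall p, `|b p| <= M, forall p q, `|c p q| <= M, K (f x) b c &
      forall h, norm1 h <= 1 ->
        `|f (fun p => x p + h p) - taylor_poly (f x) b c h| <= M * norm1 h ^+ 3].

Lemma ler_norm_taylor_poly u b c h M : norm1 h <= 1 -> `|u| <= M ->
  (forall p, `|b p| <= M) -> (forall p q, `|c p q| <= M) ->
  `|taylor_poly u b c h| <= 3 * M.
Proof.
move=> h1 uM bM cM; have h0 := norm1_ge0 h; have M0 : 0 <= M by exact: le_trans uM.
have -> : 3 * M = M + M + M by ring.
rewrite (le_trans (ler_normD _ _))// (le_trans (lerD (ler_normD _ _) (lexx _)))// !lerD//.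
  by rewrite (le_trans (ler_norm_linear_form h bM))// ler_piMr.
by rewrite (le_trans (ler_norm_quad_form h cM))// ler_piMr// exprn_ile1.
Qed.

Lemma taylor_polyM u b c u' b' c' h :
  taylor_poly u b c h * taylor_poly u' b' c' h =
  taylor_poly (u * u') (fun p => u * b' p + u' * b p)
    (fun p q => u * c' p q + u' * c p q + b p * b' q) h +
  (linear_form b h * quad_form c' h + quad_form c h * linear_form b' h +
   quad_form c h * quad_form c' h).
Proof.
have linE : linear_form (fun p => u * b' p + u' * b p) h =
    u * linear_form b' h + u' * linear_form b h.
  by rewrite /linear_form !mulr_sumr -big_split; apply: eq_bigr => p _ /=; ring.
have quadE : quad_form (fun p q => u * c' p q + u' * c p q + b p * b' q) h =
    u * quad_form c' h + u' * quad_form c h + linear_form b h * linear_form b' h.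
  rewrite /quad_form /linear_form mulr_suml !mulr_sumr -!big_split.
  apply: eq_bigr => p _ /=; rewrite !mulr_sumr -!big_split.
  by apply: eq_bigr => q _ /=; ring.
by rewrite /taylor_poly linE quadE; ring.
Qed.

Lemma ler_norm_taylor_poly_cross b c b' c' h M M' : norm1 h <= 1 ->
  (forall p, `|b p| <= M) -> (forall p q, `|c p q| <= M) ->
  (forall p, `|b' p| <= M') -> (forall p q, `|c' p q| <= M') -> 0 <= M -> 0 <= M' ->
  `|linear_form b h * quad_form c' h + quad_form c h * linear_form b' h +
    quad_form c h * quad_form c' h| <= 3 * (M * M' * norm1 h ^+ 3).
Proof.
move=> h1 bM cM b'M c'M M0 M'0; set H := norm1 h in h1 *; have H0 : 0 <= H := norm1_ge0 h.
have := ler_norm_linear_form h bM; have := ler_norm_linear_form h b'M.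
have := ler_norm_quad_form h cM; have := ler_norm_quad_form h c'M.
set B := linear_form b h; set B' := linear_form b' h.
set Q := quad_form c h; set Q' := quad_form c' h => Q'b Qb B'b Bb.
have cubic (r s : R) (i j : nat) : `|r| <= M * H ^+ i -> `|s| <= M' * H ^+ j ->
    (3 <= i + j)%N -> `|r * s| <= M * M' * H ^+ 3.
  move=> rM sM ij; rewrite normrM (le_trans (ler_pM _ _ rM sM))// mulrACA -exprD.
  rewrite ler_wpM2l// ?mulr_ge0//.
  by rewrite -(subnK ij) exprD ler_piMl ?exprn_ge0// exprn_ile1.
have -> : 3 * (M * M' * H ^+ 3) = M * M' * H ^+ 3 + M * M' * H ^+ 3 + M * M' * H ^+ 3 by ring.
rewrite (le_trans (ler_normD _ _))// (le_trans (lerD (ler_normD _ _) (lexx _)))// !lerD//.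
- exact: (cubic _ _ 1 2).
- exact: (cubic _ _ 2 1).
- exact: (cubic _ _ 2 2).
Qed.

Lemma taylor_class_mul K1 K2 K3 f g :
  (forall u b c u' b' c', K1 u b c -> K2 u' b' c' ->
     K3 (u * u') (fun p => u * b' p + u' * b p)
        (fun p q => u * c' p q + u' * c p q + b p * b' q)) ->
  taylor_class K1 f -> taylor_class K2 g -> taylor_class K3 (fun x => f x * g x).
Proof.
move=> K123 [M M0 fM] [M' M'0 gM]; have V0 : 0 <= M * M' by rewrite mulr_ge0.
exists (7 * (M * M')); first by rewrite mulr_ge0.
move=> x; have [b [c [fx bM cM Kf fh]]] := fM x; have [b' [c' [gx b'M c'M Kg gh]]] := gM x.
exists (fun p => f x * b' p + g x * b p).
exists (fun p q => f x * c' p q + g x * c p q + b p * b' q).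
have ler_normM (r s : R) : `|r| <= M -> `|s| <= M' -> `|r * s| <= M * M'.
  by move=> rM sM; rewrite normrM ler_pM.
have ler_normMC (r s : R) : `|r| <= M' -> `|s| <= M -> `|r * s| <= M * M'.
  by move=> rM sM; rewrite mulrC ler_normM.
split.
- by rewrite (le_trans (ler_normM _ _ fx gx))//; lra.
- move=> p; rewrite (le_trans (ler_normD _ _))//.
  have := ler_normM _ _ fx (b'M p); have := ler_normMC _ _ gx (bM p); lra.
- move=> p q; rewrite (le_trans (ler_normD _ _))//.
  have := ler_normD (f x * c' p q) (g x * c p q); have := ler_normM _ _ fx (c'M p q).
  have := ler_normMC _ _ gx (cM p q); have := ler_normM _ _ (bM p) (b'M q); lra.
- exact: K123.
- move=> h h1; set xh := fun p => x p + h p; have [_ [_ [gxh _ _ _ _]]] := gM xh.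
  have cross := ler_norm_taylor_poly_cross h1 bM cM b'M c'M M0 M'0.
  have -> : f xh * g xh - taylor_poly (f x * g x) (fun p => f x * b' p + g x * b p)
      (fun p q => f x * c' p q + g x * c p q + b p * b' q) h =
    (f xh - taylor_poly (f x) b c h) * g xh +
    taylor_poly (f x) b c h * (g xh - taylor_poly (g x) b' c' h) +
    (linear_form b h * quad_form c' h + quad_form c h * linear_form b' h +
     quad_form c h * quad_form c' h).
    by rewrite mulrBl mulrBr taylor_polyM; ring.
  have -> : 7 * (M * M') * norm1 h ^+ 3 = M * norm1 h ^+ 3 * M' +
    3 * M * (M' * norm1 h ^+ 3) + 3 * (M * M' * norm1 h ^+ 3) by ring.
  rewrite (le_trans (ler_normD _ _))// (le_trans (lerD (ler_normD _ _) (lexx _)))// !lerD//.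
  + by rewrite normrM ler_pM// fh.
  + by rewrite normrM ler_pM// ?gh// ler_norm_taylor_poly.
Qed.

Lemma taylor_class_cst K (a : R) : K a (fun=> 0) (fun _ _ => 0) -> taylor_class K (fun=> a).
Proof.
move=> Ka; exists `|a| => // x; exists (fun=> 0), (fun _ _ => 0).
split=> // [p|p q|h _]; rewrite ?normr0//.
rewrite /taylor_poly /linear_form /quad_form !big1 ?addr0 => [|p _|p _]; last 2 first.
- by rewrite big1// => q _; rewrite mul0r.
- by rewrite mul0r.
by rewrite subrr normr0 mulr_ge0// exprn_ge0// norm1_ge0.
Qed.

Lemma taylor_class_prod K (I : Type) (r : seq I) (F : I -> (P -> R) -> R) :
  K 1 (fun=> 0) (fun _ _ => 0) ->
  (forall u b c u' b' c', K u b c -> K u' b' c' ->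
     K (u * u') (fun p => u * b' p + u' * b p)
        (fun p q => u * c' p q + u' * c p q + b p * b' q)) ->
  (forall i, taylor_class K (F i)) -> taylor_class K (fun x => \prod_(i <- r) F i x).
Proof.
move=> K1 KM KF; elim: r => [|i r IH].
  under [X in taylor_class _ X]eq_fun do rewrite big_nil.
  exact: taylor_class_cst.
under [X in taylor_class _ X]eq_fun do rewrite big_cons.
exact: taylor_class_mul KM (KF i) IH.
Qed.

Lemma taylor_class_onem K1 K2 f :
  (forall u b c, K1 u b c -> K2 (1 - u) (fun p => - b p) (fun p q => - c p q)) ->
  taylor_class K1 f -> taylor_class K2 (fun x => 1 - f x).
Proof.
move=> K12 [M M0 fM]; exists (1 + M); first by rewrite addr_ge0.
move=> x; have [b [c [fx bM cM Kf fh]]] := fM x.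
exists (fun p => - b p), (fun p q => - c p q); split.
- by rewrite (le_trans (ler_normB _ _))// normr1 lerD2l.
- by move=> p; rewrite normrN (le_trans (bM p))// lerDr.
- by move=> p q; rewrite normrN (le_trans (cM p q))// lerDr.
- exact: K12.
- move=> h h1.
  have -> : taylor_poly (1 - f x) (fun p => - b p) (fun p q => - c p q) h =
      1 - taylor_poly (f x) b c h.
    rewrite /taylor_poly /linear_form /quad_form !opprD -!sumrN !addrA.
    congr (_ + _ + _); apply: eq_bigr => p _; first by rewrite mulNr.
    by rewrite -sumrN; apply: eq_bigr => q _; rewrite mulNr.
  have -> : 1 - f (fun p => x p + h p) - (1 - taylor_poly (f x) b c h) =
      - (f (fun p => x p + h p) - taylor_poly (f x) b c h) by ring.
  rewrite normrN (le_trans (fh h h1))//.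
  by rewrite ler_wpM2r ?exprn_ge0 ?norm1_ge0// lerDr.
Qed.

Lemma linear_form_delta (a : R) (p0 : P) h :
  linear_form (fun p => a *+ (p == p0)) h = a * h p0.
Proof.
rewrite /linear_form (bigD1 p0)//= eqxx mulr1n big1 ?addr0// => p /negbTE->.
by rewrite mulr0n mul0r.
Qed.

Lemma quad_form_delta (a : R) (p0 : P) h :
  quad_form (fun p q => a *+ ((p == p0) && (q == p0))) h = a * (h p0 * h p0).
Proof.
rewrite /quad_form (bigD1 p0)//= [X in _ + X]big1 => [|p /negbTE->]; last first.
  by rewrite big1// => q _; rewrite mulr0n mul0r.
rewrite addr0 (bigD1 p0)//= eqxx mulr1n big1 ?addr0// => q /negbTE->.
by rewrite mulr0n mul0r.
Qed.

Lemma taylor_class_coord K (F F1 F2 F3 : R -> R) M (p0 : P) :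
  (forall u : R, is_derive u 1 F (F1 u)) -> (forall u : R, is_derive u 1 F1 (F2 u)) ->
  (forall u : R, is_derive u 1 F2 (F3 u)) ->
  (forall u, [/\ `|F u| <= M, `|F1 u| <= M, `|F2 u| <= M & `|F3 u| <= M]) ->
  (forall u, K (F u) (fun p => F1 u *+ (p == p0))
                     (fun p q => (F2 u / 2) *+ ((p == p0) && (q == p0)))) ->
  taylor_class K (fun x => F (x p0)).
Proof.
move=> d1 d2 d3 FM KF; have [M0 _ _ _] := FM 0; have {}M0 : 0 <= M by exact: le_trans M0.
exists M => // x; set u := x p0; have [Fu F1u F2u _] := FM u.
exists (fun p => F1 u *+ (p == p0)), (fun p q => (F2 u / 2) *+ ((p == p0) && (q == p0))).
split=> //.
- by move=> p; case: eqP => _; rewrite ?mulr0n ?normr0.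
- move=> p q; case: (_ && _); rewrite ?mulr0n ?normr0// mulr1n normrM.
  by rewrite (ger0_norm (_ : 0 <= 2^-1)) ?invr_ge0//; have := normr_ge0 (F2 u); lra.
move=> h _; have -> : taylor_poly (F u) (fun p => F1 u *+ (p == p0))
    (fun p q => (F2 u / 2) *+ ((p == p0) && (q == p0))) h =
    F u + F1 u * h p0 + F2 u / 2 * h p0 ^+ 2.
  by rewrite /taylor_poly linear_form_delta quad_form_delta expr2.
apply: (le_trans (taylor2_bound _ _ d1 d2 d3 (fun v => let: And4 _ _ _ F3v := FM v in F3v))).
by rewrite ler_wpM2l// lerXn2r ?nnegrE ?norm1_ge0// ler_norm1.
Qed.

Lemma taylor_class_bounded K f : taylor_class K f ->
  exists2 M : R, 0 <= M & forall x, `|f x| <= M.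
Proof. by move=> [M M0 fM]; exists M => // x; have [b [c []]] := fM x. Qed.

Lemma taylor_class_expansion K f : taylor_class K f ->
  exists2 M : R, 0 <= M & forall x, exists b c, K (f x) b c /\
    forall h, `|f (fun p => x p + h p) - taylor_poly (f x) b c h| <= M * norm1 h ^+ 3.
Proof.
move=> [M M0 fM]; exists (4 * M); first by rewrite mulr_ge0.
move=> x; have [b [c [fx bM cM Kf fh]]] := fM x; exists b, c; split => // h.
have H0 := norm1_ge0 h; have [h1|h1] := leP (norm1 h) 1.
  by rewrite (le_trans (fh h h1))// ler_wpM2r ?exprn_ge0//; lra.
have [_ [_ [fxh _ _ _ _]]] := fM (fun p => x p + h p).
have linM := ler_norm_linear_form h bM; have quadM := ler_norm_quad_form h cM.
have norm1X n : (n <= 3)%N -> M * norm1 h ^+ n <= M * norm1 h ^+ 3.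
  by move=> n3; rewrite ler_wpM2l// ler_eXn2l// ltW.
have := norm1X 0%N isT; have := norm1X 1%N isT; have := norm1X 2%N isT.
rewrite expr0 mulr1 expr1 => M2 M1 M3.
rewrite (le_trans (ler_normB _ _))//.
have := ler_normD (f x + linear_form b h) (quad_form c h).
have := ler_normD (f x) (linear_form b h); rewrite /taylor_poly; lra.
Qed.

Lemma taylor_class_lipschitz K f : taylor_class K f -> exists2 M : R, 0 <= M &
  forall x y, `|f x - f y| <= M * norm1 (fun p => x p - y p).
Proof.
move=> [M M0 fM]; exists (3 * M); first by rewrite mulr_ge0.
move=> x y; have [b [c [fy bM cM _ fh]]] := fM y.
pose h p := x p - y p; rewrite -/h.
have xE : x = (fun p => y p + h p) by apply/funext => p; rewrite /h addrC subrK.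
have H0 := norm1_ge0 h; have [h1|h1] := leP (norm1 h) 1; last first.
  have [_ [_ [fx _ _ _ _]]] := fM x; have := ler_wpM2l M0 (ltW h1); rewrite mulr1 => Mh.
  by rewrite (le_trans (ler_normB _ _))//; lra.
have linM := ler_norm_linear_form h bM; have quadM := ler_norm_quad_form h cM.
have norm1X n : (0 < n)%N -> M * norm1 h ^+ n <= M * norm1 h.
  by case: n => // n _; rewrite ler_wpM2l// exprS ler_piMr// exprn_ile1.
have := norm1X 2%N isT; have := norm1X 3%N isT => M3 M2.
rewrite -(subrK (taylor_poly (f y) b c h) (f x)) -addrA (le_trans (ler_normD _ _))//.
have := fh h h1; rewrite -xE; have := ler_normD (linear_form b h) (quad_form c h).
have -> : taylor_poly (f y) b c h - f y = linear_form b h + quad_form c h.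
  by rewrite /taylor_poly; ring.
lra.
Qed.

End taylor_class.

Section smooth_minmax.
Context {R : realType} {I J : finType}.
Local Notation P := (I * J)%type.
Implicit Types (x b : P -> R) (c : P -> P -> R).
Variables l m : R.
Hypothesis l0 : 0 <= l.

(* A smooth surrogate of the indicator of the event that each row [i] has an entry
   [x (i, j)] above the level [m]. *)
Definition smooth_minmax x : R := \prod_(i : I) (1 - \prod_(j : J) logistic l m (x (i, j))).

Definition row_jet (i : I) (u : R) b c := [/\ 0 <= u <= 1, forall p, b p <= 0,
  forall p, p.1 != i -> b p = 0 & forall p q, p.1 != q.1 -> c p q = 0].
Definition minmax_jet (u : R) b c := [/\ 0 <= u, forall p, 0 <= b p &
  forall p q, p.1 != q.1 -> 0 <= c p q].

Lemma taylor_class_logistic i j : taylor_class (row_jet i) (fun x => logistic l m (x (i, j))).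
Proof.
have sum_ge0 : [/\ 0 <= `|l|, 0 <= `|l| ^+ 2 & 0 <= `|l| ^+ 3] by split; rewrite ?exprn_ge0.
apply: (@taylor_class_coord _ _ _ _ (logistic1 l m) (logistic2 l m) (logistic3 l m)
  (1 + `|l| + `|l| ^+ 2 + `|l| ^+ 3)).
- exact: is_derive_logistic.
- exact: is_derive_logistic1.
- exact: is_derive_logistic2.
- move=> u; have := ler_norm_logistic1 l m u; have := ler_norm_logistic2 l m u.
  have := ler_norm_logistic3 l m u; have := ger0_norm (logistic_ge0 l m u).
  by have := logistic_le1 l m u; case: sum_ge0; split; lra.
- move=> u; split.
  + by rewrite logistic_ge0 logistic_le1.
  + by move=> p; case: eqP => _; rewrite ?mulr0n ?logistic1_le0.
  + by move=> [p p'] /= pi; rewrite xpair_eqE (negbTE pi).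
  + move=> [p p'] [q q'] /= pq; rewrite !xpair_eqE.
    case: (p =P i) pq => [->|//]; rewrite eq_sym => /negbTE ->.
    by rewrite andbF mulr0n.
Qed.

Lemma taylor_class_row i :
  taylor_class minmax_jet (fun x => 1 - \prod_(j : J) logistic l m (x (i, j))).
Proof.
apply: (@taylor_class_onem _ _ (row_jet i)).
  move=> u b c [/andP[u0 u1] b0 _ c0]; split; first by rewrite subr_ge0.
    by move=> p; rewrite oppr_ge0.
  by move=> p q pq; rewrite c0// oppr0.
apply: taylor_class_prod; last by move=> j; exact: taylor_class_logistic.
  by split => //; rewrite ler01 lexx.
move=> u b c u' b' c' [/andP[u0 u1] b0 bi c0] [/andP[u'0 u'1] b'0 b'i c'0]; split.
- by rewrite mulr_ge0//= mulr_ile1.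
- by move=> p; have := b0 p; have := b'0 p; nra.
- by move=> p pi; rewrite b'i// bi// !mulr0 addr0.
- move=> p q pq; rewrite c0// c'0// !mulr0 !add0r.
  have [pi|/bi ->] := eqVneq p.1 i; last by rewrite mul0r.
  by rewrite b'i ?mulr0// -pi eq_sym.
Qed.

Lemma taylor_class_smooth_minmax : taylor_class minmax_jet smooth_minmax.
Proof.
apply: taylor_class_prod; last exact: taylor_class_row.
  by split => //; rewrite ler01.
move=> u b c u' b' c' [u0 b0 c0] [u'0 b'0 c'0]; split; first exact: mulr_ge0.
  by move=> p; rewrite addr_ge0// mulr_ge0.
by move=> p q pq; rewrite !addr_ge0// mulr_ge0// ?c0 ?c'0.
Qed.

Lemma prod_onem_ge (K : finType) (y : K -> R) : (forall k, 0 <= y k <= 1) ->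
  1 - \sum_k y k <= \prod_k (1 - y k).
Proof.
move=> y01; suff [] : 1 - \sum_k y k <= \prod_k (1 - y k) /\ 0 <= \prod_k (1 - y k) <= 1 by [].
elim/big_rec2: _ => [|k p s _ [IH /andP[p0 p1]]]; first by rewrite subr0 ler01 lexx.
have /andP[yk0 yk1] := y01 k; have := mulr_ge0 yk0 p0.
split; last by rewrite mulr_ge0 ?subr_ge0//= mulr_ile1 ?subr_ge0// gerBl.
by rewrite mulrBl mul1r; nra.
Qed.

Let prod_logistic_bounds x i : 0 <= \prod_(j : J) logistic l m (x (i, j)) <= 1.
Proof.
rewrite prodr_ge0 => [|j _]; last exact: logistic_ge0.
by rewrite prodr_ile1// => j _; rewrite logistic_ge0 logistic_le1.
Qed.

Lemma smooth_minmax_ge0 x : 0 <= smooth_minmax x.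
Proof. by apply: prodr_ge0 => i _; have /andP[_] := prod_logistic_bounds x i; rewrite subr_ge0. Qed.

Lemma smooth_minmax_le1 x : smooth_minmax x <= 1.
Proof.
apply: prodr_ile1 => i _; have /andP[p0 p1] := prod_logistic_bounds x i.
by rewrite subr_ge0 p1 gerBl.
Qed.

Lemma smooth_minmax_ge d x : (forall i, exists j, m + d <= x (i, j)) ->
  1 - #|I|%:R * expR (- (l * d)) <= smooth_minmax x.
Proof.
move=> xd; apply: (le_trans _ (prod_onem_ge (prod_logistic_bounds x))).
rewrite lerD2l lerN2 -sum1_card natr_sum mulr_suml; apply: ler_sum => i _; rewrite mul1r.
have [j xij] := xd i; rewrite (bigD1 j)//= -[leRHS]mulr1.
apply: ler_pM; rewrite ?logistic_ge0 ?logistic_le_expR//.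
  by apply: prodr_ge0 => k _; exact: logistic_ge0.
by apply: prodr_ile1 => k _; rewrite logistic_ge0 logistic_le1.
Qed.

Lemma smooth_minmax_le d x i : (forall j, x (i, j) <= m - d) ->
  smooth_minmax x <= #|J|%:R * expR (- (l * d)).
Proof.
move=> xd; rewrite /smooth_minmax (bigD1 i)//= -[leRHS]mulr1.
apply: ler_pM.
- by have /andP[_] := prod_logistic_bounds x i; rewrite subr_ge0.
- by apply: prodr_ge0 => k _; have /andP[_] := prod_logistic_bounds x k; rewrite subr_ge0.
- have y01 j : 0 <= 1 - logistic l m (x (i, j)) <= 1.
    by rewrite subr_ge0 logistic_le1 gerBl logistic_ge0.
  have := prod_onem_ge y01; under eq_bigr do rewrite subKr.
  rewrite lerBlDr addrC -lerBlDr => /le_trans; apply.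
  rewrite -sum1_card natr_sum mulr_suml; apply: ler_sum => j _.
  by rewrite mul1r onem_logistic_le_expR.
- apply: prodr_ile1 => k _; have /andP[p0 p1] := prod_logistic_bounds x k.
  by rewrite subr_ge0 p1 gerBl.
Qed.

End smooth_minmax.

Section gaussian_moments.
Context {R : realType}.
Implicit Types (v : nat -> R) (N : nat).

Lemma prod_expr_eq N v (r : 'I_N) : \prod_(i < N) v i ^+ (i == r :> nat) = v r.
Proof.
rewrite (bigD1 r)//= eqxx big1 ?mulr1// => i ir.
by rewrite -val_eqE/= in ir; rewrite (negbTE ir).
Qed.

Lemma iter_integrable_mean_coord N (g : R -> R) (r : 'I_N) : gauss_integrable g ->
  iter_integrable N (fun v => g (v r)) /\ iter_mean N (fun v => g (v r)) = gauss_mean g.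
Proof.
move=> gi; pose psi i : R -> R := if i == r :> nat then g else cst 1.
have psi_int i : gauss_integrable (psi i).
  by rewrite /psi; case: ifP => // _; exact: gauss_integrable_cst.
have psiE v : 1 * \prod_(i < N) psi i (v i) = g (v r).
  rewrite mul1r (bigD1 r)//= /psi eqxx big1 ?mulr1// => i.
  by rewrite -val_eqE/= => /negbTE ->.
split; first by apply: eq_iter_integrable (iter_integrable_prod 1 (fun i _ => psi_int i)).
rewrite -(eq_iter_mean _ psiE) iter_mean_prod// mul1r (bigD1 r)//= /psi eqxx.
rewrite big1 ?mulr1// => i; rewrite -val_eqE/= => /negbTE ->.
by rewrite gauss_mean_cst.
Qed.

Lemma iter_integrable_coordM N (r s : 'I_N) : iter_integrable N (fun v : nat -> R => v r * v s).
Proof.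
apply: eq_iter_integrable (@iter_integrable_prod R N
  (fun i x => x ^+ ((i == r) + (i == s))) 1 (fun i _ => gauss_integrable_expn _)) => v.
under eq_bigr do rewrite exprD.
by rewrite big_split/= !prod_expr_eq mul1r.
Qed.

Lemma iter_mean_coordM N (r s : 'I_N) :
  iter_mean N (fun v : nat -> R => v r * v s) = (r == s)%:R.
Proof.
transitivity (iter_mean N (fun v : nat -> R =>
    1 * \prod_(i < N) v i ^+ ((i == r :> nat) + (i == s :> nat)))).
  apply: eq_iter_mean => v; under eq_bigr do rewrite exprD.
  by rewrite big_split/= !prod_expr_eq mul1r.
rewrite (iter_mean_prod (psi := fun i x => x ^+ ((i == r) + (i == s)))) => [|i _]; last first.
  exact: gauss_integrable_expn.
rewrite mul1r; have [<-|rs] := eqVneq r s.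
  by rewrite big1// => i _; case: eqP => _ /=; rewrite ?gauss_mean_cst// gauss_mean_sqr.
rewrite -val_eqE in rs.
by rewrite (bigD1 r)//= eqxx (negbTE rs) /= gauss_mean_id mul0r.
Qed.

End gaussian_moments.

Section gaussian_process.
Context {R : realType} {P : finType}.
Implicit Types (N : nat) (X : P -> nat -> R) (v w : nat -> R) (p q : P).

Definition gauss_proc N X v p : R := \sum_(r < N) X p r * v r.
Definition proc_cov N X p q : R := \sum_(r < N) X p r * X q r.

Lemma gauss_procB N X v w p :
  gauss_proc N X v p - gauss_proc N X w p = gauss_proc N X (fun i => v i - w i) p.
Proof. by rewrite /gauss_proc -sumrB; apply: eq_bigr => r _; rewrite mulrBr. Qed.

Definition coef_norm N X : R := \sum_p \sum_(r < N) `|X p r|.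

Lemma coef_norm_ge0 N X : 0 <= coef_norm N X.
Proof. by apply: sumr_ge0 => p _; exact: sumr_ge0. Qed.

Lemma norm1_gauss_proc N X v : norm1 (gauss_proc N X v) <= coef_norm N X * abs_sum N v.
Proof.
rewrite mulr_suml; apply: ler_sum => p _.
rewrite (le_trans (ler_norm_sum _ _ _))// mulr_suml.
apply: ler_sum => r _; rewrite normrM ler_wpM2l//.
by rewrite /abs_sum (bigD1 r)//= lerDl sumr_ge0.
Qed.

Lemma norm1_gauss_procB N X v w :
  norm1 (fun p => gauss_proc N X v p - gauss_proc N X w p) <= coef_norm N X * dist1 N v w.
Proof. by under [X in norm1 X]eq_fun do rewrite gauss_procB; exact: norm1_gauss_proc. Qed.

Lemma iter_integrable_mean_gauss_proc N X p :
  iter_integrable N (fun v => gauss_proc N X v p) /\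
  iter_mean N (fun v => gauss_proc N X v p) = 0.
Proof.
have coord (r : 'I_N) := iter_integrable_mean_coord r (@gauss_integrable_id R).
have term_int (r : 'I_N) := iter_integrableZ (X p r) (coord r).1.
split; first exact: iter_integrable_sum.
rewrite iter_mean_sum// big1// => r _.
by rewrite iter_meanZ ?(coord r).2 ?gauss_mean_id ?mulr0//; exact: (coord r).1.
Qed.

Lemma iter_integrable_mean_gauss_procM N X p q :
  iter_integrable N (fun v => gauss_proc N X v p * gauss_proc N X v q) /\
  iter_mean N (fun v => gauss_proc N X v p * gauss_proc N X v q) = proc_cov N X p q.
Proof.
have procM v : \sum_(r < N) \sum_(s < N) X p r * X q s * (v r * v s) =
    gauss_proc N X v p * gauss_proc N X v q.
  rewrite /gauss_proc mulr_suml; apply: eq_bigr => r _; rewrite mulr_sumr.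
  by apply: eq_bigr => s _; rewrite mulrACA.
have term_int (r s : 'I_N) := iter_integrableZ (X p r * X q s) (iter_integrable_coordM r s).
have row_int (r : 'I_N) := iter_integrable_sum (index_enum 'I_N) (term_int r).
split; first exact: eq_iter_integrable procM (iter_integrable_sum _ row_int).
rewrite -(eq_iter_mean _ procM) iter_mean_sum//; apply: eq_bigr => r _.
rewrite iter_mean_sum// (bigD1 r)//= big1 => [|s /negbTE sr].
  by rewrite addr0 iter_meanZ ?iter_mean_coordM ?eqxx ?mulr1//; exact: iter_integrable_coordM.
rewrite iter_meanZ; last exact: iter_integrable_coordM.
by rewrite iter_mean_coordM eq_sym sr mulr0.
Qed.

Lemma iter_integrable_mean_linear_form N X (b : P -> R) :
  iter_integrable N (fun v => linear_form b (gauss_proc N X v)) /\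
  iter_mean N (fun v => linear_form b (gauss_proc N X v)) = 0.
Proof.
have proc p := iter_integrable_mean_gauss_proc N X p.
have term_int p := iter_integrableZ (b p) (proc p).1.
split; first exact: iter_integrable_sum.
by rewrite iter_mean_sum// big1// => p _; rewrite iter_meanZ ?(proc p).2 ?mulr0//; case: (proc p).
Qed.

Lemma iter_integrable_mean_quad_form N X (c : P -> P -> R) :
  iter_integrable N (fun v => quad_form c (gauss_proc N X v)) /\
  iter_mean N (fun v => quad_form c (gauss_proc N X v)) =
  \sum_p \sum_q c p q * proc_cov N X p q.
Proof.
have procM p q := iter_integrable_mean_gauss_procM N X p q.
have term_int p q := iter_integrableZ (c p q) (procM p q).1.
have row_int p := iter_integrable_sum (index_enum P) (term_int p).
split; first exact: iter_integrable_sum.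
rewrite iter_mean_sum//; apply: eq_bigr => p _; rewrite iter_mean_sum//.
by apply: eq_bigr => q _; rewrite iter_meanZ ?(procM p q).2//; case: (procM p q).
Qed.

Lemma iter_integrable_expR_abs_sum N : iter_integrable N (fun v : nat -> R => expR (abs_sum N v)).
Proof.
apply: eq_iter_integrable (@iter_integrable_prod R N (fun _ x => expR (1 * `|x|)) 1
  (fun i _ => gauss_integrable_expR_norm 1)) => v.
by rewrite mul1r /abs_sum expR_sum; apply: eq_bigr => i _; rewrite mul1r.
Qed.

End gaussian_process.

Section gaussian_comparison.
Context {R : realType} {P : finType}.
Variables (K : R -> (P -> R) -> (P -> P -> R) -> Prop) (f : (P -> R) -> R).
Hypothesis f_taylor : taylor_class K f.
Implicit Types (N : nat) (X Y Z : P -> nat -> R) (x b : P -> R) (v w : nat -> R) (a e : R).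

Lemma lipschitz_gauss_proc N Z x : exists2 C : R, 0 <= C & forall v w,
  `|f (fun p => x p + gauss_proc N Z v p) - f (fun p => x p + gauss_proc N Z w p)| <=
  C * dist1 N v w.
Proof.
have [L L0 f_lip] := taylor_class_lipschitz f_taylor.
exists (L * coef_norm N Z); first by rewrite mulr_ge0// coef_norm_ge0.
move=> v w; apply: (le_trans (f_lip _ _)); rewrite -mulrA ler_wpM2l//.
under [X in norm1 X]eq_fun do rewrite opprD addrACA subrr add0r.
exact: norm1_gauss_procB.
Qed.

Lemma iter_integrable_comp_gauss_proc N Z x :
  iter_integrable N (fun v => f (fun p => x p + gauss_proc N Z v p)).
Proof. by have [C _] := lipschitz_gauss_proc N Z x; exact: lipschitz_iter_integrable. Qed.

Lemma gauss_procZ N Z e v p : gauss_proc N (fun p r => e * Z p r) v p = e * gauss_proc N Z v p.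
Proof. by rewrite /gauss_proc mulr_sumr; apply: eq_bigr => r _; rewrite mulrA. Qed.

Lemma norm1_gauss_proc_cube N Z e v : 0 <= e ->
  norm1 (fun p => e * gauss_proc N Z v p) ^+ 3 <=
  6 * (coef_norm N Z * e) ^+ 3 * expR (abs_sum N v).
Proof.
move=> e0; set s := abs_sum N v; have s0 : 0 <= s by exact: abs_sum_ge0.
have -> : norm1 (fun p => e * gauss_proc N Z v p) = e * norm1 (gauss_proc N Z v).
  by rewrite /norm1 mulr_sumr; apply: eq_bigr => p _; rewrite normrM ger0_norm.
have s_cube : s ^+ 3 <= 6 * expR s.
  have := expR_ge1Dxn 2 s0; rewrite (_ : 3`! = 6)%N// => s3.
  by rewrite mulrC -ler_pdivrMr//; lra.
have proc_s : norm1 (gauss_proc N Z v) <= coef_norm N Z * s := norm1_gauss_proc N Z v.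
have Z0 := coef_norm_ge0 N Z.
rewrite -mulrA mulrCA; apply: (@le_trans _ _ ((coef_norm N Z * e) ^+ 3 * s ^+ 3)).
  rewrite -exprMn lerXn2r ?nnegrE ?mulr_ge0 ?norm1_ge0//.
  by rewrite mulrAC [leRHS]mulrC ler_wpM2l.
by rewrite ler_wpM2l// exprn_ge0// mulr_ge0.
Qed.

Lemma iter_mean_taylor N Z (M : R) : 0 <= M -> exists2 L : R, 0 <= L &
  forall x b c e, 0 <= e ->
   (forall h, `|f (fun p => x p + h p) - taylor_poly (f x) b c h| <= M * norm1 h ^+ 3) ->
   `|iter_mean N (fun v => f (fun p => x p + e * gauss_proc N Z v p)) -
     (f x + e ^+ 2 * \sum_p \sum_q c p q * proc_cov N Z p q)| <= L * e ^+ 3.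
Proof.
move=> M0; pose bound v := expR (abs_sum N v).
exists (M * (6 * coef_norm N Z ^+ 3) * iter_mean N bound).
  rewrite !mulr_ge0// ?exprn_ge0 ?coef_norm_ge0//.
  by apply: iter_mean_ge0 => v; exact: expR_ge0.
move=> x b c e e0 fh.
have [lin_int lin_mean] := iter_integrable_mean_linear_form N Z b.
have [quad_int quad_mean] := iter_integrable_mean_quad_form N Z c.
have cst_int := iter_integrable_cst N (f x).
have linZ_int := iter_integrableZ e lin_int; have quadZ_int := iter_integrableZ (e ^+ 2) quad_int.
have cstlin_int := iter_integrableD cst_int linZ_int.
have polyE v : taylor_poly (f x) b c (fun p => e * gauss_proc N Z v p) =
    f x + e * linear_form b (gauss_proc N Z v) + e ^+ 2 * quad_form c (gauss_proc N Z v).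
  rewrite /taylor_poly /linear_form /quad_form !mulr_sumr; congr (_ + _ + _).
    by apply: eq_bigr => p _; rewrite mulrCA.
  by apply: eq_bigr => p _; rewrite mulr_sumr; apply: eq_bigr => q _; ring.
have -> : f x + e ^+ 2 * \sum_p \sum_q c p q * proc_cov N Z p q = iter_mean N (fun v =>
    f x + e * linear_form b (gauss_proc N Z v) + e ^+ 2 * quad_form c (gauss_proc N Z v)).
  by rewrite iter_meanD// iter_meanD// !iter_meanZ// iter_mean_cst lin_mean quad_mean mulr0 addr0.
have -> : M * (6 * coef_norm N Z ^+ 3) * iter_mean N bound * e ^+ 3 =
    iter_mean N (fun v => M * (6 * (coef_norm N Z * e) ^+ 3) * bound v).
  by rewrite iter_meanZ; [rewrite exprMn; ring|exact: iter_integrable_expR_abs_sum].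
apply: ler_dist_iter_mean.
- apply: eq_iter_integrable (iter_integrable_comp_gauss_proc N (fun p r => e * Z p r) x) => v.
  by congr f; apply/funext => p; rewrite gauss_procZ.
- exact: iter_integrableD.
- by apply: iter_integrableZ; exact: iter_integrable_expR_abs_sum.
- move=> v; rewrite -polyE (le_trans (fh _))// -mulrA ler_wpM2l//.
  exact: norm1_gauss_proc_cube.
Qed.

Lemma iter_mean_infinitesimal_comparison N X Y :
  (forall u b c, K u b c -> \sum_p \sum_q c p q * proc_cov N Y p q <=
                            \sum_p \sum_q c p q * proc_cov N X p q) ->
  exists2 L : R, 0 <= L & forall x e, 0 <= e ->
    iter_mean N (fun w => f (fun p => x p + e * gauss_proc N Y w p)) - L * e ^+ 3 <=
    iter_mean N (fun w => f (fun p => x p + e * gauss_proc N X w p)).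
Proof.
move=> K_cov; have [M M0 f_exp] := taylor_class_expansion f_taylor.
have [LX LX0 meanX] := iter_mean_taylor N X M0; have [LY LY0 meanY] := iter_mean_taylor N Y M0.
exists (LX + LY); first exact: addr_ge0.
move=> x e e0; have [b [c [Kbc fh]]] := f_exp x.
have := meanX x b c e e0 fh; have := meanY x b c e e0 fh; rewrite !ler_norml.
have := ler_wpM2l (sqr_ge0 e) (K_cov _ _ _ Kbc).
set u := _ * \sum_p _; set u' := _ * \sum_p _ => uu /andP[h1 h2] /andP[h3 h4].
by rewrite mulrDl; lra.
Qed.

Lemma iter_mean_split_gauss_proc N Z (s t : nat -> R) :
  (forall i, [/\ 0 <= s i, 0 <= t i & s i ^+ 2 + t i ^+ 2 = 1]) ->
  iter_mean N (fun v => iter_mean N (fun w => f (fun p =>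
    gauss_proc N (fun p r => s r * Z p r) v p + gauss_proc N (fun p r => t r * Z p r) w p))) =
  iter_mean N (fun v => f (gauss_proc N Z v)).
Proof.
move=> st; have [B _ f_bnd] := taylor_class_bounded f_taylor.
have [C C0 fZ_lip] := lipschitz_gauss_proc N Z (fun=> 0).
rewrite -(@iter_mean_stable _ C B N (fun v => f (gauss_proc N Z v)) s t)//.
  apply: eq_iter_mean => v; apply: eq_iter_mean => w; congr f; apply/funext => p.
  by rewrite /gauss_proc -big_split; apply: eq_bigr => r _ /=; ring.
move=> v w; have := fZ_lip v w.
by under [X in f X]eq_fun do rewrite add0r; under [X in _ - f X]eq_fun do rewrite add0r.
Qed.

Lemma iter_integrable_iter_mean_gauss_proc N X Y : iter_integrable N (fun v =>
  iter_mean N (fun w => f (fun p => gauss_proc N X v p + gauss_proc N Y w p))).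
Proof.
have [L L0 f_lip] := taylor_class_lipschitz f_taylor.
pose C := L * (coef_norm N X + coef_norm N Y).
have [||_ mean_lip] := @lipschitz_iter_integrable_mean R (nat -> R) (dist1 N) C N
    (fun v w => f (fun p => gauss_proc N X v p + gauss_proc N Y w p)).
- exact: dist1xx.
- move=> v v' w w'; apply: (le_trans (f_lip _ _)); rewrite -mulrA ler_wpM2l//.
  apply: (@le_trans _ _ (coef_norm N X * dist1 N v v' + coef_norm N Y * dist1 N w w')).
    apply: le_trans (lerD (norm1_gauss_procB _ _ _ _) (norm1_gauss_procB _ _ _ _)).
    rewrite /norm1 -big_split; apply: ler_sum => p _ /=.
    by rewrite opprD addrACA ler_normD.
  have := mulr_ge0 (coef_norm_ge0 N X) (dist1_ge0 N w w').
  have := mulr_ge0 (coef_norm_ge0 N Y) (dist1_ge0 N v v'); rewrite mulrDl !mulrDr; lra.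
exact: lipschitz_iter_integrable mean_lip.
Qed.

Variables (N1 N2 : nat) (X Y : P -> nat -> R).
Hypothesis K_cov : forall u b c, K u b c ->
  \sum_p \sum_q c p q * proc_cov N2 Y p q <= \sum_p \sum_q c p q * proc_cov N1 X p q.

(* [X] and [Y] are driven by disjoint blocks of coordinates of one normal vector. *)
Definition block_coef (a b : R) p r : R :=
  if (r < N1)%N then a * X p r else b * Y p (r - N1)%N.

Lemma gauss_proc_block (a b : R) v p : gauss_proc (N1 + N2) (block_coef a b) v p =
  a * gauss_proc N1 X v p + b * gauss_proc N2 Y (fun i => v (N1 + i)%N) p.
Proof.
rewrite /gauss_proc big_split_ord !mulr_sumr /block_coef; congr (_ + _).
  by apply: eq_bigr => r _ /=; rewrite ltn_ord mulrA.
by apply: eq_bigr => r _ /=; rewrite ltnNge leq_addr/= addKn mulrA.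
Qed.

Lemma proc_cov_block (a b : R) p q : proc_cov (N1 + N2) (block_coef a b) p q =
  a ^+ 2 * proc_cov N1 X p q + b ^+ 2 * proc_cov N2 Y p q.
Proof.
rewrite /proc_cov big_split_ord !mulr_sumr /block_coef; congr (_ + _).
  by apply: eq_bigr => r _ /=; rewrite ltn_ord; ring.
by apply: eq_bigr => r _ /=; rewrite ltnNge leq_addr/= addKn; ring.
Qed.

Definition mixed_mean (a b : R) : R :=
  iter_mean (N1 + N2) (fun v => f (gauss_proc (N1 + N2) (block_coef a b) v)).

Lemma mixed_mean_X a : mixed_mean a 0 =
  iter_mean N1 (fun v => f (fun p => a * gauss_proc N1 X v p)).
Proof.
rewrite /mixed_mean iter_mean_addn; apply: eq_iter_mean => x.
rewrite -[RHS](iter_mean_cst N2); apply: eq_iter_mean => y.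
congr f; apply/funext => p; rewrite gauss_proc_block mul0r addr0; congr (_ * _).
by apply: eq_bigr => r _; rewrite ltn_ord.
Qed.

Lemma mixed_mean_Y (b : R) : mixed_mean 0 b =
  iter_mean N2 (fun w => f (fun p => b * gauss_proc N2 Y w p)).
Proof.
rewrite /mixed_mean iter_mean_addn -[RHS](iter_mean_cst N1).
apply: eq_iter_mean => x; apply: eq_iter_mean => y.
congr f; apply/funext => p; rewrite gauss_proc_block mul0r add0r; congr (_ * _).
by apply: eq_bigr => r _; rewrite ltnNge leq_addr/= addKn.
Qed.

Lemma unit_weights (a e : R) : 0 <= a -> 0 <= e -> exists s t : R,
  [/\ 0 <= s, 0 <= t, s ^+ 2 + t ^+ 2 = 1,
      a = s * Num.sqrt (a ^+ 2 + e ^+ 2) & e = t * Num.sqrt (a ^+ 2 + e ^+ 2)].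
Proof.
move=> a0 e0; have [->|a_neq0] := eqVneq a 0.
  by exists 0, 1; rewrite expr0n !add0r sqrtr_sqr ger0_norm// expr1n mul0r mul1r; split.
have c2 : 0 < a ^+ 2 + e ^+ 2 by rewrite ltr_pwDl ?sqr_ge0// exprn_gt0// lt0r a_neq0.
have c0 : 0 < Num.sqrt (a ^+ 2 + e ^+ 2) by rewrite sqrtr_gt0.
exists (a / Num.sqrt (a ^+ 2 + e ^+ 2)), (e / Num.sqrt (a ^+ 2 + e ^+ 2)).
rewrite !divr_ge0 ?(ltW c0)// !divfK ?gt_eqF//; split => //.
by rewrite !expr_div_n -mulrDl sqr_sqrtr ?divff// ?gt_eqF// ltW.
Qed.

Lemma mixed_mean_split (a b d e : R) : 0 <= a -> 0 <= b -> 0 <= d -> 0 <= e ->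
  mixed_mean (Num.sqrt (a ^+ 2 + d ^+ 2)) (Num.sqrt (b ^+ 2 + e ^+ 2)) =
  iter_mean (N1 + N2) (fun v => iter_mean (N1 + N2) (fun w => f (fun p =>
    gauss_proc (N1 + N2) (block_coef a b) v p + gauss_proc (N1 + N2) (block_coef d e) w p))).
Proof.
move=> a0 b0 d0 e0; have [sX [tX [sX0 tX0 stX aE dE]]] := unit_weights a0 d0.
have [sY [tY [sY0 tY0 stY bE eE]]] := unit_weights b0 e0.
pose s r := if (r < N1)%N then sX else sY; pose t r := if (r < N1)%N then tX else tY.
rewrite /mixed_mean -(@iter_mean_split_gauss_proc _ _ s t) => [|r]; last first.
  by rewrite /s /t; case: ifP.
apply: eq_iter_mean => v; apply: eq_iter_mean => w; congr f; apply/funext => p.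
congr (_ + _); apply: eq_bigr => r _; congr (_ * _); rewrite /s /t /block_coef.
  by case: ifP => _; rewrite mulrA -?aE -?bE.
by case: ifP => _; rewrite mulrA -?dE -?eE.
Qed.

Lemma mixed_mean_step : exists2 L : R, 0 <= L & forall a b e : R, 0 <= a -> 0 <= b -> 0 <= e ->
  mixed_mean a (Num.sqrt (b ^+ 2 + e ^+ 2)) - L * e ^+ 3 <=
  mixed_mean (Num.sqrt (a ^+ 2 + e ^+ 2)) b.
Proof.
have [|L L0 step] := @iter_mean_infinitesimal_comparison (N1 + N2)
    (block_coef 1 0) (block_coef 0 1).
  move=> u b c Kbc; have := K_cov Kbc.
  under [X in _ -> X <= _]eq_bigr do under eq_bigr do
    rewrite proc_cov_block expr0n expr1n mul0r add0r mul1r.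
  by under [X in _ -> _ <= X]eq_bigr do under eq_bigr do
    rewrite proc_cov_block expr0n expr1n mul0r addr0 mul1r.
exists L => // a b e a0 b0 e0.
have sqrt0 (x : R) : 0 <= x -> x = Num.sqrt (x ^+ 2 + 0 ^+ 2).
  by move=> x0; rewrite expr0n addr0 sqrtr_sqr ger0_norm.
rewrite [X in mixed_mean X _ - _](sqrt0 _ a0) [X in _ <= mixed_mean _ X](sqrt0 _ b0).
rewrite !mixed_mean_split// -[L * _](iter_mean_cst (N1 + N2)) -iter_meanB; last 2 first.
- exact: iter_integrable_iter_mean_gauss_proc.
- exact: iter_integrable_cst.
apply: le_iter_mean => [||v].
- apply: iter_integrableB; last exact: iter_integrable_cst.
  exact: iter_integrable_iter_mean_gauss_proc.
- exact: iter_integrable_iter_mean_gauss_proc.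
have scale (a' b' : R) w p : gauss_proc (N1 + N2) (block_coef (e * a') (e * b')) w p =
    e * gauss_proc (N1 + N2) (block_coef a' b') w p.
  by rewrite !gauss_proc_block mulrDr !mulrA.
have := step (gauss_proc (N1 + N2) (block_coef a b) v) e e0.
congr (_ - _ <= _); apply: eq_iter_mean => w; congr f; apply/funext => p;
  by rewrite -scale mulr1 mulr0.
Qed.

Lemma mixed_mean_steps : exists2 L : R, 0 <= L & forall k : nat, (0 < k)%N ->
  mixed_mean 0 1 - L / k%:R <= mixed_mean 1 0.
Proof.
have [L L0 step] := mixed_mean_step; exists L => // k k0.
pose e : R := k%:R^-1; have e0 : 0 <= e by rewrite invr_ge0.
have e2 : e ^+ 2 * (k * k)%:R = 1 by rewrite /e natrM; field; rewrite pnatr_eq0 -lt0n.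
have steps (j : nat) : (j <= k * k)%N -> mixed_mean 0 1 - L * e ^+ 3 * j%:R <=
    mixed_mean (Num.sqrt (e ^+ 2 * j%:R)) (Num.sqrt (e ^+ 2 * (k * k - j)%:R)).
  elim: j => [_|j IH jk]; first by rewrite !mulr0 sqrtr0 subn0 e2 sqrtr1 subr0.
  have := step (Num.sqrt (e ^+ 2 * j%:R)) (Num.sqrt (e ^+ 2 * (k * k - j.+1)%:R)) e
     (sqrtr_ge0 _) (sqrtr_ge0 _) e0.
  rewrite !sqr_sqrtr ?mulr_ge0 ?exprn_ge0//.
  have -> : e ^+ 2 * j%:R + e ^+ 2 = e ^+ 2 * j.+1%:R by rewrite -natr1; ring.
  have -> : e ^+ 2 * (k * k - j.+1)%:R + e ^+ 2 = e ^+ 2 * (k * k - j)%:R.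
    by rewrite -(subnSK jk) -[in RHS]natr1; ring.
  by apply: le_trans; have := IH (ltnW jk); rewrite -natr1; lra.
have := steps (k * k)%N (leqnn _); rewrite subnn mulr0 sqrtr0 e2 sqrtr1.
by congr (_ - _ <= _); rewrite /e natrM; field; rewrite pnatr_eq0 -lt0n.
Qed.

(* Lindeberg replacement: [Y] is traded for [X] in [k ^ 2] steps of size [1 / k], each
   costing [O(1 / k ^ 3)]. *)
Lemma gaussian_comparison :
  iter_mean N2 (fun w => f (gauss_proc N2 Y w)) <= iter_mean N1 (fun v => f (gauss_proc N1 X v)).
Proof.
have [L L0 steps] := mixed_mean_steps.
have -> : iter_mean N1 (fun v => f (gauss_proc N1 X v)) = mixed_mean 1 0.
  by rewrite mixed_mean_X; apply: eq_iter_mean => v; under eq_fun do rewrite mul1r.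
have -> : iter_mean N2 (fun w => f (gauss_proc N2 Y w)) = mixed_mean 0 1.
  by rewrite mixed_mean_Y; apply: eq_iter_mean => w; under eq_fun do rewrite mul1r.
apply/ler_addgt0Pr => d d0; pose k := (Num.truncn (L / d)).+1.
have Lk : L / k%:R <= d.
  by rewrite ler_pdivrMr ?ltr0n// mulrC -ler_pdivrMr// ltW// truncnS_gt.
by have := steps k isT; lra.
Qed.

End gaussian_comparison.

Section certified_events.
Context {R : realType}.
Implicit Types (N : nat) (Q E : (nat -> R) -> Prop) (f B : (nat -> R) -> R) (v : nat -> R).
Implicit Types (a d : R).

(* A Markov certificate that the Gaussian probability of [~ Q] is at most [d]; it does not
   require [Q] to be measurable. *)
Definition certified N Q d := exists B, [/\ iter_integrable N B, forall v, 0 <= B v,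
  iter_mean N B <= d & forall v, B v < 1 -> Q v].

Lemma certifiedW N Q Q' d d' : (forall v, Q v -> Q' v) -> d <= d' ->
  certified N Q d -> certified N Q' d'.
Proof.
move=> QQ' dd' [B [B_int B0 Bd BQ]]; exists B; split => //; first exact: le_trans dd'.
by move=> v /BQ; exact: QQ'.
Qed.

Lemma certifiedI N Q Q' d d' : certified N Q d -> certified N Q' d' ->
  certified N (fun v => Q v /\ Q' v) (d + d').
Proof.
move=> [B [B_int B0 Bd BQ]] [B' [B'_int B'0 B'd B'Q]]; exists (fun v => B v + B' v); split.
- exact: iter_integrableD.
- by move=> v; rewrite addr_ge0.
- by rewrite iter_meanD// lerD.
- by move=> v BB'; have := B0 v; have := B'0 v; split; [apply: BQ|apply: B'Q]; lra.
Qed.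

Definition seq_shift (k : nat) v : nat -> R := fun i => v (k + i)%N.

Lemma seq_shift1_scons t v : seq_shift 1 (scons t v) = v.
Proof. by apply/funext. Qed.

Lemma certified_seq_shift N Q d : certified N Q d -> certified N.+1 (fun v => Q (seq_shift 1 v)) d.
Proof.
move=> [B [B_int B0 Bd BQ]].
have mean_shift : (fun t => iter_mean N (fun v => B (seq_shift 1 (scons t v)))) =
    fun=> iter_mean N B.
  by apply/funext => t; apply: eq_iter_mean => v; rewrite seq_shift1_scons.
exists (fun v => B (seq_shift 1 v)); split => //.
- split => [t|]; last by rewrite mean_shift; exact: gauss_integrable_cst.
  by apply: eq_iter_integrable B_int => v; rewrite seq_shift1_scons.
- by rewrite /= mean_shift gauss_mean_cst.
- by move=> v /BQ.
Qed.

Lemma certified_coord_lt N (r : 'I_N) (k : R) : 0 < k ->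
  certified N (fun v => v r < k) (expR (- (k ^+ 2 / 2))).
Proof.
move=> k0; pose g x := expR (- k ^+ 2) * expR (k * x).
have g_int : gauss_integrable g by apply: gauss_integrableZ; exact: gauss_integrable_expR.
have [gr_int gr_mean] := iter_integrable_mean_coord r g_int.
exists (fun v => g (v r)); split => //.
- by move=> v; rewrite mulr_ge0 ?expR_ge0.
- rewrite gr_mean gauss_meanZ ?gauss_mean_expR; last exact: gauss_integrable_expR.
  by rewrite -expRD ler_expR; lra.
- by move=> v; rewrite /g -expRD expR_lt1 expr2 -mulrN -mulrDr pmulr_rlt0// addrC subr_lt0.
Qed.

Lemma certified_abs_sum_lt N (s : R) : 0 <= s ->
  certified N (fun v => s * abs_sum N v < 1) (s * (N%:R * gauss_mean (fun x : R => `|x|))).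
Proof.
move=> s0; have abs_int := gauss_integrable_norm (@gauss_integrable_id R).
have coord (r : 'I_N) := iter_integrable_mean_coord r abs_int.
have sum_int : iter_integrable N (fun v => \sum_(r < N) `|v r|).
  by apply: iter_integrable_sum => r; exact: (coord r).1.
exists (fun v => s * abs_sum N v); split => //.
- exact: iter_integrableZ.
- by move=> v; rewrite mulr_ge0// abs_sum_ge0.
- rewrite iter_meanZ// ler_wpM2l// /abs_sum iter_mean_sum => [|r]; last exact: (coord r).1.
  rewrite (eq_bigr (fun=> gauss_mean (fun x : R => `|x|))) => [|r _]; last exact: (coord r).2.
  by rewrite sumr_const card_ord mulr_natl.
Qed.

Lemma certified_iter_mean_ge N Q d f a : certified N Q d -> iter_integrable N f ->
  (forall v, 0 <= f v) -> a <= 1 -> (forall v, Q v -> a <= f v) -> a - d <= iter_mean N f.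
Proof.
move=> [B [B_int B0 Bd BQ]] f_int f0 a1 Qf; have a_int := iter_integrable_cst N a.
apply: (@le_trans _ _ (iter_mean N (fun v => a - B v))).
  by rewrite iter_meanB// iter_mean_cst lerD2l lerN2.
apply: le_iter_mean => // [|v]; first exact: iter_integrableB.
have [/BQ/Qf af|B1] := ltP (B v) 1; first by have := B0 v; lra.
by have := f0 v; lra.
Qed.

Lemma certified_giter_ge N Q d f a E : certified N Q d -> iter_integrable N f ->
  (forall v, f v <= 1) -> 0 <= a -> (forall v, Q v -> ~ E v -> f v <= a) ->
  ((iter_mean N f - a - d)%:E <= giter N (fun v => (\1_E v)%:E))%E.
Proof.
move=> [B [B_int B0 Bd BQ]] f_int f1 a0 QEf; have a_int := iter_integrable_cst N a.
apply: (@le_trans _ _ (iter_mean N (fun v => f v - a - B v))%:E).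
  rewrite lee_fin iter_meanB//; last exact: iter_integrableB.
  by rewrite iter_meanB// iter_mean_cst lerD2l lerN2.
apply: iter_mean_le_giter => [|v|v]; rewrite ?lee_fin//.
  by apply: iter_integrableB => //; exact: iter_integrableB.
rewrite indicE; have := B0 v; have := f1 v.
have [_|/negP Ev] := boolP (v \in (E : set (nat -> R))); rewrite /=; first lra.
have [/BQ Qv|B1] := ltP (B v) 1; last lra.
by have := QEf v Qv (fun h => Ev (mem_set h)); lra.
Qed.

Lemma giter_seq_shift N (h : (nat -> R) -> \bar R) :
  giter N.+1 (fun v => h (seq_shift 1 v)) = giter N h.
Proof.
rewrite /= (_ : (fun t => _) = cst (giter N h)); last first.
  by apply/funext => t; congr giter; apply/funext => v; rewrite seq_shift1_scons.
by rewrite integral_cst// [X in (_ * X)%E](@probability_setT _ _ _ (normal_prob (0 : R) 1)) mule1.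
Qed.

End certified_events.

Section gordon_finite.
Context {R : realType}.
Implicit Types (m n : nat) (z w e v u : nat -> R).

Definition dot n z w : R := \sum_(k < n) z k * w k.
Definition bilin_form m n z v w : R := \sum_(k < m) \sum_(l < n) z k * v (k * n + l)%N * w l.

Lemma sum_ord_mul m n (G : nat -> R) :
  \sum_(r < m * n) G r = \sum_(k < m) \sum_(l < n) G (k * n + l)%N.
Proof.
rewrite -(big_mkord predT) big_nat_mul big_mkord; apply: eq_bigr => k _.
rewrite -[(k * n)%N]add0n big_addn mulSn addnK big_mkord.
by apply: eq_bigr => l _; rewrite addnC.
Qed.

Lemma sum_ord_divmod m n (G : nat -> nat -> nat -> R) :
  \sum_(r < m * n) G r (r %/ n)%N (r %% n)%N = \sum_(k < m) \sum_(l < n) G (k * n + l)%N k l.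
Proof.
rewrite (sum_ord_mul m n (fun r => G r (r %/ n)%N (r %% n)%N)).
apply: eq_bigr => k _; apply: eq_bigr => l _.
have n0 : (0 < n)%N by exact: leq_ltn_trans (ltn_ord l).
by rewrite divnMDl// divn_small ?ltn_ord// addn0 modnMDl modn_small.
Qed.

Lemma dot_le1 n z w : dot n z z = 1 -> dot n w w = 1 -> dot n z w <= 1.
Proof.
move=> z1 w1; have : 0 <= dot n (fun k => z k - w k) (fun k => z k - w k).
  by apply: sumr_ge0 => k _; rewrite -expr2 sqr_ge0.
have -> : dot n (fun k => z k - w k) (fun k => z k - w k) =
    dot n z z + dot n w w - 2 * dot n z w.
  by rewrite /dot mulr_sumr -big_split -sumrB; apply: eq_bigr => k _ /=; ring.
by rewrite z1 w1; lra.
Qed.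

(* Coefficients of the processes [g0 + z A w] and [z g + w h] on the underlying independent
   normal variables [(g0, A)] and [(g, h)]. *)
Definition bilin_coef n z w (r : nat) : R :=
  if r is r'.+1 then z (r' %/ n)%N * w (r' %% n)%N else 1.
Definition linear_coef m z w (r : nat) : R := if (r < m)%N then z r else w (r - m)%N.

Lemma sum_bilin_coef m n z w u :
  \sum_(r < (m * n).+1) bilin_coef n z w r * u r = u 0%N + bilin_form m n z (seq_shift 1 u) w.
Proof.
rewrite big_ord_recl/= mul1r; congr (_ + _).
rewrite (sum_ord_divmod m n (fun r k l => z k * w l * u (bump 0 r))).
by apply: eq_bigr => k _; apply: eq_bigr => l _; rewrite mulrAC.
Qed.

Lemma cov_bilin_coef m n z w z' w' :
  \sum_(r < (m * n).+1) bilin_coef n z w r * bilin_coef n z' w' r =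
  1 + dot m z z' * dot n w w'.
Proof.
rewrite big_ord_recl/= mul1r; congr (_ + _).
rewrite (sum_ord_divmod m n (fun _ k l => z k * w l * (z' k * w' l))) /dot mulr_suml.
by apply: eq_bigr => k _; rewrite mulr_sumr; apply: eq_bigr => l _; ring.
Qed.

Lemma sum_linear_coef m n z w e :
  \sum_(r < m + n) linear_coef m z w r * e r = dot m z e + dot n w (seq_shift m e).
Proof.
rewrite big_split_ord /=; congr (_ + _); apply: eq_bigr => k _ /=; rewrite /linear_coef.
  by rewrite ltn_ord.
by rewrite ltnNge leq_addr/= addKn.
Qed.

Lemma cov_linear_coef m n z w z' w' :
  \sum_(r < m + n) linear_coef m z w r * linear_coef m z' w' r = dot m z z' + dot n w w'.
Proof.
rewrite sum_linear_coef; congr (_ + _); apply: eq_bigr => k _.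
  by rewrite /linear_coef ltn_ord.
by rewrite /seq_shift /linear_coef ltnNge leq_addr/= addKn.
Qed.

Context {I J : finType}.
Variables (m n : nat) (Z W : I * J -> nat -> R).
Hypothesis Z_unit : forall p, dot m (Z p) (Z p) = 1.
Hypothesis W_unit : forall p, dot n (W p) (W p) = 1.
Hypothesis row_shared : forall p q : I * J, p.1 = q.1 -> Z p = Z q \/ W p = W q.

(* On a row the two covariances agree; in general their difference is
   [(1 - dot z z') (1 - dot w w') >= 0]. *)
Lemma gordon_comparison (f : (I * J -> R) -> R) : taylor_class minmax_jet f ->
  iter_mean (m + n) (fun e => f (fun p => dot m (Z p) e + dot n (W p) (seq_shift m e))) <=
  iter_mean (m * n).+1 (fun u => f (fun p => u 0%N + bilin_form m n (Z p) (seq_shift 1 u) (W p))).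
Proof.
move=> f_taylor; pose X p := bilin_coef n (Z p) (W p); pose Y p := linear_coef m (Z p) (W p).
have XE u : (fun p => u 0%N + bilin_form m n (Z p) (seq_shift 1 u) (W p)) =
    gauss_proc (m * n).+1 X u.
  by apply/funext => p; rewrite /gauss_proc sum_bilin_coef.
have YE e : (fun p => dot m (Z p) e + dot n (W p) (seq_shift m e)) = gauss_proc (m + n) Y e.
  by apply/funext => p; rewrite /gauss_proc sum_linear_coef.
under eq_iter_mean do rewrite YE; under [leRHS]eq_iter_mean do rewrite XE.
apply: (gaussian_comparison f_taylor) => u b c [_ _ c0].
apply: ler_sum => p _; apply: ler_sum => q _.
have -> : proc_cov (m * n).+1 X p q = 1 + dot m (Z p) (Z q) * dot n (W p) (W q).
  exact: cov_bilin_coef.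
have -> : proc_cov (m + n) Y p q = dot m (Z p) (Z q) + dot n (W p) (W q).
  exact: cov_linear_coef.
have [/row_shared[] ->|pq] := eqVneq p.1 q.1; rewrite ?Z_unit ?W_unit ?mul1r ?mulr1//.
  by rewrite [1 + _]addrC.
rewrite ler_wpM2l ?c0//.
have := dot_le1 (Z_unit p) (Z_unit q); have := dot_le1 (W_unit p) (W_unit q).
by set s := dot _ _ _; set t := dot _ _ _ => s1 t1; nra.
Qed.

Lemma expR_decay_le (C k d : R) : 0 <= C -> 0 < k -> 0 < d ->
  exists2 l : R, 0 <= l & C * expR (- (l * k)) <= d.
Proof.
move=> C0 k0 d0; exists (C / d / k); first by rewrite !divr_ge0// ltW.
rewrite divfK ?gt_eqF// expRN ler_pdivrMr ?expR_gt0// mulrC -ler_pdivrMr//.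
by apply: le_trans (expR_ge1Dx _); rewrite lerDr.
Qed.

Variables (k dX dY : R) (QX QY E : (nat -> R) -> Prop).
Hypothesis k0 : 0 < k.
Hypothesis QY_certified : certified (m + n) QY dY.
Hypothesis QY_minmax : forall e, QY e -> forall i, exists j,
  4 * k <= dot m (Z (i, j)) e + dot n (W (i, j)) (seq_shift m e).
Hypothesis QX_certified : certified (m * n) QX dX.
Hypothesis QX_minmax : forall v, QX v ->
  (forall i, exists j, k <= bilin_form m n (Z (i, j)) v (W (i, j))) -> E v.

Let X_certified :
  certified (m * n).+1 (fun u => u 0%N < k /\ QX (seq_shift 1 u)) (expR (- (k ^+ 2 / 2)) + dX).
Proof. by apply: certifiedI (certified_seq_shift _) => //; exact: (certified_coord_lt ord0). Qed.

Lemma gordon_finite :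
  ((1 - dX - dY - expR (- (k ^+ 2 / 2)))%:E <= giter (m * n) (fun v => (\1_E v)%:E))%E.
Proof.
rewrite -giter_seq_shift.
apply/lee_subgt0Pr => d d0.
have [|l l0 ld] := @expR_decay_le (#|I|%:R + #|J|%:R) k d _ k0 d0; first by rewrite addr_ge0.
pose q := expR (- (l * k)); have q0 : 0 <= q by exact: expR_ge0.
pose f : (I * J -> R) -> R := smooth_minmax l (3 * k).
have f_taylor : taylor_class minmax_jet f by exact: taylor_class_smooth_minmax.
have f_int N T : iter_integrable N (fun v => f (gauss_proc N T v)).
  apply: eq_iter_integrable (iter_integrable_comp_gauss_proc f_taylor N T (fun=> 0)) => v.
  by under [X in f X]eq_fun do rewrite add0r.
have lower : 1 - #|I|%:R * q - dY <= iter_mean (m + n) (fun e =>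
    f (fun p => dot m (Z p) e + dot n (W p) (seq_shift m e))).
  apply: certified_iter_mean_ge QY_certified _ _ _ _ => [|e||e Qe].
  - apply: eq_iter_integrable (f_int _ (fun p => linear_coef m (Z p) (W p))) => e.
    by congr f; apply/funext => p; rewrite /gauss_proc sum_linear_coef.
  - exact: smooth_minmax_ge0.
  - by rewrite gerBl mulr_ge0.
  - apply: smooth_minmax_ge => // i; have [j ij] := QY_minmax Qe i; exists j.
    by apply: le_trans ij; lra.
apply: (le_trans _ (certified_giter_ge (a := #|J|%:R * q)
  (f := fun u => f (fun p => u 0%N + bilin_form m n (Z p) (seq_shift 1 u) (W p)))
  X_certified _ _ _ _)).
- rewrite -EFinB lee_fin; have := gordon_comparison f_taylor.
  by move: lower ld; rewrite -/q mulrDl; lra.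
- apply: eq_iter_integrable (f_int _ (fun p => bilin_coef n (Z p) (W p))) => u.
  by congr f; apply/funext => p; rewrite /gauss_proc sum_bilin_coef.
- by move=> u; exact: smooth_minmax_le1.
- by rewrite mulr_ge0.
- move=> u [u0 /QX_minmax QE] nE.
  have /existsNP[i /forallNP row_lt] : ~ forall i, exists j,
      k <= bilin_form m n (Z (i, j)) (seq_shift 1 u) (W (i, j)) by move=> /QE/nE.
  apply: (@smooth_minmax_le _ _ _ _ _ _ _ _ i) => // j.
  by have /negP := row_lt j; rewrite -ltNge; lra.
Qed.

End gordon_finite.

Section gordon_minmax.
Context {R : realType}.
Implicit Types (m n : nat) (x y z w e v : nat -> R) (eta : R).

Lemma ler_norm_unit_entry n w (k : 'I_n) : dot n w w = 1 -> `|w k| <= 1.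
Proof.
move=> w1; rewrite -(@ler_pXn2r _ 2)// ?nnegrE// expr1n -w1 real_normK ?num_real//.
rewrite /dot (bigD1 k)//= -expr2 lerDl; apply: sumr_ge0 => i _.
by rewrite -expr2 sqr_ge0.
Qed.

Lemma ler_dist_dot n x y z eta : (forall k : 'I_n, `|x k - y k| <= eta) ->
  `|dot n x z - dot n y z| <= eta * abs_sum n z.
Proof.
move=> xy; rewrite /dot -sumrB (le_trans (ler_norm_sum _ _ _))// mulr_sumr.
by apply: ler_sum => k _; rewrite -mulrBl normrM ler_wpM2r.
Qed.

Lemma ler_dist_bilin_form m n z z' v w w' eta :
  (forall k : 'I_m, `|z k - z' k| <= eta) -> (forall l : 'I_n, `|w l - w' l| <= eta) ->
  (forall k : 'I_m, `|z' k| <= 1) -> (forall l : 'I_n, `|w l| <= 1) ->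
  `|bilin_form m n z v w - bilin_form m n z' v w'| <= 2 * eta * abs_sum (m * n) v.
Proof.
move=> zz ww z1 w1; rewrite /bilin_form -sumrB (le_trans (ler_norm_sum _ _ _))//.
rewrite /abs_sum (sum_ord_mul m n (fun r => `|v r|)) mulr_sumr.
apply: ler_sum => k _; rewrite -sumrB mulr_sumr (le_trans (ler_norm_sum _ _ _))//.
apply: ler_sum => l _; set a := v _.
have -> : z k * a * w l - z' k * a * w' l = ((z k - z' k) * w l + z' k * (w l - w' l)) * a by ring.
rewrite normrM ler_wpM2r// (le_trans (ler_normD _ _))// !normrM mulrDl mul1r lerD//.
  by rewrite -[leRHS]mulr1 ler_pM.
by rewrite -[leRHS]mul1r ler_pM.
Qed.

(* Round every coordinate down to the grid of mesh [1 / K]; two vectors in the same cell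
   are [eta]-close. *)
Lemma finite_net n (T : set (nat -> R)) eta : 0 < eta ->
  T !=set0 -> (forall w, T w -> forall i : 'I_n, `|w i| <= 1) ->
  exists (I : finType) (net : I -> nat -> R), (forall i, T (net i)) /\
    forall w, T w -> exists i, forall k : 'I_n, `|w k - net i k| <= eta.
Proof.
move=> eta0 [w0 Tw0] T1.
pose K : nat := (Num.truncn eta^-1).+1.
have K0 : 0 < K%:R :> R by rewrite ltr0n.
have K_eta : K%:R^-1 <= eta.
  by rewrite -[leRHS]invrK lef_pV2 ?posrE ?invr_gt0//; apply: ltW; exact: truncnS_gt.
pose cell (t : R) : 'I_(2 * K).+1 := inord (Num.truncn (K%:R * (t + 1))).
pose net (g : {ffun 'I_n -> 'I_(2 * K).+1}) : nat -> R :=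
  xget w0 [set w | T w /\ forall k : 'I_n, cell (w k) = g k].
exists {ffun 'I_n -> 'I_(2 * K).+1}, net; split.
  by move=> g; rewrite /net; case: xgetP => [w _ []|].
move=> w Tw; exists [ffun k : 'I_n => cell (w k)] => k; rewrite /net.
case: xgetP => [w' _ [Tw' /(_ k)]|/(_ w)[]]; last by split => // j; rewrite ffunE.
have scaled_ge0 u : T u -> 0 <= K%:R * (u k + 1).
  by move=> /T1/(_ k); rewrite ler_norml => /andP[u1 _]; rewrite mulr_ge0 ?(ltW K0)//; lra.
have cell_lt u : T u -> (Num.truncn (K%:R * (u k + 1)) < (2 * K).+1)%N.
  move=> Tu; have := T1 u Tu k; rewrite ler_norml => /andP[_ u2].
  rewrite ltnS -(ler_nat R) (le_trans (_ : _ <= K%:R * (u k + 1)))//.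
    by rewrite truncn_le scaled_ge0.
  by rewrite natrM mulrC ler_wpM2r ?(ltW K0)//; lra.
rewrite ffunE /cell => /(congr1 val); rewrite /= !inordK ?cell_lt// => same_cell.
have /andP[a1 a2] := truncn_itv (scaled_ge0 _ Tw).
have /andP[b1 b2] := truncn_itv (scaled_ge0 _ Tw').
rewrite same_cell -natr1 in b1 b2; rewrite -natr1 in a2.
apply: le_trans K_eta; rewrite -[leRHS]mul1r ler_pdivlMr// -(gtr0_norm K0) -normrM.
rewrite ler_norml; move: a1 a2 b1 b2; set u := (Num.truncn _)%:R => a1 a2 b1 b2.
by apply/andP; split; lra.
Qed.

Variables (a b m n : nat) (X Y : set (nat -> R)).
Variables (Z W : (nat -> R) -> (nat -> R) -> nat -> R).
Hypotheses (X_neq0 : X !=set0) (Y_neq0 : Y !=set0).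
Hypothesis X_le1 : forall x, X x -> forall i : 'I_a, `|x i| <= 1.
Hypothesis Y_le1 : forall y, Y y -> forall i : 'I_b, `|y i| <= 1.
Hypothesis Z_unit : forall x y, X x -> Y y -> dot m (Z x y) (Z x y) = 1.
Hypothesis W_unit : forall x y, X x -> Y y -> dot n (W x y) (W x y) = 1.
Hypothesis row_shared : forall x y y', Z x y = Z x y' \/ W x y = W x y'.
Hypothesis Z_nonexpansive : forall x x' y y' eta, 0 < eta ->
  (forall i : 'I_a, `|x i - x' i| <= eta) -> (forall i : 'I_b, `|y i - y' i| <= eta) ->
  forall k : 'I_m, `|Z x y k - Z x' y' k| <= eta.
Hypothesis W_nonexpansive : forall x x' y y' eta, 0 < eta ->
  (forall i : 'I_a, `|x i - x' i| <= eta) -> (forall i : 'I_b, `|y i - y' i| <= eta) ->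
  forall k : 'I_n, `|W x y k - W x' y' k| <= eta.
Variables (k d : R) (Q E : (nat -> R) -> Prop).
Hypothesis k0 : 0 < k.
Hypothesis Q_certified : certified (m + n) Q d.
Hypothesis Q_minmax : forall e, Q e -> forall x, X x -> exists2 y, Y y &
  5 * k <= dot m (Z x y) e + dot n (W x y) (seq_shift m e).
Hypothesis E_minmax : forall v,
  (forall x, X x -> exists2 y, Y y & k / 2 <= bilin_form m n (Z x y) v (W x y)) -> E v.

Lemma abs_sum_split e : abs_sum (m + n) e = abs_sum m e + abs_sum n (seq_shift m e).
Proof. by rewrite /abs_sum big_split_ord. Qed.

(* Outside an event of small probability the entries of the normal vectors are bounded, so
   that a net of fixed mesh is enough. *)
Lemma gordon_minmax :
  ((1 - d - expR (- (k ^+ 2 / 2)))%:E <= giter (m * n) (fun v => (\1_E v)%:E))%E.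
Proof.
apply/lee_subgt0Pr => delta delta0.
pose g : R := gauss_mean (fun t : R => `|t|); have g0 : 0 <= g by exact: gauss_mean_ge0.
pose M : R := ((m * n)%:R + (m + n)%:R) * g + 1.
have M0 : 0 < M by rewrite ltr_wpDl// mulr_ge0.
pose s : R := delta / M; have s0 : 0 < s by rewrite divr_gt0.
have sM : s * ((m * n)%:R * g) + s * ((m + n)%:R * g) <= delta.
  by rewrite -mulrDr -mulrDl /s mulrAC ler_pdivrMr// ler_wpM2l ?(ltW delta0)// lerDl.
pose eta : R := k * s / 4; have eta0 : 0 < eta by rewrite divr_gt0// mulr_gt0.
have eta_abs_sum t : s * t < 1 -> eta * t <= k / 4.
  by move=> /ltW/(ler_wpM2l (ltW k0)); rewrite /eta; lra.
have [I [netX [netX_X netX_close]]] := finite_net eta0 X_neq0 X_le1.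
have [J [netY [netY_Y netY_close]]] := finite_net eta0 Y_neq0 Y_le1.
pose ZIJ (p : I * J) := Z (netX p.1) (netY p.2); pose WIJ (p : I * J) := W (netX p.1) (netY p.2).
have eta_refl N w (i : 'I_N) : `|w i - w i| <= eta by rewrite subrr normr0 ltW.
apply: (le_trans _ (@gordon_finite _ _ _ m n ZIJ WIJ _ _ _ k _ _ _ _ E k0
  (certifiedI Q_certified (certified_abs_sum_lt _ (ltW s0))) _
  (certified_abs_sum_lt (m * n) (ltW s0)) _)).
- by rewrite -EFinB lee_fin -/g; lra.
- by move=> p; exact: Z_unit.
- by move=> p; exact: W_unit.
- by move=> [i j] [i' j'] /= ->; exact: row_shared.
- move=> e [Qe small] i; have [y Yy xy] := Q_minmax Qe (netX_X i).
  have [j yj] := netY_close y Yy; exists j; rewrite /ZIJ /WIJ /=.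
  have := ler_dist_dot e (Z_nonexpansive eta0 (eta_refl _ (netX i)) yj).
  have := ler_dist_dot (seq_shift m e) (W_nonexpansive eta0 (eta_refl _ (netX i)) yj).
  have := eta_abs_sum _ small; rewrite abs_sum_split mulrDr !ler_norml.
  by move=> ? /andP[? ?] /andP[? ?]; lra.
- move=> v small minmax; apply: E_minmax => x Xx; have [i xi] := netX_close x Xx.
  have [j ij] := minmax i; exists (netY j) => //; move: ij; rewrite /ZIJ /WIJ /=.
  have := @ler_dist_bilin_form m n (Z x (netY j)) (Z (netX i) (netY j)) v _ _ eta
    (Z_nonexpansive eta0 xi (eta_refl _ (netY j))) (W_nonexpansive eta0 xi (eta_refl _ (netY j)))
    (fun k => ler_norm_unit_entry k (Z_unit (netX_X i) (netY_Y j)))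
    (fun l => ler_norm_unit_entry l (W_unit Xx (netY_Y j))).
  by have := eta_abs_sum _ small; rewrite ler_norml => ? /andP[? ?] ?; lra.
Qed.

End gordon_minmax.

Section chernoff.
Context {R : realType}.
Implicit Types (phi : R -> R) (a b c t x : R).

Lemma expR_le_quad x : expR x <= 1 + x + x ^+ 2 * expR `|x|.
Proof.
have sub_le (y : R) : expR y - 1 <= y * expR y.
  have := expR_ge1Dx (- y) => /(ler_wpM2r (expR_ge0 y)).
  by rewrite -expRD addNr expR0 mulrDl mul1r; lra.
have [x0|x0] := leP 0 x.
  by rewrite ger0_norm//; have := sub_le x; have := ler_wpM2l x0 (sub_le x); nra.
have x_sqr : x * (expR x - 1) <= x ^+ 2.
  by have := ler_wnM2l (ltW x0) (expR_ge1Dx x); rewrite expr2; nra.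
have : 1 <= expR `|x| by rewrite -[leLHS]expR0 ler_expR.
by have := sub_le x; have := sqr_ge0 x; nra.
Qed.

Definition subexponential phi := measurable_fun setT phi /\
  exists2 s : R, 0 < s & gauss_integrable (fun x => expR (s * `|phi x|)).

Lemma le_subexponential phi psi : measurable_fun setT phi ->
  (forall x, `|phi x| <= `|psi x|) -> subexponential psi -> subexponential phi.
Proof.
move=> mphi phi_psi [mpsi [s s0 s_int]]; split => //; exists s => //.
apply: le_gauss_integrable s_int => [|x].
  by apply: measurableT_comp => //; apply: measurable_funM => //; exact: measurableT_comp.
by rewrite ger0_norm ?expR_ge0// ler_expR ler_wpM2l// ltW.
Qed.

Lemma subexponential_integrable phi : subexponential phi -> gauss_integrable phi.
Proof.
move=> [mphi [s s0 s_int]]; apply: le_gauss_integrable (gauss_integrableZ s^-1 s_int) => // x.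
by rewrite ler_pdivlMl// (le_trans _ (expR_ge1Dx _))// lerDr.
Qed.

Lemma subexponential_heavisideM t phi : subexponential phi ->
  subexponential (fun x => heaviside t x * phi x).
Proof.
move=> phi_sub; apply: le_subexponential (phi_sub) => [|x].
  by apply: measurable_funM; [exact: measurable_heaviside|exact: phi_sub.1].
by rewrite normrM (ger0_norm (heaviside_ge0 t x)) ler_piMl// heaviside_le1.
Qed.

Lemma subexponential_quad a b c : subexponential (fun x => a * x ^+ 2 + b * x + c).
Proof.
have mquad : measurable_fun setT (fun x => a * x ^+ 2 + b * x + c).
  apply: continuous_measurable_fun => x; apply: cvgD; last exact: cvg_cst.
  apply: cvgD; last exact: mulrl_continuous.
  by apply: cvgM; [exact: cvg_cst|exact: exprn_continuous].
pose B := `|a| + `|b| + `|c|; have B0 : 0 <= B by rewrite !addr_ge0.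
have quad_le x : `|a * x ^+ 2 + b * x + c| <= B * (1 + x ^+ 2).
  rewrite (le_trans (ler_normD _ _))// (le_trans (lerD (ler_normD _ _) (lexx _)))//.
  rewrite (normrM a) (normrM b) (ger0_norm (sqr_ge0 x)).
  have x1 : `|x| <= 1 + x ^+ 2.
    by rewrite -[x ^+ 2]real_normK ?num_real//; have := sqr_ge0 (`|x| - 1); nra.
  have := ler_wpM2l (normr_ge0 b) x1; have := mulr_ge0 (normr_ge0 c) (sqr_ge0 x).
  by have := normr_ge0 a; rewrite /B; lra.
have B4 : 0 < 4 * (B + 1) by rewrite mulr_gt0// ltr_wpDl.
split => //; exists (4 * (B + 1))^-1; first by rewrite invr_gt0.
apply: le_gauss_integrable (gauss_integrableZ (expR 4^-1) (@gauss_integrable_expR_sqr R)) => [|x].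
  by apply: measurableT_comp => //; apply: measurable_funM => //; exact: measurableT_comp.
rewrite ger0_norm ?expR_ge0// -expRD ler_expR ler_pdivrMl// (le_trans (quad_le x))//.
by have := sqr_ge0 x; nra.
Qed.

(* Taylor expansion of the moment generating function at [0]; the quadratic remainder is
   controlled by a fixed exponential moment. *)
Lemma subexponential_mgf phi : subexponential phi -> exists C s : R,
  [/\ 0 <= C, 0 < s & forall xi, 0 <= xi <= s -> gauss_integrable (fun x => expR (xi * phi x)) /\
    gauss_mean (fun x => expR (xi * phi x)) <= expR (xi * gauss_mean phi + C * xi ^+ 2)].
Proof.
move=> phi_sub; have phi_int := subexponential_integrable phi_sub.
have [mphi [s3 s30 s3_int]] := phi_sub; pose s := s3 / 3; have s0 : 0 < s by rewrite divr_gt0.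
pose K := gauss_mean (fun x => expR (s3 * `|phi x|)).
have K0 : 0 <= K by apply: gauss_mean_ge0 => x; exact: expR_ge0.
exists (s ^- 2 * K), s; split => // [|xi /andP[xi0 xi_s]].
  by rewrite mulr_ge0// invr_ge0 exprn_ge0// ltW.
have xi_phi x : `|xi * phi x| <= s * `|phi x| by rewrite normrM ger0_norm// ler_wpM2r.
have remainder x : (xi * phi x) ^+ 2 * expR `|xi * phi x| <=
    xi ^+ 2 * s ^- 2 * expR (s3 * `|phi x|).
  have -> : (xi * phi x) ^+ 2 = xi ^+ 2 * s ^- 2 * (s * `|phi x|) ^+ 2.
    by rewrite (exprMn _ xi) (exprMn _ s) real_normK ?num_real//; field; rewrite gt_eqF.
  rewrite -mulrA ler_wpM2l ?mulr_ge0 ?invr_ge0 ?exprn_ge0 ?(ltW s0)//.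
  have -> : s3 * `|phi x| = 2%:R * (s * `|phi x|) + s * `|phi x| by rewrite /s; field.
  have sphi0 : 0 <= s * `|phi x| by rewrite mulr_ge0// ltW.
  rewrite expRD expRM_natl; apply: ler_pM; rewrite ?sqr_ge0 ?expR_ge0 ?ler_expR//.
  by rewrite lerXn2r ?nnegrE ?expR_ge0// (le_trans _ (expR_ge1Dx _))// lerDr.
have exp_int : gauss_integrable (fun x => expR (xi * phi x)).
  apply: le_gauss_integrable s3_int => [|x].
    by apply: measurableT_comp => //; exact: measurable_funM.
  rewrite ger0_norm ?expR_ge0// ler_expR (le_trans (ler_norm _))// (le_trans (xi_phi x))//.
  by rewrite ler_wpM2r// /s; lra.
split => //.
have lin_int := gauss_integrableD (gauss_integrable_cst 1) (gauss_integrableZ xi phi_int).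
have rem_int := gauss_integrableZ (xi ^+ 2 * s ^- 2) s3_int.
apply: (@le_trans _ _ (gauss_mean (fun x =>
    1 + xi * phi x + xi ^+ 2 * s ^- 2 * expR (s3 * `|phi x|)))).
  apply: le_gauss_mean => // [|x]; first exact: gauss_integrableD.
  by apply: (le_trans (expR_le_quad _)); rewrite lerD2l; exact: remainder.
rewrite gauss_meanD// gauss_meanD ?gauss_mean_cst ?gauss_meanZ//; last 2 first.
- exact: gauss_integrable_cst.
- exact: gauss_integrableZ.
by apply: le_trans (expR_ge1Dx _); rewrite -/K -addrA [_ * xi ^+ 2]mulrC mulrA.
Qed.

Lemma certified_sum_lt (K : finType) (phi : K -> R -> R) :
  (forall k, subexponential (phi k)) -> exists C s : R,
  [/\ 0 <= C, 0 < s & forall xi, 0 < xi <= s -> forall N (kind : nat -> K) (T : R),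
    certified N (fun v => \sum_(i < N) phi (kind i) (v i) < T)
      (expR (xi * (\sum_(i < N) gauss_mean (phi (kind i)) - T) + C * xi ^+ 2 * N%:R))].
Proof.
move=> /(fun phi_sub k => subexponential_mgf (phi_sub k)) /choice[C /choice[s Cs]].
pose s0 := \big[Num.min/1]_k s k; pose C0 := \sum_k C k.
have Ck k : C k <= C0 by rewrite /C0 (bigD1 k)//= lerDl sumr_ge0// => j _; case: (Cs j).
exists C0, s0; split; first by apply: sumr_ge0 => k _; case: (Cs k).
  by apply/bigmin_gtP; split => // k _; case: (Cs k).
move=> xi /andP[xi0 xi_s] N kind T.
have xi_sk k : 0 <= xi <= s k by rewrite ltW//= (le_trans xi_s)//; exact: bigmin_le.
have mgf k := let: And3 _ _ mgf_k := Cs k in mgf_k xi (xi_sk k).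
pose psi i x := expR (xi * phi (kind i) x).
have psi_int i : gauss_integrable (psi i) by exact: (mgf (kind i)).1.
exists (fun v => expR (- (xi * T)) * \prod_(i < N) psi i (v i)); split.
- exact: iter_integrable_prod.
- by move=> v; rewrite mulr_ge0 ?expR_ge0// prodr_ge0// => i _; exact: expR_ge0.
- rewrite iter_mean_prod// mulrBr -addrA addrCA expRD ler_wpM2l ?expR_ge0//.
  apply: (@le_trans _ _ (\prod_(i < N) expR (xi * gauss_mean (phi (kind i)) + C0 * xi ^+ 2))).
    apply: ler_prod => i _; rewrite gauss_mean_ge0 => [|x]; last exact: expR_ge0.
    rewrite (le_trans (mgf (kind i)).2)// ler_expR lerD2l ler_wpM2r ?sqr_ge0//.
  by rewrite -expR_sum big_split/= -mulr_sumr sumr_const card_ord mulr_natr.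
- move=> v; rewrite /psi -expR_sum -expRD expR_lt1 -mulr_sumr -mulrN -mulrDr.
  by rewrite pmulr_rlt0// addrC subr_lt0.
Qed.

End chernoff.

Section overwhelming_probability.
Context {R : realType}.
Implicit Types (alpha beta : R) (n : nat).
Local Notation seq_event := (forall n, {set 'I_n} -> (nat -> R) -> Prop).

Lemma nfloor_le alpha n : 0 <= alpha -> (nfloor alpha n)%:R <= alpha * n%:R.
Proof. by move=> a0; rewrite truncn_le mulr_ge0. Qed.

Lemma nfloor_gt alpha n : alpha * n%:R < (nfloor alpha n)%:R + 1.
Proof. by rewrite natr1 truncnS_gt. Qed.

Lemma nfloor_dist alpha n : 0 <= alpha -> `|(nfloor alpha n)%:R - alpha * n%:R| <= 1.
Proof.
move=> a0; have := nfloor_le n a0; have := nfloor_gt alpha n.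
by rewrite ler_norml => *; apply/andP; split; lra.
Qed.

Lemma near_nfloor_gt0 alpha : 0 < alpha -> \forall n \near \oo, (0 < nfloor alpha n)%N.
Proof.
move=> a0; near=> n; rewrite -(ltr_nat R); have := nfloor_gt alpha n.
have : 1 / alpha <= n%:R by near: n; exact: nbhs_infty_ger.
by rewrite ler_pdivrMr// mulrC; lra.
Unshelve. all: by end_near. Qed.

Lemma near_expR_absorb (K c : R) : 0 < c ->
  \forall n \near \oo, K * expR (- (c * n%:R)) <= expR (- (c / 2 * n%:R)).
Proof.
move=> c0; near=> n; have : 2 * K / c <= n%:R by near: n; exact: nbhs_infty_ger.
rewrite ler_pdivrMr// => Kn.
have -> : - (c * n%:R) = - (c / 2 * n%:R) - c / 2 * n%:R by lra.
rewrite expRD mulrCA ler_piMr ?expR_ge0// expRN ler_pdivrMr ?expR_gt0// mul1r.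
by rewrite (le_trans _ (expR_ge1Dx _))//; lra.
Unshelve. all: by end_near. Qed.

(* [Q n S (g, h)] holds for normal vectors [g] and [h] of sizes [nfloor alpha n] and [n]
   outside an event of exponentially small probability. *)
Definition whp alpha beta (Q : seq_event) := exists2 c : R, 0 < c &
  \forall n \near \oo, forall S : {set 'I_n}, #|S| = nfloor beta n ->
    certified (nfloor alpha n + n) (Q n S) (expR (- (c * n%:R))).

Lemma whpW alpha beta (Q Q' : seq_event) : (forall n S e, Q n S e -> Q' n S e) ->
  whp alpha beta Q -> whp alpha beta Q'.
Proof.
move=> QQ' [c c0 Qc]; exists c => //; apply: filterS Qc => n certQ S cardS.
by apply: certifiedW (certQ S cardS) => // e; exact: QQ'.
Qed.

Lemma whpI alpha beta (Q Q' : seq_event) : whp alpha beta Q -> whp alpha beta Q' ->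
  whp alpha beta (fun n S e => Q n S e /\ Q' n S e).
Proof.
move=> [c c0 Qc] [c' c'0 Qc']; pose d := Num.min c c'.
have d0 : 0 < d by rewrite lt_min c0.
have dc x n : d <= x -> expR (- (x * n%:R)) <= expR (- (d * n%:R)).
  by move=> dx; rewrite ler_expR lerN2 ler_wpM2r.
exists (d / 2); first by rewrite divr_gt0.
apply: filterS3 Qc Qc' (near_expR_absorb 2 d0) => n certQ certQ' absorb S cardS.
apply: certifiedW (certifiedI (certQ S cardS) (certQ' S cardS)) => //; apply: le_trans absorb.
by rewrite mulr_natl mulr2n lerD// dc// ge_min lexx ?orbT.
Qed.

Lemma overwhelming_of_whp alpha beta (c : R) (Q : seq_event)
    (P : forall n (S : {set 'I_n}), set 'M[R]_(nfloor alpha n, n)) :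
  0 < c -> whp alpha beta Q ->
  (\forall n \near \oo, forall S : {set 'I_n}, #|S| = nfloor beta n -> forall d,
     certified (nfloor alpha n + n) (Q n S) d ->
     ((1 - d - expR (- ((c * Num.sqrt n%:R) ^+ 2 / 2)))%:E <= gauss_prob (P n S))%E) ->
  overwhelming alpha beta P.
Proof.
move=> c0 [c' c'0 Qc'] QP; pose d := Num.min c' (c ^+ 2 / 2).
have d0 : 0 < d by rewrite lt_min c'0 divr_gt0// exprn_gt0.
have [N _ NP] : \forall n \near \oo, forall S : {set 'I_n}, #|S| = nfloor beta n ->
    ((1 - expR (- (d / 2 * n%:R)))%:E <= gauss_prob (P n S))%E.
  apply: filterS3 Qc' QP (near_expR_absorb 2 d0) => n certQ certP absorb S cardS.
  apply: le_trans (certP S cardS _ (certQ S cardS)); rewrite lee_fin exprMn sqr_sqrtr//.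
  have dc x : d <= x -> expR (- (x * n%:R)) <= expR (- (d * n%:R)).
    by move=> dx; rewrite ler_expR lerN2 ler_wpM2r.
  have := dc c'; have := dc (c ^+ 2 / 2).
  by rewrite !ge_min !lexx !orbT mulrAC => /(_ isT) ? /(_ isT) ?; lra.
by exists (d / 2); split; [rewrite divr_gt0|exists N => n Nn; exact: NP].
Qed.

(* The block of coordinate [i] of [(g, h)]: [None] for [g], [Some true] for [h] on [S] and
   [Some false] for [h] off [S]. *)
Definition coord_kind m n (S : {set 'I_n}) (i : nat) : option bool :=
  if (i < m)%N then None else Some (if insub (i - m)%N is Some l then l \in S else false).

Lemma sum_coord_kind m n (S : {set 'I_n}) (F : option bool -> nat -> R) :
  \sum_(i < m + n) F (coord_kind m S i) i =
  \sum_(k < m) F None k + \sum_(l < n) F (Some (l \in S)) (m + l)%N.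
Proof.
rewrite big_split_ord/=; congr (_ + _); apply: eq_bigr => k _; rewrite /coord_kind /=.
  by rewrite ltn_ord.
by rewrite ltnNge leq_addr/= addKn (valK k).
Qed.

Lemma sum_in_set n (S : {set 'I_n}) (F : bool -> R) :
  \sum_(l < n) F (l \in S) = #|S|%:R * F true + (n%:R - #|S|%:R) * F false.
Proof.
have -> : n%:R - #|S|%:R = #|~: S|%:R :> R.
  by rewrite -[n in n%:R]card_ord -(cardsC S) natrD addrAC subrr add0r.
rewrite (bigID (mem S))/= (eq_bigr (fun=> F true)) => [|l ->//].
rewrite [X in _ + X](eq_bigr (fun=> F false)) => [|l /negbTE ->//].
rewrite !sumr_const -(mulr_natl (F true)) -(mulr_natl (F false)); congr (_ + _%:R * _).
by apply: eq_card => l; rewrite !inE.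
Qed.

Lemma dist_block_means alpha beta n (S : {set 'I_n}) (mean : option bool -> R) :
  0 <= alpha -> 0 <= beta -> #|S| = nfloor beta n ->
  `|\sum_(k < nfloor alpha n) mean None + \sum_(l < n) mean (Some (l \in S)) -
    (alpha * mean None + beta * mean (Some true) + (1 - beta) * mean (Some false)) * n%:R| <=
  `|mean None| + `|mean (Some true) - mean (Some false)|.
Proof.
move=> a0 b0 cardS; rewrite (sum_in_set S (mean \o some)) cardS.
rewrite sumr_const card_ord -(mulr_natl (mean None)) /=.
set M := (nfloor alpha n)%:R; set L := (nfloor beta n)%:R.
have -> : M * mean None + (L * mean (Some true) + (n%:R - L) * mean (Some false)) -
    (alpha * mean None + beta * mean (Some true) + (1 - beta) * mean (Some false)) * n%:R =
    (M - alpha * n%:R) * mean None + (L - beta * n%:R) * (mean (Some true) - mean (Some false)).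
  by ring.
by rewrite (le_trans (ler_normD _ _))// !normrM lerD// ler_piMl// nfloor_dist.
Qed.

Lemma whp_sum_lt alpha beta (phi : option bool -> R -> R) (T : R) :
  0 <= alpha <= 1 -> 0 <= beta -> (forall k, subexponential (phi k)) ->
  alpha * gauss_mean (phi None) + beta * gauss_mean (phi (Some true)) +
    (1 - beta) * gauss_mean (phi (Some false)) < T ->
  whp alpha beta (fun n S e => \sum_(k < nfloor alpha n) phi None (e k) +
    \sum_(l < n) phi (Some (l \in S)) (e (nfloor alpha n + l)%N) < T * n%:R).
Proof.
move=> /andP[a0 a1] b0 phi_sub; set mean := _ + _; rewrite -subr_gt0.
set gap := T - mean => gap0.
have [C [s [C0 s0 cert]]] := certified_sum_lt phi_sub.
pose xi := Num.min s (gap / (8 * (C + 1))).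
have C8 : 0 < 8 * (C + 1) by rewrite mulr_gt0// ltr_wpDl.
have xi0 : 0 < xi by rewrite lt_min s0 divr_gt0.
have xi_s : 0 < xi <= s by rewrite xi0 ge_min lexx.
have xi_gap : xi * (8 * (C + 1)) <= gap by rewrite -ler_pdivlMr// ge_min lexx orbT.
pose A : R := `|gauss_mean (phi None)| +
  `|gauss_mean (phi (Some true)) - gauss_mean (phi (Some false))|.
exists (xi * gap / 2); first by rewrite divr_gt0// mulr_gt0.
near=> n => S cardS; set m := nfloor alpha n.
have A_le : A <= gap / 4 * n%:R.
  have : 4 * A / gap <= n%:R by near: n; exact: nbhs_infty_ger.
  by rewrite ler_pdivrMr//; lra.
have m_le : m%:R <= n%:R :> R by rewrite (le_trans (nfloor_le n a0))// ler_piMl.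
apply: certifiedW (cert xi xi_s (m + n)%N (coord_kind m S) (T * n%:R)) => [e|].
  by rewrite (sum_coord_kind m S (fun k i => phi k (e i))).
rewrite ler_expR (sum_coord_kind m S (fun k _ => gauss_mean (phi k))).
have := dist_block_means (fun k => gauss_mean (phi k)) a0 b0 cardS.
rewrite -/m -/mean -/A ler_norml => /andP[_ mean_le].
have mean_gap : \sum_(k < m) gauss_mean (phi None) +
    \sum_(l < n) gauss_mean (phi (Some (l \in S))) - T * n%:R <= - (3 / 4 * gap * n%:R).
  by have gapE : T = gap + mean by [rewrite /gap subrK]; rewrite gapE; lra.
have := ler_wpM2l (ltW xi0) mean_gap.
have : C * xi ^+ 2 * (m + n)%:R <= xi * gap / 4 * n%:R.
  apply: (@le_trans _ _ (C * xi ^+ 2 * (2 * n%:R))).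
    by apply: ler_wpM2l; [rewrite mulr_ge0// sqr_ge0|rewrite natrD; lra].
  have -> : C * xi ^+ 2 * (2 * n%:R) = xi * (2 * C * xi) * n%:R by ring.
  rewrite ler_wpM2r//; have := ler_wpM2l (ltW xi0) xi_gap; have := sqr_ge0 xi.
  by rewrite expr2; lra.
by lra.
Unshelve. all: by end_near. Qed.

End overwhelming_probability.

Section row_vectors.
Context {R : realType}.
Implicit Types (m n : nat).

Definition row_dot n (x y : 'rV[R]_n) : R := (x *m y^T) 0 0.

Lemma row_dotE n (x y : 'rV[R]_n) : row_dot x y = \sum_k x 0 k * y 0 k.
Proof. by rewrite /row_dot mxE; apply: eq_bigr => k _; rewrite mxE. Qed.

Lemma row_dotC n (x y : 'rV[R]_n) : row_dot x y = row_dot y x.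
Proof. by rewrite !row_dotE; apply: eq_bigr => k _; rewrite mulrC. Qed.

Lemma row_dotDl n (x x' y : 'rV[R]_n) : row_dot (x + x') y = row_dot x y + row_dot x' y.
Proof. by rewrite /row_dot mulmxDl mxE. Qed.

Lemma row_dotZl n (a : R) (x y : 'rV[R]_n) : row_dot (a *: x) y = a * row_dot x y.
Proof. by rewrite /row_dot -scalemxAl mxE. Qed.

Lemma row_dotDr n (x y y' : 'rV[R]_n) : row_dot x (y + y') = row_dot x y + row_dot x y'.
Proof. by rewrite !(row_dotC x) row_dotDl. Qed.

Lemma row_dotZr n (a : R) (x y : 'rV[R]_n) : row_dot x (a *: y) = a * row_dot x y.
Proof. by rewrite !(row_dotC x) row_dotZl. Qed.

Lemma row_dot0r n (x : 'rV[R]_n) : row_dot x 0 = 0.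
Proof. by rewrite -(scale0r 0) row_dotZr mul0r. Qed.

Lemma row_dot_ge0 n (x : 'rV[R]_n) : 0 <= row_dot x x.
Proof. by rewrite row_dotE; apply: sumr_ge0 => k _; rewrite -expr2 sqr_ge0. Qed.

Lemma row_dot_gt0 n (x : 'rV[R]_n) : (0 < row_dot x x) = (x != 0).
Proof.
rewrite lt_def row_dot_ge0 andbT; congr (~~ _); apply/eqP/eqP => [|->]; last exact: row_dot0r.
rewrite row_dotE => /eqP; rewrite psumr_eq0 => [/allP x0|k _]; last by rewrite -expr2 sqr_ge0.
apply/rowP => k; rewrite mxE; apply/eqP.
by have := x0 k (mem_index_enum _); rewrite -expr2 sqrf_eq0.
Qed.

Lemma row_dot_sqrD n (a : R) (x y : 'rV[R]_n) : row_dot (x + a *: y) (x + a *: y) =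
  row_dot x x + 2 * a * row_dot x y + a ^+ 2 * row_dot y y.
Proof. by rewrite !(row_dotDl, row_dotDr, row_dotZl, row_dotZr) (row_dotC y x); ring. Qed.

Lemma ler_norm_row_dot_unit n (x w : 'rV[R]_n) : row_dot w w = 1 ->
  `|row_dot x w| <= Num.sqrt (row_dot x x).
Proof.
move=> w1; rewrite -sqrtr_sqr ler_wsqrtr// -subr_ge0.
have := row_dot_ge0 (x + (- row_dot x w) *: w).
by rewrite row_dot_sqrD w1 sqrrN; set a := row_dot x w; nra.
Qed.

Lemma row_dot_normalize n (x : 'rV[R]_n) : x != 0 ->
  let y := (Num.sqrt (row_dot x x))^-1 *: x in row_dot y y = 1.
Proof.
rewrite -row_dot_gt0 => x0; rewrite /= row_dotZl row_dotZr -{3}(sqr_sqrtr (ltW x0)).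
by field; rewrite gt_eqF// sqrtr_gt0.
Qed.

Definition seq_row n (w : nat -> R) : 'rV[R]_n := \row_(i < n) w i.

Lemma seq_row_surj n (x : 'rV[R]_n) : exists w, seq_row n w = x.
Proof.
exists (fun i => if insub i is Some k then x 0 k else 0).
by apply/rowP => k; rewrite mxE (valK k).
Qed.

Lemma dotE n z w : dot n z w = row_dot (seq_row n z) (seq_row n w).
Proof. by rewrite row_dotE; apply: eq_bigr => k _; rewrite !mxE. Qed.

Lemma bilin_formE m n z v w :
  bilin_form m n z v w = row_dot (seq_row m z) (seq_row n w *m (mat_of m n v)^T).
Proof.
rewrite row_dotE; apply: eq_bigr => k _; rewrite !mxE mulr_sumr.
by apply: eq_bigr => l _; rewrite !mxE; ring.
Qed.

Definition scaled_delta (a : R) (i k : nat) : R := a * (k == i)%:R.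

Lemma dot_scaled_delta n (a : R) i v : (i < n)%N -> dot n (scaled_delta a i) v = a * v i.
Proof.
move=> i_lt; rewrite /dot (bigD1 (Ordinal i_lt))//= /scaled_delta eqxx mulr1 big1 ?addr0// => k.
by rewrite -val_eqE => /negbTE /= ->; rewrite mulr0 mul0r.
Qed.

Lemma dot_unit_attained n (e : nat -> R) : (0 < n)%N ->
  exists2 y, dot n y y = 1 & dot n y e = Num.sqrt (dot n e e).
Proof.
move=> n0; rewrite dotE; have [e0|e_neq0] := eqVneq (seq_row n e) 0.
  exists (scaled_delta 1 0); first by rewrite dot_scaled_delta// /scaled_delta eqxx !mulr1.
  by rewrite dotE e0 !row_dot0r sqrtr0.
have [y yE] := seq_row_surj ((Num.sqrt (row_dot (seq_row n e) (seq_row n e)))^-1 *: seq_row n e).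
exists y; rewrite dotE yE; first exact: row_dot_normalize.
move: e_neq0; rewrite -row_dot_gt0 row_dotZl => e0.
by rewrite -[row_dot _ _ in X in _ * X]sqr_sqrtr ?ltW// expr2 mulKf// gt_eqF// sqrtr_gt0.
Qed.

End row_vectors.

Section projection.
Context {R : realType}.
Variables (m n : nat) (B : 'M[R]_(n, m)) (y : 'rV[R]_m).
Implicit Types (u w : 'rV[R]_n) (K C : set 'rV[R]_n).

Let continuous_residual :
  continuous (fun w => row_dot (y - w *m B) (y - w *m B)).
Proof.
have sum_cont (T : topologicalType) (I : finType) (F : I -> T -> R) :
    (forall i, continuous (F i)) -> continuous (fun x => \sum_i F i x).
  by move=> F_cont; apply: continuous_big => //; exact: add_continuous.
have entry_cont k : continuous (fun w : 'rV[R]_n => (y - w *m B) 0 k).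
  have -> : (fun w => (y - w *m B) 0 k) = (fun w => y 0 k - \sum_l w 0 l * B l k).
    by apply/funext => w; rewrite !mxE.
  move=> w; apply: continuousB; first exact: cst_continuous.
  apply: (sum_cont _ _ (fun l (w : 'rV[R]_n) => w 0 l * B l k)) => l w'.
  by apply: continuousM; [exact: coord_continuous|exact: cst_continuous].
rewrite (funext (fun w => row_dotE (y - w *m B) (y - w *m B))).
apply: (sum_cont _ _ (fun k w => (y - w *m B) 0 k * (y - w *m B) 0 k)) => k w.
by apply: continuousM; exact: entry_cont.
Qed.

Lemma compact_convex_projection K : compact K -> K !=set0 ->
  (forall u w t, K u -> K w -> 0 <= t <= 1 -> K (w + t *: (u - w))) ->
  exists2 w, K w & forall u, K u -> row_dot (y - w *m B) ((u - w) *m B) <= 0.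
Proof.
move=> cK K0 convexK.
have [w wK wmin] := compact_EVT_min K0 cK (continuous_subspaceT continuous_residual).
exists w => [|u uK]; first by rewrite inE in wK.
set r := y - w *m B; set d := (u - w) *m B; rewrite leNgt; apply/negP => rd0.
have step_ge t : 0 <= t <= 1 -> 2 * t * row_dot r d <= t ^+ 2 * row_dot d d.
  move=> t01; have := wmin (w + t *: (u - w)); rewrite !inE in wK *.
  move=> /(_ (convexK _ _ _ uK wK t01)).
  have -> : y - (w + t *: (u - w)) *m B = r + (- t) *: d.
    by rewrite /r /d mulmxDl opprD addrA scaleNr scalemxAl.
  by rewrite -/r row_dot_sqrD sqrrN; lra.
have dd0 := row_dot_ge0 d; pose t := Num.min 1 (row_dot r d / (row_dot d d + 1)).
have dd1 : 0 < row_dot d d + 1 by rewrite ltr_wpDl.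
have t0 : 0 < t by rewrite lt_min ltr01 divr_gt0.
have trd : t * (row_dot d d + 1) <= row_dot r d by rewrite -ler_pdivlMr// ge_min lexx orbT.
have := step_ge t; rewrite (ltW t0) ge_min lexx => /(_ isT).
by have := ler_wpM2l (ltW t0) trd; have := mulr_gt0 t0 rd0; have := mulr_gt0 t0 t0; nra.
Qed.

Lemma compact_closedI_ball C (radius : R) : closed C -> compact (C `&` [set w | `|w| <= radius]).
Proof.
move=> closedC; apply: bounded_closed_compact.
  exists radius; split => [|M radiusM w [_ /= w_le]]; first exact: num_real.
  exact: le_trans (ltW radiusM).
apply: closedI => //; apply: (@preimage_closed _ _ _ [set x : R | x <= radius]) => [w _|].
  exact: norm_continuous.
exact: closed_le.
Qed.

(* The projection of [y] onto the image of a large ball of the cone has no residual: along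
   its residual the cone would contain points with a larger inner product. *)
Lemma closed_cone_surjective C (c : R) : closed C -> C 0 ->
  (forall u w, C u -> C w -> C (u + w)) -> (forall a u, 0 <= a -> C u -> C (a *: u)) ->
  0 < c -> (forall z : 'rV[R]_m, row_dot z z = 1 ->
    exists w, [/\ C w, `|w| <= 1 & c <= row_dot z (w *m B)]) ->
  exists2 w, C w & w *m B = y.
Proof.
move=> closedC C0 addC scaleC c0 spread.
pose radius := (1 + row_dot y y) / (2 * c).
have radius0 : 0 <= radius by rewrite divr_ge0 ?mulr_ge0 ?addr_ge0 ?row_dot_ge0// ltW.
pose K := C `&` [set w | `|w| <= radius].
have convexK u w t : K u -> K w -> 0 <= t <= 1 -> K (w + t *: (u - w)).
  move=> [Cu /= u_le] [Cw /= w_le] /andP[t0 t1].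
  have -> : w + t *: (u - w) = (1 - t) *: w + t *: u.
    by rewrite scalerBr scalerBl scale1r addrA addrAC.
  split; first by apply: addC; apply: scaleC; rewrite ?subr_ge0.
  rewrite /= (le_trans (ler_normD _ _))// !normrZ (ger0_norm t0) ger0_norm ?subr_ge0//.
  have := ler_wpM2l t0 u_le; have := ler_wpM2l (_ : 0 <= 1 - t) w_le.
  by rewrite subr_ge0 => /(_ t1); lra.
have [|w [Cw w_le] w_proj] := compact_convex_projection (compact_closedI_ball closedC) _ convexK.
  by exists 0; split => //=; rewrite normr0.
exists w => //; apply/eqP; rewrite eq_sym -subr_eq0; apply/negPn/negP => residual.
pose r := y - w *m B; pose z := (Num.sqrt (row_dot r r))^-1 *: r.
have zz : row_dot z z = 1 by exact: row_dot_normalize.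
have r0 : 0 < Num.sqrt (row_dot r r) by rewrite sqrtr_gt0 row_dot_gt0.
have rz : r = Num.sqrt (row_dot r r) *: z by rewrite scalerA divff ?scale1r// gt_eqF.
have [u [Cu u_le zu]] := spread z zz.
have : row_dot z ((radius *: u - w) *m B) <= 0.
  have : K (radius *: u).
    by split; [exact: scaleC|rewrite /= normrZ ger0_norm// ler_piMr].
  by move=> /w_proj; rewrite -/r [in X in X -> _]rz row_dotZl pmulr_rle0.
have -> : (radius *: u - w) *m B = radius *: (u *m B) + (-1) *: (y + (-1) *: r).
  by rewrite mulmxBl -scalemxAl !scaleN1r /r subKr.
have zr : row_dot z r = Num.sqrt (row_dot r r) by rewrite [in LHS]rz row_dotZr zz mulr1.
rewrite row_dotDr !row_dotZr row_dotDr row_dotZr zr.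
have := row_dot_ge0 (z + (-1) *: y); rewrite row_dot_sqrD zz.
have := ler_wpM2l radius0 zu.
have -> : radius * c = (1 + row_dot y y) / 2 by rewrite /radius; field; rewrite gt_eqF.
by rewrite sqrrN expr1n; lra.
Qed.

End projection.

Section recovery_cone.
Context {R : realType}.
Variables (m n : nat) (S : {set 'I_n}) (A : 'M[R]_(m, n)).
Implicit Types (w : 'rV[R]_n) (x u : 'cV[R]_n).

Definition cone w := (forall i, i \notin S -> 0 <= w 0 i) /\ \sum_i w 0 i <= 0.

Lemma closed_cone : closed cone.
Proof.
have -> : cone = \bigcap_(i in [set i | i \notin S]) [set w | 0 <= w 0 i] `&`
    [set w | \sum_i w 0 i <= 0] by [].
apply: closedI; first apply: closed_bigI => i _.
  apply: (@preimage_closed _ _ (fun w => w 0 i) [set x | 0 <= x]) => [w _|].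
    exact: coord_continuous.
  exact: closed_ge.
apply: (@preimage_closed _ _ (fun w => \sum_i w 0 i) [set x | x <= 0]) => [w _|]; last first.
  exact: closed_le.
apply: continuous_big; first exact: add_continuous.
by move=> i _; exact: coord_continuous.
Qed.

Lemma cone0 : cone 0.
Proof. by split => [i _|]; [rewrite mxE|rewrite big1// => i _; rewrite mxE]. Qed.

Lemma coneD w w' : cone w -> cone w' -> cone (w + w').
Proof.
move=> [w0 sw] [w'0 sw']; split => [i iS|]; first by rewrite mxE addr_ge0 ?w0 ?w'0.
by under eq_bigr do rewrite mxE; rewrite big_split/= -[leRHS]addr0 lerD.
Qed.

Lemma coneZ (a : R) w : 0 <= a -> cone w -> cone (a *: w).
Proof.
move=> a0 [w0 sw]; split => [i iS|]; first by rewrite mxE mulr_ge0 ?w0.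
by under eq_bigr do rewrite mxE; rewrite -mulr_sumr mulr_ge0_le0.
Qed.

Lemma ge0_l1E x : (forall i, 0 <= x i 0) -> l1 x = \sum_i x i 0.
Proof. by move=> x0; apply: eq_bigr => i _; rewrite ger0_norm. Qed.

Lemma recovery_of_cone :
  (forall w, cone w -> w *m A^T = 0 -> w = 0) -> recovery_event m S A.
Proof.
move=> null_space x x_pos.
have x0 i : 0 <= x i 0.
  by have [xS xC] := x_pos i; have [/xS/ltW//|/xC ->] := boolP (i \in S).
split => // u [Au u0] ux; rewrite !ge0_l1E// ltNge; apply/negP => u_le.
apply: ux; apply: trmx_inj; apply/eqP; rewrite -subr_eq0 -linearB/=.
apply/eqP/null_space; last by rewrite -trmx_mul mulmxBr Au subrr trmx0.
split => [i iS|]; last by under eq_bigr do rewrite !mxE; rewrite sumrB subr_le0.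
by have [_ /(_ iS) xi] := x_pos i; rewrite !mxE xi subr0.
Qed.

Lemma failure_of_cone w : (forall i, i \notin S -> 0 <= w 0 i) -> \sum_i w 0 i < 0 ->
  w *m A^T = 0 -> failure_event m S A.
Proof.
move=> w0 sw Aw; pose b : R := 1 + \sum_i `|w 0 i|.
have b0 : 0 < b by rewrite ltr_wpDr// sumr_ge0.
have bw i : - w 0 i <= b.
  rewrite (le_trans (ler_norm _))// normrN /b (bigD1 i)//=.
  by rewrite addrCA lerDl addr_ge0// sumr_ge0.
pose x : 'cV[R]_n := \col_i (if i \in S then b else 0); pose u := x + w^T.
have x0 i : 0 <= x i 0 by rewrite mxE; case: ifP => // _; exact: ltW.
have u0 i : 0 <= u i 0.
  rewrite !mxE; case: ifPn => iS; last by rewrite add0r w0.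
  by have := bw i; lra.
have u_lt : l1 u < l1 x.
  rewrite !ge0_l1E// [ltLHS](eq_bigr (fun i => x i 0 + w 0 i)) => [|i _]; last by rewrite !mxE.
  by rewrite big_split/= gtrDl.
exists x; split => [i|[_ /(_ u) x_lt]]; first by rewrite mxE; split => [->//|/negbTE ->].
suff : l1 x < l1 u by rewrite ltNge ltW.
apply: x_lt => [|ux]; last by rewrite ux ltxx in u_lt.
split => //; rewrite mulmxDr -[X in _ + X]trmxK trmx_mul trmxK Aw.
by rewrite trmx0 addr0.
Qed.

Lemma failure_of_cone_surjective : S != finset.set0 ->
  (forall y : 'rV[R]_m, exists2 w, cone w & w *m A^T = y) -> failure_event m S A.
Proof.
move=> /set0Pn[i0 i0S] surj; pose ind : 'rV[R]_n := \row_i (i \in S)%:R.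
have [w [w0 sw] wA] := surj (ind *m A^T).
apply: (@failure_of_cone (w - ind)) => [i iS||]; last by rewrite mulmxBl wA subrr.
  by rewrite !mxE (negbTE iS) subr0 w0.
under eq_bigr do rewrite !mxE.
rewrite sumrB subr_lt0 (le_lt_trans sw)// (bigD1 i0)//= i0S ltr_pwDl//.
by apply: sumr_ge0 => i _; case: (i \in S).
Qed.

End recovery_cone.

Section error_function.
Context {R : realType}.
Implicit Types (a b t u x y c beta theta : R).
Local Notation mu := (@lebesgue_measure R).

Lemma le_gauss_tail t u : t <= u -> gauss_tail u <= gauss_tail t.
Proof.
move=> tu; apply: le_gauss_mean => [||x]; try exact: gauss_integrable_heaviside.
by rewrite ler_nat; case: (ltP u x) => // /(le_lt_trans tu) ->.
Qed.

Lemma gauss_tail_lt t u : gauss_tail u < gauss_tail t -> t < u.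
Proof. by apply: contraTT; rewrite -!leNgt; exact: le_gauss_tail. Qed.

Lemma gauss_tail_le_expR t : gauss_tail t <= expR (2^-1 - t).
Proof.
have -> : expR (2^-1 - t) = gauss_mean (fun x => expR (- t) * expR (1 * x)).
  rewrite gauss_meanZ ?gauss_mean_expR; last exact: gauss_integrable_expR.
  by rewrite -expRD; congr expR; lra.
apply: le_gauss_mean => [||x].
- exact: gauss_integrable_heaviside.
- by apply: gauss_integrableZ; exact: gauss_integrable_expR.
- rewrite -expRD mul1r /heaviside; case: (ltP t x) => tx; last exact: expR_ge0.
  by rewrite -expR0 ler_expR; lra.
Qed.

Lemma gauss_tail_Rintegral x : gauss_tail x = 1 - \int[mu]_(y in `]-oo, x]) gauss_pdf y.
Proof.
have heaviside_int := gauss_integrable_heaviside x.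
have comp_int : gauss_integrable (fun y => 1 + (-1) * heaviside x y).
  by apply: gauss_integrableD; [exact: gauss_integrable_cst|exact: gauss_integrableZ].
transitivity (1 - gauss_mean (fun y => 1 + (-1) * heaviside x y)).
  rewrite gauss_meanD ?gauss_mean_cst ?gauss_meanZ//; first by rewrite -/(gauss_tail x); ring.
  - exact: gauss_integrable_cst.
  - exact: gauss_integrableZ.
rewrite gauss_meanE// [in RHS]Rintegral_mkcond; congr (1 - _); apply: eq_Rintegral => y _.
rewrite patchE mem_setE in_itv/= /heaviside leNgt.
by case: (x < y) => /=; rewrite -?[point]/(0 : R); ring.
Qed.

Lemma is_derive_gauss_tail x : is_derive x 1 gauss_tail (- gauss_pdf x).
Proof.
have pdf_int : mu.-integrable `]-oo, (x + 1)%R] (EFin \o gauss_pdf).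
  apply: (integrableS measurableT) => //; apply: eq_integrable (gauss_integrable_pdf
    (gauss_integrable_cst 1)) => // y _; by rewrite mul1r.
have x1 : x < x + 1 by rewrite ltrDl.
have [|cdf_derivable cdf_derive] := continuous_FTC1 x1 pdf_int _ (@continuous_gauss_pdf R x).
  exact: ltNyr.
rewrite (funext gauss_tail_Rintegral) -cdf_derive derive1E -[- _]sub0r.
exact: is_deriveB (is_derive_cst _ _ _) (DeriveDef cdf_derivable erefl).
Qed.

Lemma continuous_gauss_tail : continuous (gauss_tail : R -> R).
Proof.
move=> x; apply: differentiable_continuous; apply/derivable1_diffP.
by case: (is_derive_gauss_tail x).
Qed.

Lemma gauss_tail_surj (p : R) : 0 < p < 1 -> exists t, gauss_tail t = p.
Proof.
move=> /andP[p0 p1].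
have expR_inv (q : R) : 0 < q -> expR (- q^-1) <= q.
  move=> q0; rewrite expRN -[leRHS]invrK lef_pV2 ?posrE ?expR_gt0 ?invr_gt0//.
  by rewrite (le_trans _ (expR_ge1Dx _))// lerDr.
pose T := 2^-1 + p^-1 + (1 - p)^-1.
have ip : 0 < p^-1 by rewrite invr_gt0.
have iq : 0 < (1 - p)^-1 by rewrite invr_gt0 subr_gt0.
have tailT q : 0 < q -> q^-1 <= T - 2^-1 -> gauss_tail T <= q.
  move=> q0 qT; apply: le_trans (expR_inv q q0); apply: le_trans (gauss_tail_le_expR T) _.
  by rewrite ler_expR; lra.
have [|||c _ <-] := @IVT R gauss_tail (- T) T p; last by exists c.
- by rewrite /T; lra.
- exact/continuous_subspaceT/continuous_gauss_tail.
- have := tailT p p0; have := tailT (1 - p); rewrite subr_gt0 => /(_ p1).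
  by rewrite gauss_tailN ge_min le_max /T => *; apply/andP; split; apply/orP; [right|left]; lra.
Qed.

Lemma gauss_pdf_sqrt2 u :
  Num.sqrt (1 / (2 * pi)) * expR (- u ^+ 2) = gauss_pdf (Num.sqrt 2 * u).
Proof.
rewrite gauss_pdfE mul1r sqrtrV ?mulr_ge0 ?pi_ge0//; congr (_ * expR _).
by rewrite exprMn sqr_sqrtr//; field.
Qed.

Let sqrt_pi_neq0 : Num.sqrt pi != 0 :> R.
Proof. by rewrite gt_eqF// sqrtr_gt0 pi_gt0. Qed.

Lemma Rintegral_expR_sqr a b : a <= b ->
  \int[mu]_(x in [set s | a <= s <= b]) expR (- x ^+ 2) =
  Num.sqrt pi * (gauss_tail (Num.sqrt 2 * a) - gauss_tail (Num.sqrt 2 * b)).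
Proof.
have -> : [set s | a <= s <= b] = `[a, b]%classic by apply/seteqP; split => x; rewrite /= in_itv.
rewrite le_eqVlt => /predU1P[<-|ab]; first by rewrite set_itv1 Rintegral_set1 subrr mulr0.
pose F x := - (Num.sqrt pi * gauss_tail (Num.sqrt 2 * x)).
have F_derive x : is_derive x 1 F (expR (- x ^+ 2)).
  have dilation : is_derive x 1 (fun y => Num.sqrt 2 * y) (Num.sqrt 2 : R).
    by apply: is_derive_eq; rewrite [LHS]mulr1.
  have tail_derive := @is_derive1_comp _ gauss_tail (fun y => Num.sqrt 2 * y) x _ _
    (is_derive_gauss_tail (Num.sqrt 2 * x)) dilation.
  apply: is_derive_eq (is_deriveN (is_deriveZ (Num.sqrt pi) tail_derive)) _.
  rewrite /= -gauss_pdf_sqrt2 mul1r sqrtrV ?mulr_ge0 ?pi_ge0// sqrtrM//.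
  rewrite /GRing.scale /=; field.
  by rewrite sqrt_pi_neq0 gt_eqF// sqrtr_gt0.
have F_cont : continuous F.
  by move=> x; apply: differentiable_continuous; apply/derivable1_diffP; case: (F_derive x).
rewrite /Rintegral (@continuous_FTC2 _ (fun x => expR (- x ^+ 2)) F)//=.
- by rewrite /F; ring.
- apply: continuous_subspaceT => x; apply: continuous_comp; last exact: continuous_expR.
  by apply: continuousN; exact: exprn_continuous.
- split => [x _||]; first by case: (F_derive x).
  + exact/cvg_at_right_filter/F_cont.
  + exact/cvg_at_left_filter/F_cont.
- by move=> x _; rewrite derive1E (@derive_val _ _ _ _ _ _ _ (F_derive x)).
Qed.

Lemma erfE u : erf u = 1 - 2 * gauss_tail (Num.sqrt 2 * u).
Proof.
rewrite /erf; case: ifPn => [u0|]; last rewrite -ltNge => /ltW u0.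
  by rewrite Rintegral_expR_sqr// mulr0 gauss_tail0 mulrA divfK//; field.
by rewrite Rintegral_expR_sqr// mulr0 gauss_tail0 mulrN mulrA divfK//; field.
Qed.

Lemma erfinvK y : -1 < y < 1 -> erf (erfinv y) = y.
Proof.
move=> /andP[y1 y2]; apply: (@xgetPex _ 0 [set u | erf u = y]).
have [|t tail_t] := @gauss_tail_surj ((1 - y) / 2); first by apply/andP; split; lra.
exists (t / Num.sqrt 2); rewrite /= erfE [Num.sqrt 2 * _]mulrC divfK ?tail_t; first lra.
by rewrite gt_eqF// sqrtr_gt0.
Qed.

Lemma gauss_tail_erfinv_earg c beta theta : -1 < earg c beta theta < 1 ->
  gauss_tail (Num.sqrt 2 * erfinv (earg c beta theta)) = 1 - c * (1 - theta) / (1 - beta).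
Proof. by move=> /erfinvK; rewrite erfE {2}/earg; lra. Qed.

End error_function.

Section recovery_probability.
Context {R : realType}.
Variables (m n : nat) (S : {set 'I_n}).
Hypotheses (m_gt0 : (0 < m)%N) (S_neq0 : S != finset.set0).
Implicit Types (k d : R) (e v w x y z : nat -> R) (Q : (nat -> R) -> Prop).

Definition unit_sphere : set (nat -> R) := [set z | dot m z z = 1].
Definition unit_cone : set (nat -> R) := [set w | dot n w w = 1 /\ cone S (seq_row n w)].

Lemma unit_sphere_neq0 : unit_sphere !=set0.
Proof.
exists (scaled_delta 1 0).
by rewrite /unit_sphere/= dot_scaled_delta// /scaled_delta eqxx !mulr1.
Qed.

Lemma unit_cone_neq0 : unit_cone !=set0.
Proof.
have /set0Pn[i iS] := S_neq0; exists (scaled_delta (-1) i); split.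
  by rewrite dot_scaled_delta ?ltn_ord// /scaled_delta eqxx mulr1 mulrNN mulr1.
split => [j jS|].
  rewrite mxE /scaled_delta; case: eqP => [/val_inj ji|_]; last by rewrite mulr0.
  by rewrite ji iS in jS.
by apply: sumr_le0 => j _; rewrite mxE /scaled_delta mulN1r oppr_le0 ler0n.
Qed.

Lemma unit_cone_normalize (u : 'rV[R]_n) : cone S u -> u != 0 ->
  exists2 w, unit_cone w & seq_row n w = (Num.sqrt (row_dot u u))^-1 *: u.
Proof.
move=> cone_u u_neq0; have [w wE] := seq_row_surj ((Num.sqrt (row_dot u u))^-1 *: u).
exists w => //; split; first by rewrite dotE wE; exact: row_dot_normalize.
by rewrite wE; apply: coneZ => //; rewrite invr_ge0 sqrtr_ge0.
Qed.

Lemma recovery_prob_ge k d Q : 0 < k -> certified (m + n) Q d ->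
  (forall e, Q e -> forall w, unit_cone w ->
     dot n w (seq_shift m e) + 5 * k <= Num.sqrt (dot m e e)) ->
  ((1 - d - expR (- (k ^+ 2 / 2)))%:E <= gauss_prob (recovery_event m S))%E.
Proof.
move=> k0 Q_certified Q_mesh.
apply: (@gordon_minmax _ n m m n unit_cone unit_sphere (fun _ y => y) (fun x _ i => - x i)
  unit_cone_neq0 unit_sphere_neq0 _ _ _ _ _ _ _ k d Q
  [set v | recovery_event m S (mat_of m n v)] k0 Q_certified) => //.
- by move=> x [x1 _] i; exact: ler_norm_unit_entry.
- by move=> y y1 i; exact: ler_norm_unit_entry.
- by move=> x y [x1 _] _; rewrite -x1; apply: eq_bigr => i _; rewrite mulrNN.
- by move=> x y y'; right.
- by move=> x x' y y' eta eta0 xx _ i; rewrite -opprD normrN; exact: xx.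
- move=> e Qe x cone_x; have [y y1 ye] := dot_unit_attained e m_gt0; exists y => //.
  have := Q_mesh e Qe x cone_x; rewrite ye.
  have -> : dot n (fun i => - x i) (seq_shift m e) = - dot n x (seq_shift m e).
    by rewrite /dot -sumrN; apply: eq_bigr => i _; rewrite mulNr.
  by lra.
- move=> v v_minmax; apply: recovery_of_cone => u cone_u uA.
  apply/eqP/negPn/negP => /(unit_cone_normalize cone_u)[x cone_x xE].
  have [y _] := v_minmax x cone_x; rewrite bilin_formE.
  have -> : seq_row n (fun i => - x i) = - seq_row n x by apply/rowP => i; rewrite !mxE.
  by rewrite xE mulNmx -scalemxAl uA scaler0 oppr0 row_dot0r leNgt divr_gt0.
Qed.

Lemma failure_prob_ge k d Q : 0 < k -> certified (m + n) Q d ->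
  (forall e, Q e -> exists2 w, unit_cone w &
     Num.sqrt (dot m e e) + 5 * k <= dot n w (seq_shift m e)) ->
  ((1 - d - expR (- (k ^+ 2 / 2)))%:E <= gauss_prob (failure_event m S))%E.
Proof.
move=> k0 Q_certified Q_mesh.
apply: (@gordon_minmax _ m n m n unit_sphere unit_cone (fun x _ => x) (fun _ y => y)
  unit_sphere_neq0 unit_cone_neq0 _ _ _ _ _ _ _ k d Q
  [set v | failure_event m S (mat_of m n v)] k0 Q_certified) => //.
- by move=> x x1 i; exact: ler_norm_unit_entry.
- by move=> y [y1 _] i; exact: ler_norm_unit_entry.
- by move=> x y _ [].
- by move=> x y y'; left.
- move=> e /Q_mesh[w cone_w w_ge] z z1; exists w => //.
  have := @ler_norm_row_dot_unit _ _ (seq_row m e) (seq_row m z).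
  by rewrite -!dotE => /(_ z1); rewrite dotE row_dotC -dotE ler_norml => /andP[? _]; lra.
- move=> v v_minmax; apply: failure_of_cone_surjective => // y.
  apply: (@closed_cone_surjective _ _ _ _ y _ (k / 2)).
  + exact: closed_cone.
  + exact: cone0.
  + by move=> u w; exact: coneD.
  + by move=> a u; exact: coneZ.
  + by rewrite divr_gt0.
  + move=> z z1; have [x xE] := seq_row_surj z.
    have [|w [w1 cone_w] w_ge] := v_minmax x; first by rewrite /unit_sphere/= dotE xE.
    exists (seq_row n w); split => //; last by rewrite -xE -bilin_formE.
    rewrite [leLHS]mx_normrE; apply/bigmax_leP; split => // -[i j] _ /=.
    by rewrite mxE; exact: ler_norm_unit_entry.
Qed.

End recovery_probability.

Section weak_threshold.
Context {R : realType}.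
Implicit Types (alpha beta t s x T : R) (n : nat).

Definition selector t (inS : bool) x : R := if inS then 1 else heaviside t x.

Definition selected_mass beta t : R := beta + (1 - beta) * gauss_tail t.
Definition weak_multiplier beta t : R := (1 - beta) * gauss_pdf t / selected_mass beta t.
Definition weak_threshold beta t : R :=
  selected_mass beta t + t * ((1 - beta) * gauss_pdf t) -
  ((1 - beta) * gauss_pdf t) ^+ 2 / selected_mass beta t.

Lemma selected_mass_gt0 beta t : 0 < beta < 1 -> 0 < selected_mass beta t.
Proof.
move=> /andP[b0 b1]; rewrite ltr_pwDl// mulr_ge0 ?subr_ge0 ?(ltW b1)//.
by apply: gauss_mean_ge0 => x; exact: heaviside_ge0.
Qed.

Lemma selector_ge0 t inS x : 0 <= selector t inS x.
Proof. by case: inS => //; exact: heaviside_ge0. Qed.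

Lemma selector_idem t inS x : selector t inS x * selector t inS x = selector t inS x.
Proof. by rewrite /selector /heaviside; case: inS (t < x) => [] []; rewrite ?mulr1 ?mulr0. Qed.

Lemma subexponential_selector t inS (phi : R -> R) : subexponential phi ->
  subexponential (fun x => selector t inS x * phi x).
Proof.
move=> phi_sub; case: inS; last exact: subexponential_heavisideM.
by rewrite /selector; under eq_fun do rewrite mul1r.
Qed.

Lemma gauss_mean_quad (a b c : R) : gauss_mean (fun x => a * x ^+ 2 + b * x + c) = a + c.
Proof.
have sqr_int := gauss_integrableZ a (@gauss_integrable_expn R 2).
have id_int := gauss_integrableZ b (@gauss_integrable_id R).
rewrite gauss_meanD; last 2 first.
- exact: gauss_integrableD.
- exact: gauss_integrable_cst.
rewrite gauss_meanD// gauss_mean_cst !gauss_meanZ ?gauss_mean_sqr ?gauss_mean_id.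
- by ring.
- exact: gauss_integrable_id.
- exact: gauss_integrable_expn.
Qed.

Lemma gauss_mean_heaviside_quad t (a b c : R) :
  gauss_mean (fun x => heaviside t x * (a * x ^+ 2 + b * x + c)) =
  a * (gauss_tail t + t * gauss_pdf t) + b * gauss_pdf t + c * gauss_tail t.
Proof.
have sqr_int := gauss_integrable_heavisideM t (@gauss_integrable_expn R 2).
have id_int := gauss_integrable_heavisideM t (@gauss_integrable_id R).
have one_int := @gauss_integrable_heaviside R t.
rewrite (@eq_gauss_mean _ _ (fun x =>
  a * (heaviside t x * x ^+ 2) + b * (heaviside t x * x) + c * heaviside t x)); last first.
  by move=> x; ring.
have sqr_intZ := gauss_integrableZ a sqr_int; have id_intZ := gauss_integrableZ b id_int.
rewrite gauss_meanD; [|exact: gauss_integrableD|exact: gauss_integrableZ].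
by rewrite gauss_meanD// !gauss_meanZ// gauss_mean_heaviside_sqr gauss_mean_heaviside_id.
Qed.

Definition selected_mean beta t (f : R -> R) : R :=
  beta * gauss_mean (fun x => selector t true x * f x) +
  (1 - beta) * gauss_mean (fun x => selector t false x * f x).

Lemma selected_mean_quad beta t (f : R -> R) (a b c : R) :
  (forall x, f x = a * x ^+ 2 + b * x + c) ->
  selected_mean beta t f = a * (selected_mass beta t + t * ((1 - beta) * gauss_pdf t)) +
    b * ((1 - beta) * gauss_pdf t) + c * selected_mass beta t.
Proof.
move=> /funext ->; rewrite /selected_mean gauss_mean_heaviside_quad /selector.
under eq_gauss_mean do rewrite mul1r.
by rewrite gauss_mean_quad /selected_mass; ring.
Qed.

Lemma weak_multiplierK beta t : 0 < beta < 1 ->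
  weak_multiplier beta t * selected_mass beta t = (1 - beta) * gauss_pdf t.
Proof. by move=> beta01; rewrite divfK// gt_eqF// selected_mass_gt0. Qed.

Lemma weak_thresholdE beta t : 0 < beta < 1 ->
  weak_threshold beta t = selected_mass beta t *
    (1 + t * weak_multiplier beta t - weak_multiplier beta t ^+ 2).
Proof.
move=> beta01; rewrite /weak_threshold -weak_multiplierK//; field.
by rewrite gt_eqF// selected_mass_gt0.
Qed.

Lemma weak_multiplier_gt0 beta t : 0 < beta < 1 -> 0 < weak_multiplier beta t.
Proof.
move=> beta01; have /andP[_ b1] := beta01.
by rewrite divr_gt0 ?selected_mass_gt0// mulr_gt0 ?subr_gt0// gauss_pdf_gt0.
Qed.

Lemma selected_mean_sqr beta t s : 0 < beta < 1 ->
  selected_mean beta t (fun x => (x - s) ^+ 2) =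
  weak_threshold beta t + selected_mass beta t * (s - weak_multiplier beta t) ^+ 2.
Proof.
move=> beta01; rewrite (@selected_mean_quad _ _ _ 1 (- 2 * s) (s ^+ 2)) => [|x]; last by ring.
by rewrite weak_thresholdE// -weak_multiplierK//; ring.
Qed.

(* The Chernoff bounds are upper-tail bounds, so lower bounds are taken on the negated sum. *)
Lemma selected_mean_mulN beta t s : 0 < beta < 1 ->
  selected_mean beta t (fun x => - (x * (x - s))) =
  (1 - beta) * gauss_pdf t * (s - weak_multiplier beta t) - weak_threshold beta t.
Proof.
move=> beta01; rewrite (@selected_mean_quad _ _ _ (-1) s 0) => [|x]; last by ring.
by rewrite weak_thresholdE// -weak_multiplierK//; ring.
Qed.

Lemma selected_mean_sub beta t s : 0 < beta < 1 ->
  selected_mean beta t (fun x => x - s) =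
  selected_mass beta t * (weak_multiplier beta t - s).
Proof.
move=> beta01; rewrite (@selected_mean_quad _ _ _ 0 1 (- s)) => [|x]; last by ring.
by rewrite -weak_multiplierK//; ring.
Qed.

Lemma weak_threshold_ge0 beta t : 0 < beta < 1 -> 0 <= weak_threshold beta t.
Proof.
move=> beta01; have := selected_mean_sqr t (weak_multiplier beta t) beta01.
rewrite subrr expr0n mulr0 addr0 => <-; have /andP[b0 b1] := beta01.
rewrite addr_ge0// mulr_ge0 ?subr_ge0 ?(ltW b0) ?(ltW b1)//; apply: gauss_mean_ge0 => x;
  by rewrite mulr_ge0 ?sqr_ge0// selector_ge0.
Qed.

Definition selected_sum n (S : {set 'I_n}) t (f : R -> R) (h : nat -> R) : R :=
  \sum_(l < n) selector t (l \in S) (h l) * f (h l).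

Lemma whp_selected_sum_lt alpha beta t (f : R -> R) (a b c T : R) :
  0 <= alpha <= 1 -> 0 <= beta -> (forall x, f x = a * x ^+ 2 + b * x + c) ->
  selected_mean beta t f < T ->
  whp alpha beta (fun n S e =>
    selected_sum S t f (seq_shift (nfloor alpha n) e) < T * n%:R).
Proof.
move=> alpha_itv beta0 fE mean_lt.
pose phi block x := if block is Some b then selector t b x * f x else 0.
apply: (@whpW _ _ _ (fun n S e => \sum_(k < nfloor alpha n) phi None (e k) +
  \sum_(l < n) phi (Some (l \in S)) (e (nfloor alpha n + l)%N) < T * n%:R)) => [n S e|].
  by rewrite big1// add0r.
apply: whp_sum_lt => // [[inS|]|].
- apply: (@subexponential_selector t inS f).
  by rewrite (funext fE); exact: subexponential_quad.
- have -> : phi None = fun x => 0 * x ^+ 2 + 0 * x + 0 by apply/funext => x /=; ring.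
  exact: subexponential_quad.
- by rewrite gauss_mean_cst mulr0 add0r.
Qed.

Lemma whp_dot_lt alpha beta (a T : R) : 0 <= alpha <= 1 -> 0 <= beta -> a * alpha < T ->
  whp alpha beta (fun n _ e => a * dot (nfloor alpha n) e e < T * n%:R).
Proof.
move=> alpha_itv beta0 aT.
pose phi (block : option bool) x : R := if block is Some _ then 0 else a * x ^+ 2 + 0 * x + 0.
apply: (@whpW _ _ _ (fun n (S : {set 'I_n}) e => \sum_(k < nfloor alpha n) phi None (e k) +
  \sum_(l < n) phi (Some (l \in S)) (e (nfloor alpha n + l)%N) < T * n%:R)) => [n S e|].
  rewrite [X in _ + X]big1// addr0 /dot mulr_sumr.
  by under eq_bigr do rewrite /phi mul0r !addr0 expr2.
apply: whp_sum_lt => // [[inS|]|].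
- have -> : phi (Some inS) = fun x => 0 * x ^+ 2 + 0 * x + 0 by apply/funext => x /=; ring.
  exact: subexponential_quad.
- exact: subexponential_quad.
- by rewrite gauss_mean_quad !gauss_mean_cst addr0 !mulr0 !addr0 mulrC.
Qed.

Definition truncated_row n (S : {set 'I_n}) t s (h : nat -> R) : 'rV[R]_n :=
  \row_l (selector t (l \in S) (h l) * (h l - s)).

Lemma row_dot_truncated_sqr n (S : {set 'I_n}) t s h :
  row_dot (truncated_row S t s h) (truncated_row S t s h) =
  selected_sum S t (fun x => (x - s) ^+ 2) h.
Proof.
by rewrite row_dotE; apply: eq_bigr => l _; rewrite mxE mulrACA selector_idem expr2.
Qed.

Lemma row_dot_truncated n (S : {set 'I_n}) t s h :
  row_dot (truncated_row S t s h) (seq_row n h) =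
  - selected_sum S t (fun x => - (x * (x - s))) h.
Proof. by rewrite row_dotE -sumrN; apply: eq_bigr => l _; rewrite !mxE; ring. Qed.

(* Subtracting the multiplier [s] of the constraint [\sum_i w i <= 0] increases the inner
   product; off [S] the entries [h l - s] with [h l <= t] are nonpositive. *)
Lemma cone_dot_le n (S : {set 'I_n}) t s h (w : 'rV[R]_n) : cone S w -> 0 <= s -> t <= s ->
  row_dot w (seq_row n h) <= row_dot w (truncated_row S t s h).
Proof.
move=> [w0 sw] s0 ts; rewrite !row_dotE.
apply: (@le_trans _ _ (\sum_l w 0 l * (h l - s))).
  under [leRHS]eq_bigr do rewrite mulrBr.
  rewrite sumrB -mulr_suml (eq_bigr (fun l => w 0 l * h l)) => [|l _]; last by rewrite mxE.
  by rewrite lerDl oppr_ge0 mulr_le0_ge0.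
apply: ler_sum => l _; rewrite mxE /selector; case: ifPn => [_|lS]; first by rewrite mul1r.
rewrite /heaviside; case: (ltP t (h l)) => [_|ht]; first by rewrite mul1r.
by rewrite mul0r mulr0 mulr_ge0_le0 ?w0//; lra.
Qed.

Lemma unit_cone_dot_le n (S : {set 'I_n}) t s h w : unit_cone S w -> 0 <= s -> t <= s ->
  dot n w h <= Num.sqrt (selected_sum S t (fun x => (x - s) ^+ 2) h).
Proof.
move=> [w1 cone_w] s0 ts; rewrite dotE (le_trans (cone_dot_le h cone_w s0 ts))//.
rewrite dotE in w1; have := ler_norm_row_dot_unit (truncated_row S t s h) w1.
by rewrite row_dot_truncated_sqr row_dotC; exact: le_trans (ler_norm _).
Qed.

Lemma unit_cone_dot_ge n (S : {set 'I_n}) t s h (a b : R) : s <= t -> 0 < a ->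
  selected_sum S t (fun x => x - s) h <= 0 ->
  a <= - selected_sum S t (fun x => - (x * (x - s))) h ->
  selected_sum S t (fun x => (x - s) ^+ 2) h <= b ->
  exists2 w, unit_cone S w & a / Num.sqrt b <= dot n w h.
Proof.
move=> st a0 sum_le0; rewrite -row_dot_truncated -row_dot_truncated_sqr.
set p := truncated_row S t s h => a_le b_ge.
have p_neq0 : p != 0.
  apply/eqP => p0; move: a_le; rewrite p0 row_dotC row_dot0r.
  by rewrite leNgt a0.
have cone_p : cone S p.
  split => [l lS|]; last by under eq_bigr do rewrite mxE.
  rewrite mxE (negbTE lS) /selector /heaviside; case: ltP => tx; last by rewrite mul0r.
  by rewrite mul1r subr_ge0 ltW// (le_lt_trans st).
have [w cone_w wE] := unit_cone_normalize cone_p p_neq0; exists w => //.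
have p0 : 0 < row_dot p p by rewrite row_dot_gt0.
rewrite dotE wE row_dotZl [leRHS]mulrC ler_pM ?invr_ge0 ?sqrtr_ge0 ?(ltW a0)//.
by rewrite lef_pV2 ?posrE ?sqrtr_gt0 ?ler_wsqrtr// (lt_le_trans p0).
Qed.

Lemma overwhelming_recovery alpha beta t : 0 < alpha < 1 -> 0 < beta < 1 ->
  t < weak_multiplier beta t -> weak_threshold beta t < alpha ->
  overwhelming alpha beta (fun n S => recovery_event (nfloor alpha n) S).
Proof.
move=> alpha01 beta01; have [/andP[a0 _] /andP[b0 _]] := (alpha01, beta01).
have alpha_itv : 0 <= alpha <= 1 by have /andP[/ltW -> /ltW ->] := alpha01.
set s := weak_multiplier beta t; set F := weak_threshold beta t => ts F_alpha.
have F0 : 0 <= F by exact: weak_threshold_ge0.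
pose r := F + (alpha - F) / 3; pose r' := F + 2 * (alpha - F) / 3.
have r0 : 0 <= r by rewrite /r; lra.
have r'0 : 0 < r' by rewrite /r'; lra.
pose c := (Num.sqrt r' - Num.sqrt r) / 5.
have c0 : 0 < c by rewrite divr_gt0// subr_gt0 ltr_sqrt// /r /r'; lra.
have sel_lt : selected_mean beta t (fun x => (x - s) ^+ 2) < r.
  by rewrite selected_mean_sqr// -/F subrr expr0n mulr0 addr0 /r; lra.
have whp_sel : whp alpha beta (fun n S e =>
    selected_sum S t (fun x => (x - s) ^+ 2) (seq_shift (nfloor alpha n) e) < r * n%:R).
  by apply: (@whp_selected_sum_lt _ _ _ _ 1 (- 2 * s) (s ^+ 2)) => // [|x]; [exact: ltW|ring].
have whp_dot : whp alpha beta (fun n _ e => -1 * dot (nfloor alpha n) e e < - r' * n%:R).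
  by apply: whp_dot_lt => //; [exact: ltW|rewrite /r'; lra].
apply: (overwhelming_of_whp c0 (whpI whp_sel whp_dot)).
apply: filterS3 (near_nfloor_gt0 a0) (near_nfloor_gt0 b0) (nbhs_infty_gt 0%N).
move=> n m0 k0 n0 S cardS d cert.
have S_neq0 : S != finset.set0 by rewrite -card_gt0 cardS.
have c_n0 : 0 < c * Num.sqrt n%:R by rewrite mulr_gt0// sqrtr_gt0 ltr0n.
apply: (recovery_prob_ge m0 S_neq0 c_n0 cert) => e [sel_e dot_e] w cone_w.
have s0 : 0 <= s by rewrite ltW// weak_multiplier_gt0.
have := unit_cone_dot_le (seq_shift (nfloor alpha n) e) cone_w s0 (ltW ts).
have := ler_wsqrtr (ltW sel_e); rewrite sqrtrM//.
have : Num.sqrt (r' * n%:R) <= Num.sqrt (dot (nfloor alpha n) e e).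
  by rewrite ler_wsqrtr//; lra.
by rewrite (sqrtrM _ (ltW r'0)) /c; lra.
Qed.

Lemma exists_failure_levels (alpha F s t p q : R) :
  0 <= alpha -> alpha < F -> s < t -> 0 <= p -> 0 <= q ->
  exists s' a k k', [/\ s < s' < t, alpha < a, p * (s' - s) - F < - k,
    F + q * (s' - s) ^+ 2 < k' & Num.sqrt a < k / Num.sqrt k'].
Proof.
move=> alpha0 alphaF st p0 q0; pose d := F - alpha.
have pq0 : 0 < 8 * (p + q + 1) by rewrite mulr_gt0// ltr_wpDl// addr_ge0.
pose eps := Num.min (Num.min ((t - s) / 2) 1) (d / (8 * (p + q + 1))).
have eps0 : 0 < eps by rewrite !lt_min ltr01 !divr_gt0// subr_gt0.
have eps_t : eps <= (t - s) / 2 by rewrite !ge_min lexx.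
have eps1 : eps <= 1 by rewrite !ge_min lexx orbT.
have eps_d : eps * (8 * (p + q + 1)) <= d by rewrite -ler_pdivlMr// !ge_min lexx orbT.
have p_eps := mulr_ge0 p0 (ltW eps0); have q_eps := mulr_ge0 q0 (ltW eps0).
have k0 : 0 < F - d / 4 by rewrite /d; lra.
have k'0 : 0 < F + d / 4 by lra.
have alphaE : alpha = F - d by rewrite /d; lra.
exists (s + eps), (alpha + d / 4), (F - d / 4), (F + d / 4); split => //.
- by apply/andP; split; lra.
- by lra.
- by rewrite addrAC subrr add0r; nra.
- by rewrite addrAC subrr add0r expr2; nra.
- rewrite ltr_pdivlMr ?sqrtr_gt0// -sqrtrM; last by lra.
  by rewrite -[ltRHS](gtr0_norm k0) -sqrtr_sqr ltr_sqrt ?exprn_gt0// alphaE; nra.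
Qed.

Lemma whp_selected_sums alpha beta t s (k k' : R) : 0 <= alpha <= 1 -> 0 < beta < 1 ->
  weak_multiplier beta t < s ->
  (1 - beta) * gauss_pdf t * (s - weak_multiplier beta t) - weak_threshold beta t < - k ->
  weak_threshold beta t + selected_mass beta t * (s - weak_multiplier beta t) ^+ 2 < k' ->
  whp alpha beta (fun n S e => let h := seq_shift (nfloor alpha n) e in
    [/\ selected_sum S t (fun x => x - s) h < 0,
        k * n%:R < - selected_sum S t (fun x => - (x * (x - s))) h &
        selected_sum S t (fun x => (x - s) ^+ 2) h < k' * n%:R]).
Proof.
move=> alpha_itv beta01 ss mul_lt sqr_lt; have /andP[b0 _] := beta01.
have whp_sub : whp alpha beta (fun n S e =>
    selected_sum S t (fun x => x - s) (seq_shift (nfloor alpha n) e) < 0 * n%:R).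
  apply: (@whp_selected_sum_lt _ _ _ _ 0 1 (- s)) => // [|x|]; [exact: ltW|by ring|].
  by rewrite selected_mean_sub// pmulr_rlt0 ?selected_mass_gt0// subr_lt0.
have whp_mul : whp alpha beta (fun n S e => selected_sum S t (fun x => - (x * (x - s)))
    (seq_shift (nfloor alpha n) e) < - k * n%:R).
  apply: (@whp_selected_sum_lt _ _ _ _ (-1) s 0) => // [|x|]; [exact: ltW|by ring|].
  by rewrite selected_mean_mulN.
have whp_sqr : whp alpha beta (fun n S e =>
    selected_sum S t (fun x => (x - s) ^+ 2) (seq_shift (nfloor alpha n) e) < k' * n%:R).
  apply: (@whp_selected_sum_lt _ _ _ _ 1 (- 2 * s) (s ^+ 2)) => // [|x|]; [exact: ltW|by ring|].
  by rewrite selected_mean_sqr.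
apply: whpW (whpI whp_sub (whpI whp_mul whp_sqr)) => n S e [].
by rewrite mul0r mulNr ltrNr => ? [].
Qed.

Lemma overwhelming_failure alpha beta t : 0 < alpha < 1 -> 0 < beta < 1 ->
  weak_multiplier beta t < t -> alpha < weak_threshold beta t ->
  overwhelming alpha beta (fun n S => failure_event (nfloor alpha n) S).
Proof.
move=> alpha01 beta01 st alphaF; have [/andP[a0 _] /andP[b0 b1]] := (alpha01, beta01).
have alpha_itv : 0 <= alpha <= 1 by have /andP[/ltW -> /ltW ->] := alpha01.
have g0 : 0 <= (1 - beta) * gauss_pdf t by rewrite mulr_ge0 ?gauss_pdf_ge0// subr_ge0 ltW.
have mass0 := ltW (selected_mass_gt0 t beta01).
have [s [a [k [k' [/andP[ss st'] alpha_a mul_lt sqr_lt sqrt_lt]]]]] :=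
  exists_failure_levels (ltW a0) alphaF st g0 mass0.
have k'0 : 0 < k'.
  by apply: le_lt_trans sqr_lt; rewrite addr_ge0 ?weak_threshold_ge0// mulr_ge0 ?sqr_ge0.
have k0 : 0 < k.
  by have := le_lt_trans (sqrtr_ge0 a) sqrt_lt; rewrite pmulr_lgt0 ?invr_gt0 ?sqrtr_gt0.
have whp_dot : whp alpha beta (fun n _ e => 1 * dot (nfloor alpha n) e e < a * n%:R).
  by apply: whp_dot_lt; rewrite ?mul1r// ltW.
have c0 : 0 < (k / Num.sqrt k' - Num.sqrt a) / 5 by rewrite divr_gt0// subr_gt0.
apply: (overwhelming_of_whp c0
  (whpI (whp_selected_sums alpha_itv beta01 ss mul_lt sqr_lt) whp_dot)).
apply: filterS3 (near_nfloor_gt0 a0) (near_nfloor_gt0 b0) (nbhs_infty_gt 0%N).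
move=> n m0 card0 n0 S cardS d cert.
have S_neq0 : S != finset.set0 by rewrite -card_gt0 cardS.
have n_gt0 : 0 < n%:R :> R by rewrite ltr0n.
have sqrt_n0 : 0 < Num.sqrt n%:R :> R by rewrite sqrtr_gt0.
apply: (failure_prob_ge m0 S_neq0 (mulr_gt0 c0 sqrt_n0) cert) => e.
rewrite mul1r => -[[sub_e mul_e sqr_e] dot_e].
have [w cone_w w_ge] := unit_cone_dot_ge (ltW st') (mulr_gt0 k0 n_gt0) (ltW sub_e) (ltW mul_e)
  (ltW sqr_e).
exists w => //; apply: le_trans w_ge; have := ler_wsqrtr (ltW dot_e).
have alpha_a0 : 0 <= a by rewrite ltW// (lt_trans a0).
rewrite !sqrtrM ?(ltW k'0)// invfM mulrACA -{3}[n%:R]sqr_sqrtr ?ler0n// expr2 mulfK ?gt_eqF//.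
by lra.
Qed.

End weak_threshold.

Section fixed_point.
Context {R : realType}.
Implicit Types (beta : R).

Lemma erf_pdfE beta (E : R) :
  (1 - beta) * Num.sqrt (1 / (2 * pi)) * expR (- E ^+ 2) =
  (1 - beta) * gauss_pdf (Num.sqrt 2 * E).
Proof. by rewrite -gauss_pdf_sqrt2 mulrA. Qed.

Lemma erf_pdf_mulE beta (E : R) :
  (1 - beta) / Num.sqrt (2 * pi) * (Num.sqrt (2 * E ^+ 2) / expR (E ^+ 2)) =
  `|Num.sqrt 2 * E| * ((1 - beta) * gauss_pdf (Num.sqrt 2 * E)).
Proof.
rewrite -gauss_pdf_sqrt2 (@sqrtrM _ 2 (E ^+ 2))// sqrtr_sqr normrM (ger0_norm (sqrtr_ge0 _)).
by rewrite -expRN mul1r sqrtrV ?mulr_ge0 ?pi_ge0//; ring.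
Qed.

Variables (beta c c' theta : R).
Hypotheses (beta01 : 0 < beta < 1) (sol : solves_eq c c' beta theta).
Let t := Num.sqrt 2 * erfinv (earg 1 beta theta).

Let onem_beta_gt0 : 0 < 1 - beta.
Proof. by have /andP[_] := beta01; rewrite subr_gt0. Qed.

Lemma solves_eq_mass : selected_mass beta t = theta.
Proof.
have [_ earg1 _ _] := sol.
by rewrite /selected_mass gauss_tail_erfinv_earg//; field; rewrite gt_eqF.
Qed.

Lemma solves_eq_tail : gauss_tail (c * weak_multiplier beta t) = 1 - c' * (1 - gauss_tail t).
Proof.
have [_ earg1 earg_c' eqn] := sol.
have -> : c * weak_multiplier beta t = Num.sqrt 2 * erfinv (earg c' beta theta).
  by move: eqn; rewrite gauss_pdf_sqrt2 -/t /weak_multiplier solves_eq_mass; lra.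
by rewrite !gauss_tail_erfinv_earg//; field; rewrite gt_eqF.
Qed.

Lemma solves_eq_tail_lt1 : gauss_tail t < 1.
Proof.
have [_ /[dup] /andP[+ _] earg1 _ _] := sol; rewrite gauss_tail_erfinv_earg// /earg; lra.
Qed.

Lemma lt_weak_multiplier : 0 < c <= 1 -> 1 < c' -> t < weak_multiplier beta t.
Proof.
move=> /andP[c0 c1] c'1; have := weak_multiplier_gt0 t beta01.
have := solves_eq_tail_lt1; have := solves_eq_tail => tail_eq tail1 s0.
apply: (@lt_le_trans _ _ (c * weak_multiplier beta t)); last by rewrite ler_piMl// ltW.
by apply: gauss_tail_lt; rewrite tail_eq; nra.
Qed.

Lemma weak_multiplier_lt : 1 <= c -> c' < 1 -> weak_multiplier beta t < t.
Proof.
move=> c1 c'1; have := weak_multiplier_gt0 t beta01.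
have := solves_eq_tail_lt1; have := solves_eq_tail => tail_eq tail1 s0.
apply: (@le_lt_trans _ _ (c * weak_multiplier beta t)); first by rewrite ler_peMl// ltW.
by apply: gauss_tail_lt; rewrite tail_eq; nra.
Qed.

End fixed_point.

Lemma lt_of_lt_perturbed (R : realFieldType) (alpha p q e1 e2 e3 : R) :
  0 <= p -> 0 <= q -> 0 < alpha -> 0 < e1 -> 0 < e2 -> 0 < e3 ->
  alpha < 1 / (1 + e1) ^+ 2 * ((1 - e2) * p - (1 + e3) ^+ 2 * q) -> alpha < p - q.
Proof.
move=> p0 q0 a0 e1_gt0 e2_gt0 e3_gt0.
have e1_sqr : 1 <= (1 + e1) ^+ 2 by rewrite expr2; nra.
rewrite mul1r mulrC ltr_pdivlMr ?(lt_le_trans _ e1_sqr)//.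
by nra.
Qed.

Theorem theorem5 (R : realType) (alpha beta : R)
  (e1c e2c e1m e1g e3g : R) :
  0 < alpha < 1 -> 0 < beta < 1 ->
  0 < e1c < 1 -> 0 < e2c < 1 -> 0 < e1m < 1 -> 0 < e1g < 1 -> 0 < e3g < 1 ->
  (* part (1) *)
  (forall theta : R,
     solves_eq (1 - e1c) (1 + e1c) beta theta ->
     (forall theta' : R, solves_eq (1 - e1c) (1 + e1c) beta theta' -> theta' = theta) ->
     let E := erfinv (earg 1 beta theta) in
     let G := (1 - beta) * Num.sqrt (1 / (2 * pi)) * expR (- E ^+ 2) in
     (1 - beta) / Num.sqrt (2 * pi) * (Num.sqrt (2 * E ^+ 2) / expR (E ^+ 2))
       + theta - G ^+ 2 / theta < alpha ->
     overwhelming alpha beta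
       (fun n S => recovery_event (nfloor alpha n) S)) /\
  (* part (2) *)
  (forall theta : R,
     solves_eq (1 + e2c) (1 - e2c) beta theta ->
     (forall theta' : R, solves_eq (1 + e2c) (1 - e2c) beta theta' -> theta' = theta) ->
     let E := erfinv (earg 1 beta theta) in
     let G := (1 - beta) * Num.sqrt (1 / (2 * pi)) * expR (- E ^+ 2) in
     alpha < 1 / (1 + e1m) ^+ 2 *
       ((1 - e1g) * (theta + (1 - beta) / Num.sqrt (2 * pi)
                              * (Num.sqrt (2 * E ^+ 2) / expR (E ^+ 2)))
        - (1 + e3g) ^+ 2 * (G ^+ 2 / theta)) ->
     overwhelming alpha beta
       (fun n S => failure_event (nfloor alpha n) S)).
Proof.
move=> alpha01 beta01 /andP[e1c0 e1c1] /andP[e2c0 _] /andP[e1m0 _] /andP[e1g0 _] /andP[e3g0 _].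
have /andP[a0 _] := alpha01; have /andP[_ b1] := beta01.
split=> theta sol _ E G; rewrite /G erf_pdfE erf_pdf_mulE -/E; set t := Num.sqrt 2 * E;
  have pdf0 : 0 <= (1 - beta) * gauss_pdf t by rewrite mulr_ge0 ?gauss_pdf_ge0// subr_ge0 ltW.
- have ts : t < weak_multiplier beta t.
    by apply: (lt_weak_multiplier beta01 sol); [apply/andP; split; lra|lra].
  move=> alpha_gt; apply: (overwhelming_recovery alpha01 beta01 ts); apply: le_lt_trans alpha_gt.
  by rewrite /weak_threshold (solves_eq_mass beta01 sol) lerD2r addrC lerD2r ler_wpM2r ?ler_norm.
- have st : weak_multiplier beta t < t by apply: (weak_multiplier_lt beta01 sol); lra.
  have t0 : 0 < t by apply: lt_trans st; exact: weak_multiplier_gt0.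
  have theta0 : 0 < theta by rewrite -(solves_eq_mass beta01 sol) selected_mass_gt0.
  rewrite (gtr0_norm t0) => alpha_lt; apply: (overwhelming_failure alpha01 beta01 st).
  rewrite /weak_threshold (solves_eq_mass beta01 sol).
  apply: lt_of_lt_perturbed alpha_lt => //.
    by rewrite addr_ge0 ?(ltW theta0)// mulr_ge0// ltW.
  by rewrite divr_ge0 ?sqr_ge0// ltW.
Qed.
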